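(* Let $X$ be a separable real Banach space having a separating function $Q:X\to[0,\infty)$ with a Lipschitz holomorphic extension $\widetilde{Q}$ defined on a set of the form $\{x+iy\in\widetilde{X}: x,y\in X,\ \|y\|<\delta\}$ for some $\delta>0$. Then there exists a number $C\geq 1$ such that for every Lipschitz function $f:X\to\mathbb{R}$ and every $\varepsilon>0$ there exists a Lipschitz, real analytic function $g:X\to\mathbb{R}$ such that $|f(x)-g(x)|<\varepsilon$ for all $x\in X$, and $\mathrm{Lip}(g)\leq C\,\mathrm{Lip}(f)$.
   Context: A separating function on a real Banach space $X$ is a function $Q:X\to[0,+\infty)$ such that $Q(0)=0$ and there exist $M,m>0$ with $Q(x)\geq m\|x\|$ whenever $\|x\|\geq M$. $\mathrm{Lip}(f)$ denotes the Lipschitz constant of $f$ on $X$. $\widetilde{X}=X\oplus iX$ is the (Taylor) complexification of $X$, with norm $\|x+iy\|_{\widetilde{X}}=\sup_{0\leq\theta\leq 2\pi}\|\cos\theta\,x-\sin\theta\,y\|_X$. A function $g:X\to\mathbb{R}$ is real analytic if for every $x\in X$ there are a neighbourhood $N_x$ of $x$ and continuous $n$-homogeneous polynomials $P_n^x:X\to\mathbb{R}$ (i.e. $P_n^x(h)=A(h,\dots,h)$ with $A$ continuous $n$-multilinear) such that $g(x+h)=\sum_{n\geq 0}P_n^x(h)$ whenever $x+h\in N_x$. *)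

(* Defs.v *)
From HB Require Import structures.
From mathcomp Require Import all_boot all_order all_algebra.
From mathcomp Require Import complex ring lra.
From mathcomp Require Import all_classical all_reals all_analysis.

Set Implicit Arguments.
Unset Strict Implicit.
Unset Printing Implicit Defensive.

Import Order.TTheory GRing.Theory Num.Theory.
Import numFieldNormedType.Exports.

Local Open Scope classical_set_scope.
Local Open Scope complex_scope.
Local Open Scope ring_scope.

Section Complexification.
Context {R : realType}.

(* The pair (x, y) stands for x + iy. This is an alias of the product type
   because X * X already carries its own (max) norm and R-module structure. *)
Definition complexification (X : normedModType R) : Type := (X * X)%type.

Variable X : normedModType R.
Local Notation XC := (complexification X).
Implicit Types (u v : XC) (z : R[i]).

HB.instance Definition _ := GRing.Zmodule.copy XC (X * X)%type.

Definition cscale z v : XC :=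
  (complex.Re z *: v.1 - complex.Im z *: v.2,
   complex.Im z *: v.1 + complex.Re z *: v.2).

Fact cscaleA z1 z2 v : cscale z1 (cscale z2 v) = cscale (z1 * z2) v.
Proof.
case: z1 z2 v => [a b] [c d] [x y]; rewrite /cscale /=; congr pair;
  rewrite !(scalerBr, scalerDr, scalerBl, scalerDl, scalerA).
  by rewrite opprD addrACA -opprD.
by rewrite addrACA addrC [X in X + _]addrC [X in _ + X]addrC addrC.
Qed.

Fact cscale1 : left_id 1 cscale.
Proof. by case=> x y; rewrite /cscale /= !scale1r !scale0r subr0 add0r. Qed.

Fact cscaleDr : right_distributive cscale +%R.
Proof.
move=> [a b] [x y] [x' y']; congr pair => /=.
  by rewrite !scalerDr opprD addrACA.
by rewrite !scalerDr addrACA.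
Qed.

Fact cscaleDl v : {morph cscale^~ v : z1 z2 / z1 + z2}.
Proof.
case: v => x y [a b] [c d]; congr pair => /=.
  by rewrite !scalerDl opprD addrACA.
by rewrite !scalerDl addrACA.
Qed.

HB.instance Definition _ := GRing.Zmodule_isLmodule.Build R[i] XC
  cscaleA cscale1 cscaleDr cscaleDl.

(* The supremum is over a nonempty bounded set, see norm_values_ubound. *)
Definition taylor_norm v : R :=
  sup [set `|cos t *: v.1 - sin t *: v.2| | t in `[0, 2 * pi]%classic].

Fact unit_circle_angle (c s : R) : c ^+ 2 + s ^+ 2 = 1 ->
  exists2 t, `[0, 2 * pi]%classic t & cos t = c /\ sin t = s.
Proof.
move=> cs1; have cB : -1 <= c <= 1.
  by rewrite -ler_norml -(@expr_le1 _ 2) // real_normK ?num_real// -cs1 lerDl sqr_ge0.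
have s2 : Num.sqrt (1 - c ^+ 2) = `|s| by rewrite -cs1 addrC addKr sqrtr_sqr.
have t0 := acos_ge0 cB; have tpi := acos_lepi cB.
have [s0|s0] := leP 0 s.
  exists (acos c); first by rewrite /= in_itv/= t0 (le_trans tpi)// ler_peMl ?pi_ge0// ler1n.
  by rewrite acosK ?in_itv// sin_acos// s2 ger0_norm.
exists (- acos c + pi *+ 2).
  have pi0 := pi_ge0 R; rewrite /= in_itv/=.
  by apply/andP; split; lra.
by rewrite cosD2pi sinD2pi cosN sinN acosK ?in_itv// sin_acos// s2 ltr0_norm// opprK.
Qed.

Let norm_values v := [set `|cos t *: v.1 - sin t *: v.2| | t in `[0, 2 * pi]%classic].

Fact norm_values_ubound v : has_ubound (norm_values v).
Proof.
exists (`|v.1| + `|v.2|) => _ [t _ <-].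
rewrite (le_trans (ler_normB _ _))// !normrZ lerD// ler_piMl//.
  by rewrite ler_norml cos_geN1 cos_le1.
by rewrite ler_norml sin_geN1 sin_le1.
Qed.

Fact norm_values_neq0 v : norm_values v !=set0.
Proof.
exists `|cos 0 *: v.1 - sin 0 *: v.2|; exists 0 => //=.
by rewrite in_itv/= lexx mulr_ge0// pi_ge0.
Qed.

Fact taylor_norm_ub v (c s : R) : c ^+ 2 + s ^+ 2 = 1 ->
  `|c *: v.1 - s *: v.2| <= taylor_norm v.
Proof.
move=> /unit_circle_angle[t t02 [<- <-]].
by apply: (ub_le_sup (norm_values_ubound v)); exists t.
Qed.

Fact taylor_norm_le v (M : R) :
  (forall c s, c ^+ 2 + s ^+ 2 = 1 -> `|c *: v.1 - s *: v.2| <= M) ->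
  taylor_norm v <= M.
Proof.
move=> vM; apply: (ge_sup (norm_values_neq0 v)) => _ [t _ <-].
by apply: vM; rewrite cos2Dsin2.
Qed.

Fact ler_taylor_normD u v : taylor_norm (u + v) <= taylor_norm u + taylor_norm v.
Proof.
apply: taylor_norm_le => c s cs1; rewrite /= !scalerDr opprD addrACA.
by rewrite (le_trans (ler_normD _ _))// lerD// taylor_norm_ub.
Qed.

Fact taylor_norm0_eq0 v : taylor_norm v = 0 -> v = 0.
Proof.
move=> v0; case: v v0 => x y v0; congr pair.
  apply/normr0_eq0/le_anti; rewrite normr_ge0 andbT -v0.
  have := @taylor_norm_ub (x, y) 1 0; rewrite /= scale1r scale0r subr0; apply.
  by rewrite expr1n expr0n addr0.
apply/normr0_eq0/le_anti; rewrite normr_ge0 andbT -v0.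
have := @taylor_norm_ub (x, y) 0 1; rewrite /= scale1r scale0r sub0r normrN.
by apply; rewrite expr1n expr0n add0r.
Qed.

Fact le_taylor_normZ z v :
  z != 0 -> taylor_norm (z *: v) <= complex.Re `|z| * taylor_norm v.
Proof.
case: z => a b z0; rewrite normc_def /=; set r := Num.sqrt _.
have ab_ge0 : 0 <= a ^+ 2 + b ^+ 2 by rewrite addr_ge0 ?sqr_ge0.
have r2 : r ^+ 2 = a ^+ 2 + b ^+ 2 by rewrite sqr_sqrtr.
have r_neq0 : r != 0.
  apply: contra z0 => /eqP r0; move: r2; rewrite r0 expr0n => /esym/eqP.
  rewrite paddr_eq0 ?sqr_ge0// !sqrf_eq0 => /andP[/eqP-> /eqP->].
  by rewrite eq_complex/= eqxx.
have r_gt0 : 0 < r by rewrite lt0r r_neq0 sqrtr_ge0.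
apply: taylor_norm_le => c s cs1; case: v => x y.
pose c' := (c * a - s * b) / r; pose s' := (c * b + s * a) / r.
have cs'1 : c' ^+ 2 + s' ^+ 2 = 1.
  rewrite /c' /s' !expr_div_n -mulrDl r2.
  suff -> : (c * a - s * b) ^+ 2 + (c * b + s * a) ^+ 2 =
            (c ^+ 2 + s ^+ 2) * (a ^+ 2 + b ^+ 2).
    by rewrite cs1 mul1r divff// -r2 sqrf_eq0.
  by rewrite !expr2; ring.
rewrite (_ : _ - _ = r *: (c' *: x - s' *: y)).
  by rewrite normrZ gtr0_norm// ler_pM2l// (@taylor_norm_ub (x, y)).
have rc' : r * c' = c * a - s * b by rewrite /c' mulrC divfK.
have rs' : r * s' = c * b + s * a by rewrite /s' mulrC divfK.
rewrite [RHS]scalerBr !scalerA rc' rs' /=.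
rewrite !(scalerBr, scalerDr, scalerBl, scalerDl, scalerA) !opprD addrACA.
by rewrite -!addrA.
Qed.

Fact taylor_normZ z v : taylor_norm (z *: v) = complex.Re `|z| * taylor_norm v.
Proof.
have [->|z0] := eqVneq z 0.
  rewrite scale0r normr0 /= mul0r; apply/eqP; rewrite eq_le; apply/andP; split.
    by apply: taylor_norm_le => c s _; rewrite /= !scaler0 subr0 normr0.
  have := @taylor_norm_ub 0 1 0; rewrite /= !scaler0 subr0 normr0; apply.
  by rewrite expr1n expr0n addr0.
have r_gt0 : 0 < complex.Re `|z|.
  by have := z0; rewrite -normr_gt0 ltcE => /andP[].
apply/le_anti; rewrite le_taylor_normZ//= -ler_pdivlMl//.
have zi0 : z^-1 != 0 by rewrite invr_eq0.
have := le_taylor_normZ (z *: v) zi0; rewrite scalerA mulVf// scale1r.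
suff -> : complex.Re `|z^-1| = (complex.Re `|z|)^-1 by [].
apply: (mulIf (lt0r_neq0 r_gt0)); rewrite mulVf ?lt0r_neq0//.
have : `|z^-1| * `|z| = 1 by rewrite -normrM mulVf// normr1.
by rewrite !normc_def /= => -[]; rewrite mulr0 subr0.
Qed.

Fact ler_taylor_normcD u v :
  (taylor_norm (u + v))%:C <= (taylor_norm u)%:C + (taylor_norm v)%:C.
Proof. by rewrite -rmorphD lecR ler_taylor_normD. Qed.

Fact taylor_normcZ z v : (taylor_norm (z *: v))%:C = `|z| * (taylor_norm v)%:C.
Proof. rewrite taylor_normZ rmorphM; congr (_ * _); exact: (RRe_real (normr_real z)). Qed.

Fact taylor_normc0_eq0 v : (taylor_norm v)%:C = 0 -> v = 0.
Proof. by move=> /complexI/taylor_norm0_eq0. Qed.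

(* Norms over R[i] are R[i]-valued: `|v| is the real number taylor_norm v seen
   as a complex number. *)
HB.instance Definition _ := Lmodule_isNormed.Build R[i] XC
  ler_taylor_normcD taylor_normcZ taylor_normc0_eq0.

End Complexification.

Definition separable_space (T : topologicalType) : Prop :=
  exists2 D : set T, countable D & dense D.

Section Notions.
Context {R : realType} (X : normedModType R).

Definition separating_function (Q : X -> R) : Prop :=
  [/\ forall x, 0 <= Q x, Q 0 = 0 &
      exists M m : R, [/\ 0 < M, 0 < m &
        forall x, M <= `|x| -> m * `|x| <= Q x]].

Definition strip (delta : R) : set (complexification X) :=
  [set z | `|z.2| < delta].

(* Complex Frechet differentiability; meant for open sets U. *)
Definition holomorphic_on (V W : normedModType R[i]) (U : set V) (F : V -> W) :=
  forall z, U z -> differentiable F z.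

(* The values of Qt outside the strip are irrelevant. *)
Definition has_lipschitz_holomorphic_extension (Q : X -> R) : Prop :=
  exists delta : R, 0 < delta /\
  exists Qt : complexification X -> R[i]^o,
    [/\ forall x : X, Qt (x, 0) = (Q x)%:C,
        holomorphic_on (strip delta) Qt &
        [lipschitz Qt z | z in strip delta]].

Definition multilinear n (A : ('I_n -> X) -> R) : Prop :=
  forall (u : 'I_n -> X) (i : 'I_n), scalar (fun x : X => A (dfwith u i x)).

Definition continuous_homogeneous_polynomial n (P : X -> R) : Prop :=
  exists A : {ptws 'I_n -> X} -> R,
    [/\ multilinear A, continuous A & forall h, P h = A (fun=> h)].

Definition real_analytic (g : X -> R) : Prop :=
  forall x : X, exists P : nat -> X -> R,
    (forall n, continuous_homogeneous_polynomial n (P n)) /\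
    (\forall h \near (0 : X), series (P ^~ h) @ \oo --> g (x + h)).

(* The diagonal pairs contribute 0 / 0 = 0, so that Lip f >= 0 even when X is
   the zero space. *)
Definition Lip (f : X -> R) : \bar R :=
  ereal_sup [set (`|f p.1 - f p.2| / `|p.1 - p.2|)%:E | p in [set: X * X]].

End Notions.

(* Main.v *)
Require Import Defs.
From HB Require Import structures.
From mathcomp Require Import all_boot all_order all_algebra.
From mathcomp Require Import complex ring lra.
From mathcomp Require Import all_classical all_reals all_analysis.
From mathcomp Require Import measurable_realfun.

Import Order.TTheory GRing.Theory Num.Theory.
Import numFieldNormedType.Exports.
Local Open Scope classical_set_scope.
Local Open Scope ring_scope.

Set Implicit Arguments.
Unset Strict Implicit.
Unset Printing Implicit Defensive.

(** Replacing f by x |-> f (s x) / (l s), where l is the Lipschitz constant of f and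
    s is small, reduces the theorem to a coarse form, [coarse_approximation]: for
    some constants C and E, each 1-Lipschitz f is within E of a C-Lipschitz
    analytic function g.

    Let the points x_n form a 1-net of X. Up to a bounded error, f is the infimum
    of the functions a_n (x) = f (x_n) + K Q (x - x_n), and g smoothes this
    infimum implicitly: t = g x is the solution of
      sum_n exp ((n + 1) (t - a_n x)) prod_(j < n) Phi (n 2^-j (t - u_j x)) = 1,
    where Phi is the Gaussian distribution function and
    u_j (x) = f (x_j) + K' (A - Q (x - x_j)) is at most f x far from x_j, and
    larger than g x near x_j. All terms are nondecreasing functions of t minus
    functions of x which have a common Lipschitz constant. The solution therefore
    has this Lipschitz constant too, without any estimate of derivatives and
    whatever the number of terms, and the constant does not depend on f. If x_j is
    close to x, the factor of index j damps all terms with n > j around x, so that the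
    sum is a convergent power series in t and x near the point considered. It
    grows with t at least like exp t, so that the solution is analytic by the
    implicit function theorem.

    Analyticity is handled by means of norms of power series. The germs at x that
    converge normally on the ball of radius r form a normed algebra,
    [analytic_germ_algebra]; so do power series over a normed algebra,
    [power_series_algebra]. The estimates [na_expR], [na_cdf_bounded] and
    [na_cdf_tail] in an arbitrary normed algebra replace estimates on a complex
    neighbourhood of X, and [analytic_implicit_function] is a fixed point argument
    in such an algebra.

    Complex analysis serves for Q only: its germs must have the same radius and
    the same norm at all points, [holomorphic_analytic_germ]. By the Cauchy
    formula, the derivative of a Lipschitz holomorphic function on a strip is an
    average of the function over circles, hence is again Lipschitz and
    holomorphic, on a smaller strip, [derivative_holomorphic_pair]. Spreading n
    derivatives over half of the width of the strip costs a factor n^n, which is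
    at most exp (n) n!, so that the Taylor coefficients grow geometrically, at a
    rate which does not depend on the point. *)

(** * Absolutely convergent real series *)

Section AbsoluteSeries.
Context {R : realType}.
Implicit Types (u v b c : nat -> R) (B C l : R).

Definition dominated_series u b B :=
  (forall k, `|u k| <= b k) /\ (forall n, series b n <= B).

Lemma cvg_dominated_series u b B : dominated_series u b B -> cvgn (series u).
Proof.
move=> [ub bB]; apply: normed_cvg.
have b0 k : 0 <= b k by exact: le_trans (normr_ge0 _) (ub k).
apply: (@series_le_cvg _ (fun k => `|u k|) b (fun=> normr_ge0 _) b0 ub).
apply: nondecreasing_is_cvgn; last by exists B => _ [n _ <-].
apply/nondecreasing_series => n _ _; exact: le_trans (normr_ge0 _) (ub n).
Qed.

Lemma dominated_series_ge0 u b B : dominated_series u b B ->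
  forall k, 0 <= b k.
Proof. by move=> [ub _] k; exact: le_trans (normr_ge0 _) (ub k). Qed.

Lemma norm_seriesB_le u b (m n : nat) : (forall k, `|u k| <= b k) ->
  (m <= n)%N -> `|series u n - series u m| <= series b n - series b m.
Proof.
move=> ub mn; rewrite !sub_series_geq//.
by apply: le_trans (ler_norm_sum _ _ _) _; apply: ler_sum.
Qed.

Lemma norm_series_le u b n : (forall k, `|u k| <= b k) ->
  `|series u n| <= series b n.
Proof.
by move=> ub; apply: le_trans (ler_norm_sum _ _ _) _; apply: ler_sum.
Qed.

Lemma cvg_norm_le (T : Type) (F : set_system T) (FF : ProperFilter F)
    (w : T -> R) l B : w @ F --> l ->
  (\forall t \near F, `|w t| <= B) -> `|l| <= B.
Proof.
move=> wl wB; have nl : (fun n => `|w n|) @ F --> `|l| by exact: cvg_norm.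
rewrite -(cvg_lim _ nl)//; apply: limr_le wB; apply/cvg_ex; exists `|l|; exact: nl.
Qed.

Lemma dominated_series_bound u b B l : dominated_series u b B ->
  series u @ \oo --> l -> `|l| <= B.
Proof.
move=> [ub bB] ul; apply: cvg_norm_le ul _; apply: nearW => n.
exact: le_trans (norm_series_le n ub) (bB n).
Qed.

Lemma series_le_lim b B n : (forall k, 0 <= b k) ->
  (forall n, series b n <= B) -> series b n <= limn (series b).
Proof.
move=> b0 bB; apply: nondecreasing_cvgn_le.
  by apply/nondecreasing_series => k _ _.
by apply: (@cvg_dominated_series _ b B); split=> // k; rewrite ger0_norm.
Qed.

Lemma dominated_series_tail u b B l m : dominated_series u b B ->
  series u @ \oo --> l -> `|l - series u m| <= limn (series b) - series b m.
Proof.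
move=> ubB ul; have [ub bB] := ubB.
have ulm : (fun n => series u n - series u m) @ \oo --> l - series u m.
  by apply: cvgB => //; exact: cvg_cst.
apply: cvg_norm_le ulm _; exists m => // n /= mn.
rewrite (le_trans (norm_seriesB_le ub mn))// lerD2r.
exact: series_le_lim (dominated_series_ge0 ubB) bB.
Qed.

Lemma cvgn_lim_tail b B : (forall k, 0 <= b k) ->
  (forall n, series b n <= B) ->
  (fun m => limn (series b) - series b m) @ \oo --> (0 : R).
Proof.
move=> b0 bB; rewrite -[X in _ --> X](subrr (limn (series b))).
apply: cvgB; first exact: cvg_cst.
by apply: (@cvg_dominated_series _ b B); split=> // k; rewrite ger0_norm.
Qed.

Lemma series_le_mono b m n : (forall k, 0 <= b k) -> (m <= n)%N ->
  series b m <= series b n.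
Proof. by move=> b0 mn; apply: nondecreasing_series. Qed.

Lemma cvg_series_finite_support u m :
  (forall k, (m <= k)%N -> u k = 0) -> series u @ \oo --> series u m.
Proof.
move=> u0; apply: cvg_near_cst; exists m => // n /= mn; apply/esym/eqP.
rewrite -subr_eq0 -opprB sub_series_geq// oppr_eq0 big_nat_cond big1// => k.
by move=> /andP[/andP[mk _] _]; exact: u0.
Qed.

Lemma cvgn_sum_ord (a : nat -> nat -> R) (g : nat -> R) M :
  (forall m, a m @ \oo --> g m) ->
  (fun N => \sum_(0 <= m < M) a m N) @ \oo --> \sum_(0 <= m < M) g m.
Proof.
move=> ag; elim: M => [|M IH].
  by rewrite big_nil; under eq_fun do rewrite big_nil; exact: cvg_cst.
rewrite big_nat_recr//=; under eq_fun do rewrite big_nat_recr//=.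
by apply: cvgD.
Qed.

Section DoubleSeries.
Variables (a b : nat -> nat -> R) (B : nat -> R) (C : R) (g p : nat -> R) (f : R).
Hypothesis ab : forall m n, `|a m n| <= b m n.
Hypothesis bB : forall m N, series (b m) N <= B m.
Hypothesis BC : forall M, series B M <= C.
Hypothesis ag : forall m, series (a m) @ \oo --> g m.
Hypothesis gf : series g @ \oo --> f.
Hypothesis ap : forall n, series (a ^~ n) @ \oo --> p n.

Let b0 m n : 0 <= b m n. Proof. exact: le_trans (normr_ge0 _) (ab m n). Qed.
Let B0 m : 0 <= B m.
Proof. by have := bB m 0; rewrite /series /= big_nil. Qed.

Let column_dominated N :
  dominated_series (fun m => \sum_(0 <= n < N) a m n) B C.
Proof.
split=> // m; apply: le_trans (bB m N).
exact: norm_series_le.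
Qed.

(** Dropping the rows beyond M changes both iterated sums by at most the tail of
    the series of B, and finitely many rows can be exchanged with the limit. *)
Lemma double_series_exchange : series p @ \oo --> f.
Proof.
have gB m : `|g m| <= B m by apply: (@dominated_series_bound (a m) (b m)).
apply/cvgrPdist_lt => e e0.
have /cvgrPdist_lt/(_ (e / 4))[|M _ HM] := cvgn_lim_tail B0 BC; first by lra.
have /= := HM M (leqnn _); rewrite sub0r normrN => tM.
have tMe : limn (series B) - series B M < e / 4.
  exact: le_lt_trans (ler_norm _) tM.
have /cvgrPdist_lt/(_ (e / 4))[|N0 _ HN] := @cvgn_sum_ord _ g M ag; first by lra.
exists N0 => // N /= /HN /= h.
have h1 : `|f - series g M| <= limn (series B) - series B M.
  exact: (@dominated_series_tail g B C).
have h2 : `|series p N - \sum_(0 <= m < M) series (a m) N|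
    <= limn (series B) - series B M.
  apply: (@dominated_series_tail (fun m => \sum_(0 <= n < N) a m n) B C) => //.
  rewrite /series /=.
  under eq_fun do rewrite exchange_big_nat //=.
  by apply: cvgn_sum_ord => n; exact: ap.
have -> : f - series p N = (f - series g M)
   + (\sum_(0 <= m < M) g m - \sum_(0 <= m < M) series (a m) N)
   - (series p N - \sum_(0 <= m < M) series (a m) N).
  by rewrite /series /=; ring.
rewrite (le_lt_trans (ler_normB _ _))//.
have := ler_normD (f - series g M)
  (\sum_(0 <= m < M) g m - \sum_(0 <= m < M) series (a m) N).
by lra.
Qed.

Lemma double_series_bound N : series (fun n => limn (series (b ^~ n))) N <= C.
Proof.
have bn_cvg n : cvgn (series (b ^~ n)).
  apply: (@cvg_dominated_series _ B C); split=> // m; rewrite ger0_norm//.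
  apply: le_trans (bB m n.+1); rewrite /series /= big_nat_recr//= lerDr.
  exact: sumr_ge0.
have H := @cvgn_sum_ord (fun n => series (b ^~ n)) _ N bn_cvg.
rewrite -[X in X <= _](cvg_lim _ H)//; apply: limr_le.
  by apply/cvg_ex; eexists; exact: H.
apply: nearW => M; apply: le_trans (BC M); rewrite /series /= exchange_big_nat//=.
by apply: ler_sum => m _; exact: bB.
Qed.

End DoubleSeries.

Section CauchyProduct.

Definition cauchy_product u v n : R := \sum_(0 <= k < n.+1) u k * v (n - k)%N.

Lemma series_cauchy_product u v M :
  series (cauchy_product u v) M = \sum_(0 <= k < M) u k * series v (M - k)%N.
Proof.
elim: M => [|M IH]; first by rewrite /series /= !big_nil.
rewrite seriesSr IH /cauchy_product [in LHS]big_nat_recr//= subnn addrA.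
rewrite -big_split/= [in RHS]big_nat_recr//= subSnn; congr (_ + _).
  apply: eq_big_nat => k /andP[_ kM].
  by rewrite -mulrDr subSn ?(ltnW kM)// seriesSr.
by rewrite seriesSr /series /= big_nil add0r.
Qed.

Variables (u b v c : nat -> R) (B C : R).
Hypotheses (ub : dominated_series u b B) (vc : dominated_series v c C).

Let b0 := dominated_series_ge0 ub.
Let c0 := dominated_series_ge0 vc.

Lemma series_cauchy_product_le n : series (cauchy_product b c) n <= B * C.
Proof.
rewrite series_cauchy_product.
apply: (@le_trans _ _ (series b n * C)).
  by rewrite mulr_suml; apply: ler_sum => k _; rewrite ler_wpM2l// vc.2.
rewrite ler_wpM2r ?ub.2//; apply: le_trans (vc.2 0%N).
by rewrite /series /= big_nil.
Qed.

Let series_cauchy_product_ge N M : (N.*2 <= M)%N ->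
  series b N * series c N <= series (cauchy_product b c) M.
Proof.
move=> NM; have NM' : (N <= M)%N by apply: leq_trans NM; rewrite -addnn leq_addr.
rewrite series_cauchy_product (big_cat_nat (n := N))//= mulr_suml.
apply: (@le_trans _ _ (\sum_(0 <= k < N) b k * series c (M - k)%N)).
  rewrite big_nat_cond [leRHS]big_nat_cond.
  apply: ler_sum => k /andP[/andP[_ kN] _]; rewrite ler_wpM2l//.
  apply: series_le_mono => //; rewrite leq_subRL; last first.
    exact: leq_trans (ltnW kN) NM'.
  by apply: leq_trans NM; rewrite -addnn leq_add2r ltnW.
rewrite lerDl; apply: sumr_ge0 => k _; rewrite mulr_ge0//.
exact: sumr_ge0.
Qed.

(** The partial sum of order M of the Cauchy product differs from the product
    of the partial sums by terms which lie off a triangle of side M; these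
    are dominated by the same terms for the majorants, which are what is left
    once the square of side M / 2 contained in the triangle is removed. *)
Lemma cvg_cauchy_product l l' : series u @ \oo --> l -> series v @ \oo --> l' ->
  series (cauchy_product u v) @ \oo --> l * l'.
Proof.
move=> ul vl.
pose bl : R := limn (series b); pose cl : R := limn (series c).
have bcvg : series b @ \oo --> bl.
  by apply: (@cvg_dominated_series b b B); split; [move=> k; rewrite ger0_norm|exact: ub.2].
have ccvg : series c @ \oo --> cl.
  by apply: (@cvg_dominated_series c c C); split; [move=> k; rewrite ger0_norm|exact: vc.2].
have key M : `|series u M * l' - series (cauchy_product u v) M|
    <= bl * cl - series (cauchy_product b c) M.
  have cl0 : 0 <= cl.
    by apply: le_trans (series_le_lim 0 c0 vc.2); rewrite /series /= big_nil.
  apply: (@le_trans _ _ (series b M * cl - series (cauchy_product b c) M)); last first.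
    by rewrite lerB// ler_wpM2r//; exact: series_le_lim ub.2.
  rewrite !series_cauchy_product /(series u) /(series b) /= !mulr_suml -!sumrB.
  apply: le_trans (ler_norm_sum _ _ _) _; apply: ler_sum => k _.
  rewrite -!mulrBr normrM ler_pM//; first exact: ub.1.
  exact: (@dominated_series_tail v c C).
have half_cvg : (fun M => bl * cl - series b M./2 * series c M./2) @ \oo --> (0 : R).
  rewrite -[X in _ --> X](subrr (bl * cl)); apply: cvgB; first exact: cvg_cst.
  have h2 : (fun M => M./2) @ \oo --> \oo.
    by move=> A [N _ NA]; exists N.*2 => // M /= NM; apply: NA => /=; rewrite geq_half_double.
  by apply: cvgM; [exact: cvg_comp h2 bcvg|exact: cvg_comp h2 ccvg].
have d0 : (fun M => series u M * l' - series (cauchy_product u v) M) @ \oo --> (0 : R).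
  apply: norm_cvg0 => //.
  apply: (@squeeze_cvgr _ _ _ _ (fun=> 0) (fun M => bl * cl - series b M./2 * series c M./2)) => //.
    apply: nearW => M; rewrite normr_ge0/= (le_trans (key M))// lerB//.
    by apply: series_cauchy_product_ge; rewrite -geq_half_double.
  exact: cvg_cst.
have -> : series (cauchy_product u v) = (fun M => series u M * l' -
   (series u M * l' - series (cauchy_product u v) M)).
  by apply/funext => M; rewrite subKr.
rewrite -[X in _ --> X]subr0; apply: cvgB => //.
by apply: cvgM => //; exact: cvg_cst.
Qed.

End CauchyProduct.
End AbsoluteSeries.

Lemma mean_value {R : realType} (f df : R -> R) (a b : R) :
  (forall x : R, is_derive x 1 f (df x)) -> a < b ->
  exists c, a < c < b /\ f b - f a = df c * (b - a).
Proof.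
move=> f' ab; have cf : continuous f.
  by move=> x; apply/differentiable_continuous/derivable1_diffP; case: (f' x).
have [c cab E] := MVT ab (fun x _ => f' x) (continuous_subspaceT cf).
by exists c; split=> //; move: cab; rewrite in_itv.
Qed.

Lemma derive_ge0_homo {R : realType} (f df : R -> R) (a b : R) :
  (forall x : R, is_derive x 1 f (df x)) -> (forall x, x < b -> 0 <= df x) ->
  a <= b -> f a <= f b.
Proof.
move=> f' df0; rewrite le_eqVlt => /predU1P[->//|ab].
have [c [/andP[ac cb] E]] := mean_value f' ab.
by rewrite -subr_ge0 E mulr_ge0 ?df0// subr_ge0 ltW.
Qed.

(** * Normed algebras of functions *)

(** [N f B] reads: f has norm at most B in a Banach algebra of functions on D.
    Working with upper bounds of norms, and with absolutely convergent sums in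
    place of completeness, spares the construction of the algebra itself. *)
Record normed_algebra (R : realType) (S : Type) (D : set S)
    (N : (S -> R) -> R -> Prop) : Prop := NormedAlgebra {
  na_cst : forall c, N (cst c) `|c|;
  na_mul : forall f g B C, N f B -> N g C -> N (fun s => f s * g s) (B * C);
  na_sum : forall f (F : nat -> S -> R) b B, (forall k, N (F k) (b k)) ->
    (forall n, series b n <= B) ->
    (forall s, D s -> series (F ^~ s) @ \oo --> f s) -> N f B;
  na_ge0 : forall f B, N f B -> 0 <= B;
  na_bound : forall f B s, D s -> N f B -> `|f s| <= B }.

Section NormedAlgebraTheory.
Context {R : realType} {S : Type} {D : set S} {N : (S -> R) -> R -> Prop}.
Hypothesis NA : normed_algebra D N.

(** Changing f outside of D, or enlarging the bound, is an instance of a countable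
    sum: the one with f as its only nonzero term. *)
Lemma na_ext f g B C : N f B -> (forall s, D s -> f s = g s) -> B <= C -> N g C.
Proof.
move=> fB fg BC.
apply: (na_sum NA (F := fun k => if k is 0 then f else cst 0)
                  (b := fun k => if k is 0 then B else 0)).
- by case=> [//|k]; have := na_cst NA 0; rewrite normr0.
- case=> [|n]; rewrite /series /=.
    by rewrite big_nil; exact: le_trans (na_ge0 NA fB) BC.
  by rewrite big_nat_recl// big1// addr0.
- move=> s Ds; rewrite -fg//.
  rewrite (_ : f s = series ((fun k => if k is 0 then f else cst 0) ^~ s) 1).
    by apply: cvg_series_finite_support => -[].
  by rewrite /series /= big_nat1.
Qed.

Lemma na_le f B C : N f B -> B <= C -> N f C.
Proof. by move=> fB; apply: na_ext fB _. Qed.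

Lemma na_zero : N (fun=> 0) 0.
Proof. by have := na_cst NA 0; rewrite normr0. Qed.

Lemma na_add f g B C : N f B -> N g C -> N (fun s => f s + g s) (B + C).
Proof.
move=> fB gC; pose F k := if k is 0 then f else if k is 1 then g else fun=> 0.
apply: (na_sum NA (F := F)
                  (b := fun k => if k is 0 then B else if k is 1 then C else 0)).
- by case=> [//|[//|k]]; exact: na_zero.
- have B0 := na_ge0 NA fB; have C0 := na_ge0 NA gC.
  case=> [|[|n]]; rewrite /series /= ?big_nil ?addr_ge0//.
    by rewrite big_nat1 lerDl.
  by rewrite !big_nat_recl// big1// addr0.
- move=> s Ds; rewrite (_ : f s + g s = series (F ^~ s) 2).
    by apply: cvg_series_finite_support => -[|[]].
  by rewrite /series /= big_nat_recr// big_nat1.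
Qed.

Lemma na_scale c f B : N f B -> N (fun s => c * f s) (`|c| * B).
Proof. by move=> fB; exact: (na_mul NA (na_cst NA c) fB). Qed.

Lemma na_opp f B : N f B -> N (fun s => - f s) B.
Proof.
move=> /(na_scale (-1)); rewrite normrN1 mul1r => /na_ext; apply => // s _.
by rewrite mulN1r.
Qed.

Lemma na_sub f g B C : N f B -> N g C -> N (fun s => f s - g s) (B + C).
Proof. by move=> fB /na_opp; exact: na_add. Qed.

Lemma na_exp f B n : N f B -> N (fun s => f s ^+ n) (B ^+ n).
Proof.
move=> fB; elim: n => [|n IH]; last first.
  apply: na_ext (na_mul NA fB IH) _ _ => [s _|]; by rewrite exprS.
by have := na_cst NA 1; rewrite normr1 => /na_ext; apply.
Qed.

Lemma na_prod (F : nat -> S -> R) b n : (forall k, (k < n)%N -> N (F k) (b k)) ->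
  N (fun s => \prod_(0 <= k < n) F k s) (\prod_(0 <= k < n) b k).
Proof.
elim: n => [_|n IH Fb].
  rewrite big_nil; have := na_cst NA 1; rewrite normr1 => /na_ext; apply => // s _.
  by rewrite big_nil.
rewrite big_nat_recr//=; apply: na_ext (na_mul NA _ (Fb n _)) _ _ => //.
  by apply: IH => k kn; apply: Fb; exact: leqW.
by move=> s _; rewrite big_nat_recr.
Qed.

(** The norm of the exponential of x + f, x constant, is at most exp (x + |f|):
    the constant part enters with its sign. *)
Lemma na_expR x f B : N f B -> N (fun s => expR (x + f s)) (expR (x + B)).
Proof.
move=> fB; have eB : N (fun s => expR (f s)) (expR B).
  apply: (na_sum NA (F := fun k s => exp_coeff (f s) k) (b := exp_coeff B)).
  - move=> k; rewrite /exp_coeff /=.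
    have := na_scale (k`!%:R^-1) (na_exp k fB).
    rewrite ger0_norm ?invr_ge0// => /na_ext; apply => [s _|]; by rewrite mulrC.
  - move=> n; rewrite /expR; apply: series_le_lim => [k|m].
      by rewrite /exp_coeff /= divr_ge0// exprn_ge0// (na_ge0 NA fB).
    apply: nondecreasing_cvgn_le; last exact: is_cvg_series_exp_coeff.
    apply/nondecreasing_series => k _ _.
    by rewrite /exp_coeff /= divr_ge0// exprn_ge0// (na_ge0 NA fB).
  - by move=> s _; exact: is_cvg_series_exp_coeff.
apply: na_ext (na_scale (expR x) eB) _ _ => [s _|]; rewrite expRD//.
by rewrite ger0_norm ?expR_ge0.
Qed.

End NormedAlgebraTheory.

(** * Algebras of absolutely convergent graded series *)

(** [G n p b]: p is homogeneous of degree n, of norm at most b. *)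
Record graded_algebra (R : realType) (S : Type) (D : set S)
    (G : nat -> (S -> R) -> R -> Prop) : Prop := GradedAlgebra {
  ga_cst : forall c, G 0 (cst c) `|c|;
  ga_zero : forall n, G n (cst 0) 0;
  ga_mul : forall m n f g B C, G m f B -> G n g C ->
    G (m + n)%N (fun s => f s * g s) (B * C);
  ga_sum : forall n f (F : nat -> S -> R) b B, (forall k, G n (F k) (b k)) ->
    (forall m, series b m <= B) ->
    (forall s, D s -> series (F ^~ s) @ \oo --> f s) -> G n f B;
  ga_ge0 : forall n f B, G n f B -> 0 <= B;
  ga_bound : forall n f B s, D s -> G n f B -> `|f s| <= B }.

Definition graded_sum (R : realType) (S : Type) (D : set S)
    (G : nat -> (S -> R) -> R -> Prop) (f : S -> R) (B : R) : Prop :=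
  exists (P : nat -> S -> R) (b : nat -> R),
    [/\ forall n, G n (P n) (b n), forall n, series b n <= B &
        forall s, D s -> series (P ^~ s) @ \oo --> f s].

Section GradedSum.
Context {R : realType} {S : Type} {D : set S} {G : nat -> (S -> R) -> R -> Prop}.
Hypothesis GA : graded_algebra D G.

Lemma ga_finite_sum n m (F : nat -> S -> R) b :
  (forall k, (k < m)%N -> G n (F k) (b k)) ->
  G n (fun s => \sum_(0 <= k < m) F k s) (\sum_(0 <= k < m) b k).
Proof.
move=> Fb.
pose F' k := if (k < m)%N then F k else cst 0.
pose b' k := if (k < m)%N then b k else 0.
have F'b' k : G n (F' k) (b' k).
  by rewrite /F' /b'; case: ifPn => [/Fb//|_]; exact: (ga_zero GA).
have b'E p : (p <= m)%N -> \sum_(0 <= k < p) b k = series b' p.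
  move=> pm; rewrite /series /=; apply: eq_big_nat => k /andP[_ km].
  by rewrite /b' (leq_trans km pm).
apply: (ga_sum GA F'b').
- move=> p; rewrite b'E//; have [pm|mp] := leqP p m.
    by apply: (series_le_mono _ pm) => k; exact: (ga_ge0 GA (F'b' k)).
  rewrite -subr_le0 sub_series_geq ?(ltnW mp)// big_nat_cond big1// => k.
  by move=> /andP[/andP[mk _] _]; rewrite /b' ltnNge mk.
- move=> s _; have -> : \sum_(0 <= k < m) F k s = series (F' ^~ s) m.
    by rewrite /series /=; apply: eq_big_nat => k /andP[_ km]; rewrite /F' km.
  by apply: cvg_series_finite_support => k mk; rewrite /F' ltnNge mk.
Qed.

Lemma graded_sum_dominated P b B s : D s ->
  (forall n, G n (P n) (b n)) -> (forall n, series b n <= B) ->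
  dominated_series (P ^~ s) b B.
Proof. by move=> Ds Pb bB; split=> // k; exact: (ga_bound GA Ds (Pb k)). Qed.

Lemma graded_sum_homogeneous n f B : G n f B -> graded_sum D G f B.
Proof.
move=> fB; have B0 := ga_ge0 GA fB.
exists (fun k => if k == n then f else cst 0), (fun k => if k == n then B else 0).
have sumE (V : nmodType) (x : V) m :
    \sum_(0 <= k < m) (if k == n then x else 0) = if (n < m)%N then x else 0.
  by rewrite -big_mkcond/= big_nat1_eq.
split.
- by move=> k; case: eqP => [->//|_]; exact: (ga_zero GA).
- by move=> m; rewrite /series /= sumE; case: ifP.
- move=> s _; apply: cvg_near_cst; exists n.+1 => // m /= nm; apply/eqP.
  rewrite /series /= (eq_bigr (fun k => if k == n then f s else 0)) ?sumE ?nm//.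
  by move=> k _; case: eqP.
Qed.

(** Products are Cauchy products and countable sums are regrouped by degree, which
    absolute convergence allows in both cases. *)
Theorem graded_sum_normed_algebra : normed_algebra D (graded_sum D G).
Proof.
split.
- by move=> c; apply: graded_sum_homogeneous (ga_cst GA c).
- move=> f g B C [P [b [Pb bB Pf]]] [Q [c [Qc cC Qg]]].
  exists (fun n s => cauchy_product (P ^~ s) (Q ^~ s) n), (cauchy_product b c).
  have b0 k : 0 <= b k by exact: (ga_ge0 GA (Pb k)).
  have c0 k : 0 <= c k by exact: (ga_ge0 GA (Qc k)).
  split.
  + move=> n; apply: ga_finite_sum => k; rewrite ltnS => kn.
    by rewrite -[X in G X](subnKC kn); exact: (ga_mul GA).
  + move=> n; apply: (@series_cauchy_product_le _ b b c c) => //; split=> // k.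
      by rewrite ger0_norm.
    by rewrite ger0_norm.
  + move=> s Ds; apply: cvg_cauchy_product; [|
      exact: (graded_sum_dominated Ds Qc)|exact: Pf|exact: Qg].
    exact: (graded_sum_dominated Ds Pb bB).
- move=> f F b B Fb bB Ff.
  have /choice[P /choice[d PdF]] : forall k, exists P, exists d,
     [/\ forall n, G n (P n) (d n), forall n, series d n <= b k &
        forall s, D s -> series (P ^~ s) @ \oo --> F k s] by [].
  have Gd k n : G n (P k n) (d k n) by case: (PdF k).
  have db k n : series (d k) n <= b k by case: (PdF k).
  have PF k s : D s -> series (P k ^~ s) @ \oo --> F k s by case: (PdF k) => ? ?; apply.
  have d0 k n : 0 <= d k n by exact: (ga_ge0 GA (Gd k n)).
  have dcol k n : `|d k n| <= b k.
    rewrite ger0_norm//; apply: le_trans (db k n.+1); rewrite seriesSr lerDr.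
    exact: sumr_ge0.
  have dn n m : series (d ^~ n) m <= limn (series (d ^~ n)).
    apply: nondecreasing_cvgn_le; first by apply/nondecreasing_series.
    exact: (@cvg_dominated_series _ _ b B).
  exists (fun n s => limn (series (fun k => P k n s))), (fun n => limn (series (d ^~ n))).
  have Pcvg n s : D s -> cvgn (series (fun k => P k n s)).
    move=> Ds; apply: (@cvg_dominated_series _ _ (d ^~ n) (limn (series (d ^~ n)))).
    split=> [k|m]; last exact: dn.
    by exact: (ga_bound GA Ds (Gd k n)).
  split.
  + move=> n; apply: (ga_sum GA (F := fun k => P k n) (b := d ^~ n)) => // s Ds.
    exact: Pcvg.
  + move=> n; apply: (@double_series_bound _ d d b B) => // k m.
    by rewrite ger0_norm.
  + move=> s Ds; apply: (@double_series_exchange _ (fun k n => P k n s) d b B (F ^~ s)) => //.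
    * by move=> k n; exact: (ga_bound GA Ds (Gd k n)).
    * by move=> k; exact: PF.
    * exact: Ff.
    * by move=> n; exact: Pcvg.
- by move=> f B [P [b [Pb bB _]]]; have := bB 0%N; rewrite /series /= big_nil.
- move=> f B s Ds [P [b [Pb bB Pf]]].
  exact: dominated_series_bound (graded_sum_dominated Ds Pb bB) (Pf _ Ds).
Qed.

End GradedSum.

(** * Power series with coefficients in a normed algebra *)

Section PowerSeries.
Context {R : realType} {S : Type}.
Variables (D : set S) (N : (S -> R) -> R -> Prop) (rho : R).
Hypothesis NA : normed_algebra D N.
Hypothesis rho0 : 0 < rho.

(** Power series in a real variable t with |t| <= rho are graded by the degree in
    t, so that they form a normed algebra again. *)
Definition power_domain : set (S * R) := [set p | D p.1 /\ `|p.2| <= rho].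

Definition power_monomial k (H : S * R -> R) (b : R) : Prop :=
  exists c b', [/\ N c b', b' * rho ^+ k <= b &
    forall p, power_domain p -> H p = c p.1 * p.2 ^+ k].

Definition power_series : (S * R -> R) -> R -> Prop :=
  graded_sum power_domain power_monomial.

Let rhok k : 0 < rho ^+ k. Proof. exact: exprn_gt0. Qed.

Lemma power_monomial_graded : graded_algebra power_domain power_monomial.
Proof.
split.
- move=> c; exists (cst c), `|c|; split; first exact: na_cst NA c.
    by rewrite expr0 mulr1.
  by move=> p _; rewrite expr0 mulr1.
- move=> n; exists (fun=> 0), 0; split; first exact: na_zero NA.
    by rewrite mul0r.
  by move=> p _; rewrite mul0r.
- move=> m n f g B C [c [b [cb bB fE]]] [d [b' [db' b'C gE]]].
  exists (fun s => c s * d s), (b * b'); split; first exact: (na_mul NA cb db').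
    rewrite exprD mulrACA ler_pM// mulr_ge0// ?(ltW (rhok _))//.
      exact: (na_ge0 NA cb).
    exact: (na_ge0 NA db').
  by move=> p Dp; rewrite fE// gE// exprD mulrACA.
- move=> n f F b B /choice[c /choice[b' H]] bB Ff.
  have cb' k : N (c k) (b' k) by case: (H k).
  have b'b k : b' k <= b k / rho ^+ n.
    by rewrite ler_pdivlMr//; case: (H k).
  have sb' m : series b' m <= B / rho ^+ n.
    rewrite ler_pdivlMr// (le_trans _ (bB m))// /series /= mulr_suml.
    by apply: ler_sum => k _; rewrite -ler_pdivlMr.
  have ccvg s : D s -> cvgn (series (fun k => c k s)).
    move=> Ds; apply: (@cvg_dominated_series _ _ b' (B / rho ^+ n)); split=> // k.
    exact: (na_bound NA Ds (cb' k)).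
  exists (fun s => limn (series (fun k => c k s))), (B / rho ^+ n); split.
  + by apply: (na_sum NA cb' sb') => s Ds; exact: ccvg.
  + by rewrite divfK// gt_eqF.
  + move=> p Dp; have [Dp1 _] := Dp.
    apply: (@cvg_unique _ (@norm_hausdorff _ R^o) _ _ _ _ (Ff p Dp)).
    rewrite (_ : series (F ^~ p) = (fun m => series (fun k => c k p.1) m * p.2 ^+ n)).
      by apply: cvgM; [exact: ccvg|exact: cvg_cst].
    apply/funext => m; rewrite /series /= mulr_suml; apply: eq_bigr => k _.
    by case: (H k) => _ _; apply.
- move=> n f B [c [b [cb bB _]]]; apply: le_trans bB.
  by rewrite mulr_ge0 ?(na_ge0 NA cb)// ltW.
- move=> n f B p Dp [c [b [cb bB fE]]]; rewrite fE// normrM normrX.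
  apply: le_trans bB; case: Dp => Dp1 prho; apply: ler_pM => //.
    exact: (na_bound NA Dp1 cb).
  by rewrite lerXn2r// nnegrE// ltW.
Qed.

Lemma power_series_algebra : normed_algebra power_domain power_series.
Proof. exact: graded_sum_normed_algebra power_monomial_graded. Qed.

Lemma power_series_cst f B : N f B -> power_series (fun p => f p.1) B.
Proof.
move=> fB; apply: (graded_sum_homogeneous power_monomial_graded (n := 0)).
by exists f, B; split=> [//||p _]; rewrite expr0 mulr1.
Qed.

Lemma power_series_var : power_series (fun p => p.2) rho.
Proof.
apply: (graded_sum_homogeneous power_monomial_graded (n := 1)).
exists (cst 1), 1; split; first by have := na_cst NA 1; rewrite normr1.
  by rewrite expr1 mul1r.
by move=> p _; rewrite mul1r expr1.
Qed.

Lemma power_series_coef H B : power_series H B -> exists c b,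
  [/\ forall k, N (c k) (b k), forall n, series (fun k => b k * rho ^+ k) n <= B &
     forall p, power_domain p -> series (fun k => c k p.1 * p.2 ^+ k) @ \oo --> H p].
Proof.
move=> [P [b [Pb bB PH]]]; have /choice[c /choice[d cd]] := Pb.
exists c, d; split.
- by move=> k; case: (cd k).
- move=> n; apply: le_trans (bB n); apply: ler_sum => k _; by case: (cd k).
- move=> p Dp; have := PH p Dp; rewrite (_ : P ^~ p = fun k => c k p.1 * p.2 ^+ k)//.
  by apply/funext => k; case: (cd k) => _ _; apply.
Qed.

End PowerSeries.

Section Composition.
Context {R : realType} {S : Type} {D : set S} {N : (S -> R) -> R -> Prop}.
Hypothesis NA : normed_algebra D N.
Variables (phi : R -> R) (d : nat -> R) (eta B : R).
Hypothesis eta0 : 0 < eta.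
Hypothesis dB : forall n, series (fun k => `|d k| * eta ^+ k) n <= B.
Hypothesis phiE : forall v, `|v| <= eta -> series (fun k => d k * v ^+ k) @ \oo --> phi v.

(** The difference between Psi and the partial sums of its candidate series has a
    uniformly small derivative, so that the mean value theorem bounds it. *)
Lemma primitive_series_cvg (Psi : R -> R) v :
  (forall x : R, is_derive x 1 Psi (phi x)) -> `|v| <= eta ->
  series (fun k => d k / k.+1%:R * v ^+ k.+1) @ \oo --> Psi v - Psi 0.
Proof.
move=> Psi' veta; apply/cvgrPdist_le => e e0.
have b0 k : 0 <= `|d k| * eta ^+ k by rewrite mulr_ge0// exprn_ge0// ltW.
have /cvgrPdist_le/(_ (e / eta)) := cvgn_lim_tail b0 dB.
rewrite divr_gt0// => -[//|M _ HM]; exists M => // n /HM /=.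
rewrite sub0r normrN => /(le_trans (ler_norm _)) tail.
pose g x := Psi x - series (fun k => d k / k.+1%:R * x ^+ k.+1) n.
have g' (x : R) : is_derive x 1 g (phi x - series (fun k => d k * x ^+ k) n).
  apply: is_deriveB; rewrite /series /=.
  rewrite (_ : (fun x => _) = \sum_(0 <= k < n) (fun x => d k / k.+1%:R * x ^+ k.+1)); last first.
    by apply/funext => y; rewrite fct_sumE.
  rewrite (eq_bigr (fun k => d k / k.+1%:R *: (k.+1%:R * x ^+ k))); last first.
    by move=> k _; rewrite /GRing.scale/= mulrA divfK// pnatr_eq0.
  rewrite !big_mkord; apply: is_derive_sum => k.
  apply: is_deriveZ.
  rewrite (_ : (fun y : R => y ^+ k.+1) = (id : R -> R) ^+ k.+1); last first.
    by apply/funext => y; rewrite exprfctE.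
  by have := is_deriveX k.+1 (is_derive_id x (1 : R)); rewrite /GRing.scale/= mulr1.
have gB x : `|x| <= eta -> `|phi x - series (fun k => d k * x ^+ k) n| <= e / eta.
  move=> xeta; apply: le_trans tail.
  apply: (@dominated_series_tail _ (fun k => d k * x ^+ k) _ B) (phiE xeta).
  split=> // k; rewrite normrM normrX ler_wpM2l//.
  by rewrite lerXn2r// nnegrE// ltW.
have g0 : g 0 = Psi 0.
  rewrite /g /series /= big1 ?subr0// => k _; by rewrite expr0n mulr0.
rewrite (_ : _ - _ = g v - g 0); last by rewrite g0 /g addrAC.
have eB0 : 0 <= e / eta by rewrite divr_ge0// ltW.
apply: (@le_trans _ _ (e / eta * `|v|)); last first.
  by rewrite mulrAC ler_pdivrMr// ler_wpM2l// ltW.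
have [v0|v0|->] := ltgtP 0 v; last by rewrite subrr normr0 mulr_ge0.
- have [c [/andP[c0 cv] ->]] := mean_value g' v0.
  rewrite subr0 normrM ler_wpM2r//; apply: gB.
  by rewrite gtr0_norm// (le_trans (ltW cv))//; exact: le_trans (ler_norm _) veta.
- have [c [/andP[c0 cv] E]] := mean_value g' v0.
  rewrite distrC E sub0r normrM normrN ler_wpM2r//; apply: gB.
  by rewrite ltr0_norm// (le_trans _ veta)// ltr0_norm// lerN2; exact: ltW.
Qed.

(** Composition with a function of which only the derivative has an explicit power
    series, as is the case of a distribution function. *)
Lemma na_compose_primitive (Psi : R -> R) f :
  (forall x : R, is_derive x 1 Psi (phi x)) -> N f eta ->
  N (fun s => Psi (f s)) (`|Psi 0| + eta * B).
Proof.
move=> Psi' fe.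
have H : N (fun s => Psi (f s) - Psi 0) (eta * B).
  apply: (na_sum NA (F := fun k s => d k / k.+1%:R * f s ^+ k.+1)
    (b := fun k => `|d k / k.+1%:R| * eta ^+ k.+1)) => [k|n|s Ds].
  - exact: (na_scale NA _ (na_exp NA k.+1 fe)).
  - apply: le_trans (_ : _ <= eta * series (fun k => `|d k| * eta ^+ k) n) _; last first.
      by rewrite ler_wpM2l// ltW.
    rewrite /series /= mulr_sumr; apply: ler_sum => k _.
    rewrite exprS mulrCA ler_wpM2l ?(ltW eta0)// ler_wpM2r ?exprn_ge0 ?(ltW eta0)//.
    by rewrite normrM ler_piMr// ger0_norm ?invr_ge0// invf_le1// ler1n.
  - by apply: primitive_series_cvg => //; exact: (na_bound NA Ds fe).
apply: (na_ext NA (na_add NA (na_cst NA (Psi 0)) H)) => // s _.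
by rewrite addrC subrK.
Qed.

End Composition.

(** The real numbers as functions on a point, to be used as coefficients of
    power series in one real variable. *)
Lemma point_algebra (R : realType) :
  normed_algebra [set: unit] (fun (f : unit -> R) B => `|f tt| <= B).
Proof.
split.
- by move=> c.
- by move=> f g B C fB gC; rewrite normrM ler_pM.
- move=> f F b B Fb bB Ff.
  by apply: (@dominated_series_bound _ (F ^~ tt) b B) (Ff tt I).
- by move=> f B; exact: le_trans (normr_ge0 _).
- by move=> f B [].
Qed.

(** * Power series on a normed space *)

Section Multilinear.
Context {R : realType} {X : normedModType R}.

Definition bounded_multilinear n (A : ('I_n -> X) -> R) (c : R) : Prop :=
  multilinear A /\ forall u, `|A u| <= c * \prod_i `|u i|.

Lemma dfwith_comp_inj m n (f : 'I_m -> 'I_n) (u : 'I_n -> X) (i : 'I_m) x :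
  injective f -> dfwith u (f i) x \o f = dfwith (u \o f) i x.
Proof.
move=> finj; apply/funext => j /=; have [<-|ij] := eqVneq i j.
  by rewrite !dfwithin.
by rewrite !dfwithout// inj_eq.
Qed.

Lemma dfwith_comp_out m n (f : 'I_m -> 'I_n) (u : 'I_n -> X) (i : 'I_n) x :
  (forall j, f j != i) -> dfwith u i x \o f = u \o f.
Proof. by move=> fi; apply/funext => j /=; rewrite dfwithout// eq_sym. Qed.

Lemma bounded_multilinear_mul m n (A : ('I_m -> X) -> R) (B : ('I_n -> X) -> R) a b :
  bounded_multilinear A a -> bounded_multilinear B b ->
  bounded_multilinear (fun u : 'I_(m + n) -> X =>
    A (u \o @lshift m n) * B (u \o @rshift m n)) (a * b).
Proof.
move=> [Al Aa] [Bl Bb]; split=> [u i c x y /=|u]; last first.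
  by rewrite big_split_ord/= mulrACA normrM ler_pM.
have [[j ->]|[j ->]] : (exists j, i = lshift n j) \/ (exists j, i = rshift m j).
- by rewrite -(splitK i); case: (fintype.split i) => j; [left|right]; exists j.
- rewrite !dfwith_comp_inj; try exact: lshift_inj.
  rewrite !dfwith_comp_out; try by move=> k; rewrite eq_sym eq_lrshift.
  by rewrite Al mulrDl mulrA.
- rewrite !dfwith_comp_inj; try exact: rshift_inj.
  rewrite !dfwith_comp_out; try by move=> k; rewrite eq_lrshift.
  by rewrite Bl mulrDr mulrCA.
Qed.

Lemma bounded_multilinear_series n (A : nat -> ('I_n -> X) -> R) (a : nat -> R) b :
  (forall k, bounded_multilinear (A k) (a k)) -> (forall k, 0 <= a k) ->
  (forall m, series a m <= b) ->
  (forall u, cvgn (series (A ^~ u))) /\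
  bounded_multilinear (fun u => limn (series (A ^~ u))) b.
Proof.
move=> Aa a0 ab.
have dom u : dominated_series (A ^~ u) (fun k => a k * \prod_i `|u i|)
                              (b * \prod_i `|u i|).
  split=> [k|m]; first exact: (Aa k).2.
  rewrite (_ : series _ m = series a m * \prod_i `|u i|); last first.
    by rewrite /series /= mulr_suml.
  by rewrite ler_wpM2r ?ab// prodr_ge0.
have Acvg u : cvgn (series (A ^~ u)) by exact: cvg_dominated_series (dom u).
split=> //; split=> [u i c x y|u]; last first.
  exact: dominated_series_bound (dom u) (Acvg u).
apply: (@cvg_lim _ (@norm_hausdorff _ R^o)) => //.
rewrite (_ : series _ = (fun m => c * series (A ^~ (dfwith u i x)) m
   + series (A ^~ (dfwith u i y)) m)).
  by apply: cvgD; [apply: cvgM; [exact: cvg_cst|exact: Acvg]|exact: Acvg].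
apply/funext => m; rewrite /series /= mulr_sumr -big_split/=.
by apply: eq_bigr => k _; exact: (Aa k).1.
Qed.

Lemma bounded_multilinear_comp_scale n (A : ('I_n -> X) -> R) c k :
  bounded_multilinear A c ->
  bounded_multilinear (fun u => A (fun i => k *: u i)) (`|k| ^+ n * c).
Proof.
move=> [Al Ac]; split=> [u i a x y|u]; last first.
  apply: le_trans (Ac _) _; under eq_bigr do rewrite normrZ.
  by rewrite big_split/= prodr_const card_ord mulrCA mulrA.
have E z : (fun j => k *: dfwith u i z j) = dfwith (fun j => k *: u j) i (k *: z).
  apply/funext => j; have [<-|ij] := eqVneq i j; first by rewrite !dfwithin.
  by rewrite !dfwithout.
by rewrite !E scalerDr scalerA mulrC -scalerA Al.
Qed.

(** A u - A v is the sum over i of the values of A at the points with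
    coordinates v below i, u i - v i at i, and u above i. *)
Lemma bounded_multilinear_continuous n (A : ('I_n -> X) -> R) c :
  bounded_multilinear A c ->
  continuous (A : {ptws 'I_n -> X} -> R).
Proof.
move=> [Al Ac] v.
pose w (u : 'I_n -> X) m (i : 'I_n) := if (i < m)%N then v i else u i.
pose z (u : 'I_n -> X) (i j : 'I_n) :=
  if (j < i)%N then v j else if j == i then u i - v i else u j.
have step u (i : 'I_n) : A (w u i) - A (w u i.+1) = A (z u i).
  have wz x : dfwith (w u i) i x = fun j => if (j < i)%N then v j
      else if j == i then x else u j.
    apply/funext => j; have [<-|ij] := eqVneq i j.
      by rewrite dfwithin ltnn.
    by rewrite dfwithout.
  have -> : w u i = dfwith (w u i) i (u i).
    rewrite wz; apply/funext => j; rewrite /w; case: ifPn => // _.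
    by case: eqP => [->|].
  have -> : w u i.+1 = dfwith (w u i) i (v i).
    rewrite wz; apply/funext => j; rewrite /w ltnS leq_eqVlt -[_ == _ :> nat]/(j == i).
    case: eqP => [->|] /=; first by rewrite ltnn.
    by case: ifP.
  have -> : z u i = dfwith (w u i) i (-1 *: v i + u i).
    by rewrite wz /z scaleN1r addrC.
  by rewrite Al mulN1r addrC.
have tele u : A u - A v = \sum_(i < n) A (z u i).
  transitivity (A (w u 0) - A (w u n)).
    congr (A _ - A _); apply/funext => i; rewrite /w //.
    by rewrite ltn_ord.
  rewrite -(eq_bigr _ (fun i _ => step u i)).
  rewrite -(big_mkord xpredT (fun i => A (w u i) - A (w u i.+1))).
  rewrite (@telescope_sumr_eq _ 0 n (fun k => - A (w u k)))//.
    by rewrite opprK addrC.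
  by move=> k _; rewrite opprK addrC.
have Fv := @nbhs_filter {ptws 'I_n -> X} v.
suff H : forall e, 0 < e -> \forall u \near nbhs (v : {ptws 'I_n -> X}), `|A v - A u| <= e.
  move=> B /nbhs_ballP[e /= e0 eB].
  have e20 : 0 < e / 2 by rewrite divr_gt0.
  have := H _ e20; refine (@filterS _ _ Fv _ _ _) => u Hu; apply: eB.
  by rewrite -ball_normE/= (le_lt_trans Hu)// ltr_pdivrMr// ltr_pMr// ltr1n.
move=> e e0.
pose K : R := 1 + \sum_i `|v i|.
have K1 : 1 <= K by rewrite lerDl sumr_ge0.
have vK i : `|v i| + 1 <= K.
  by rewrite /K (bigD1 i)//= addrA [1 + _]addrC lerDl sumr_ge0.
pose d := Num.min 1 (e / ((`|c| + 1) * K ^+ n * n.+1%:R)).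
have cK0 : 0 < (`|c| + 1) * K ^+ n * n.+1%:R.
  have K0 : 0 < K by exact: lt_le_trans K1.
  have c10 : 0 < `|c| + 1 by rewrite ltr_wpDl.
  by rewrite mulr_gt0// mulr_gt0// exprn_gt0.
have d0 : 0 < d by rewrite lt_min ltr01 divr_gt0.
have near_v : \forall u \near nbhs (v : {ptws 'I_n -> X}), forall i, `|v i - u i| < d.
  refine (@filter_forall _ _ (fun i u => `|v i - u i| < d) _ Fv _) => i.
  have := @proj_continuous 'I_n (fun=> X) i v [set x | `|v i - x| < d]; apply.
  by apply/nbhs_ballP; exists d => //= x; rewrite -ball_normE.
refine (@filterS _ _ Fv _ _ _ near_v) => u vu.
have uK i : `|u i| <= K.
  apply: le_trans (vK i); rewrite -[u i](subrK (v i)) addrC.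
  apply: le_trans (ler_normD _ _) _; rewrite lerD2l distrC ltW//.
  by rewrite (lt_le_trans (vu i))// ge_min lexx.
have vK' i : `|v i| <= K by apply: le_trans (vK i); rewrite lerDl.
rewrite distrC tele; apply: le_trans (ler_norm_sum _ _ _) _.
apply: (@le_trans _ _ (\sum_(i < n) (`|c| * (d * K ^+ n)))); last first.
  rewrite sumr_const card_ord -mulr_natr.
  have dle : d <= e / ((`|c| + 1) * K ^+ n * n.+1%:R) by rewrite ge_min lexx orbT.
  move: dle; rewrite ler_pdivlMr// => dle; apply: le_trans dle.
  have Kn : 0 <= K ^+ n by rewrite exprn_ge0// (le_trans _ K1).
  rewrite [leLHS](_ : _ = d * (`|c| * K ^+ n * n%:R)); last by ring.
  rewrite ler_wpM2l ?(ltW d0)// ler_pM ?mulr_ge0// ?ler_nat//.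
  by rewrite ler_wpM2r// lerDl.
apply: ler_sum => i _; apply: le_trans (Ac _) _.
apply: (@le_trans _ _ (`|c| * \prod_j `|z u i j|)).
  by rewrite ler_wpM2r ?prodr_ge0// ler_norm.
rewrite ler_wpM2l// (bigD1 i)//= ler_pM ?prodr_ge0//.
  by rewrite /z ltnn eqxx distrC ltW.
apply: (@le_trans _ _ (\prod_(j < n | j != i) K)).
  apply: ler_prod => j ji; rewrite normr_ge0/= /z (negbTE ji).
  by case: ifP.
by rewrite prodr_const ler_weXn2l// -[leqRHS]card_ord max_card.
Unshelve. all: by end_near.
Qed.

End Multilinear.

Section AnalyticGerms.
Context {R : realType} {X : normedModType R}.

Definition centered_ball (r : R) : set X := [set h | `|h| <= r].

(** Normalizing the norm of P by the weight r ^ n makes the algebra of power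
    series that converge normally on the ball of radius r a graded one. *)
Definition homogeneous (r : R) n (P : X -> R) (b : R) : Prop :=
  exists A c, [/\ bounded_multilinear (n := n) A c, 0 <= c, c * r ^+ n <= b &
    forall h, centered_ball r h -> P h = A (fun=> h)].

(** B bounds the sum, over all degrees, of the norms of the homogeneous terms. It
    plays the part of the supremum of the modulus of f over a complex ball. *)
Definition analytic_germ r : (X -> R) -> R -> Prop :=
  graded_sum (centered_ball r) (homogeneous r).

Lemma homogeneous_graded r : 0 < r -> graded_algebra (centered_ball r) (homogeneous r).
Proof.
move=> r0; have rn n : 0 < r ^+ n by exact: exprn_gt0.
split.
- move=> c; exists (fun=> c), `|c|; split=> //; last by rewrite expr0 mulr1.
  by split=> [u []//|u]; rewrite big_ord0 mulr1.
- move=> n; exists (fun=> 0), 0; split=> //; last by rewrite mul0r.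
  by split=> [u i a x y|u]; rewrite ?mulr0 ?addr0// normr0 mul0r.
- move=> m n f g B C [A1 [c1 [Ac1 c10 c1B fE]]] [A2 [c2 [Ac2 c20 c2C gE]]].
  exists (fun u : 'I_(m + n) -> X => A1 (u \o @lshift m n) * A2 (u \o @rshift m n)), (c1 * c2).
  split; [exact: bounded_multilinear_mul|exact: mulr_ge0| |by move=> h hr; rewrite fE// gE].
  by rewrite exprD mulrACA ler_pM// mulr_ge0// ltW.
- move=> n f F b B /choice[A /choice[c H]] bB Ff.
  have Ac k : bounded_multilinear (A k) (c k) by case: (H k).
  have c0 k : 0 <= c k by case: (H k).
  have cb k : c k <= b k / r ^+ n by rewrite ler_pdivlMr//; case: (H k).
  have sc m : series c m <= B / r ^+ n.
    rewrite ler_pdivlMr// (le_trans _ (bB m))// /series /= mulr_suml.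
    by apply: ler_sum => k _; rewrite -ler_pdivlMr.
  have [Acvg Alim] := bounded_multilinear_series Ac c0 sc.
  exists (fun u => limn (series (A ^~ u))), (B / r ^+ n); split=> //.
  + by apply: le_trans (sc 0%N); rewrite /series /= big_nil.
  + by rewrite divfK// gt_eqF.
  + move=> h hr; apply: (@cvg_unique _ (@norm_hausdorff _ R^o) _ _ _ _ (Ff h hr)).
    rewrite (_ : F ^~ h = fun k => A k (fun=> h)); first exact: Acvg.
    by apply/funext => k; case: (H k) => _ _ _; apply.
- move=> n f B [A [c [Ac c0 cB _]]]; apply: le_trans cB.
  by rewrite mulr_ge0// ltW.
- move=> n f B h hr [A [c [Ac c0 cB fE]]]; rewrite fE//; apply: le_trans cB.
  apply: le_trans (Ac.2 _) _; rewrite ler_wpM2l//= prodr_const card_ord.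
  by rewrite lerXn2r// nnegrE// ltW.
Qed.


Lemma analytic_germ_algebra r : 0 < r ->
  normed_algebra (centered_ball r) (analytic_germ r).
Proof. by move=> /homogeneous_graded; exact: graded_sum_normed_algebra. Qed.

Lemma homogeneous_shrink r r' n P b : 0 < r' -> r' <= r ->
  homogeneous r n P b -> homogeneous r' n P ((r' / r) ^+ n * b).
Proof.
move=> r'0 r'r [A [c [Ac c0 cb PE]]]; exists A, c; split=> //.
  have r0 : 0 < r by exact: lt_le_trans r'r.
  rewrite expr_div_n mulrAC [c * _]mulrC -mulrA ler_wpM2l ?exprn_ge0 ?(ltW r'0)//.
  by rewrite ler_pdivlMr ?exprn_gt0.
by move=> h hr'; apply: PE; exact: le_trans hr' r'r.
Qed.

Lemma analytic_germ_shrink r r' f B : 0 < r' -> r' <= r ->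
  analytic_germ r f B -> analytic_germ r' f B.
Proof.
move=> r'0 r'r [P [b [Pb bB Pf]]].
have r0 : 0 < r by exact: lt_le_trans r'r.
have b0 k : 0 <= b k by exact: (ga_ge0 (homogeneous_graded r0) (Pb k)).
exists P, (fun n => (r' / r) ^+ n * b n); split.
- by move=> n; exact: homogeneous_shrink (Pb n).
- move=> n; apply: le_trans (bB n); apply: ler_sum => k _.
  rewrite ler_piMl// exprn_ile1//; first by rewrite divr_ge0// ltW.
  by rewrite ler_pdivrMr// mul1r.
- by move=> h hr'; apply: Pf; exact: le_trans hr' r'r.
Qed.

Lemma homogeneous0_cst r P b : 0 < r -> homogeneous r 0 P b ->
  forall h, centered_ball r h -> P h = P 0.
Proof.
move=> r0 [A [c [_ _ _ PE]]] h hr; rewrite !PE//; last first.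
  by rewrite /centered_ball/= normr0 ltW.
by congr A; apply/funext => -[].
Qed.

Lemma homogeneousS_0 r n P b : 0 < r -> homogeneous r n.+1 P b -> P 0 = 0.
Proof.
move=> r0 [A [c [[_ Ac] _ _ PE]]]; rewrite PE; last first.
  by rewrite /centered_ball/= normr0 ltW.
apply/normr0_eq0/le_anti; rewrite normr_ge0 andbT (le_trans (Ac _))//.
by rewrite big_ord_recl normr0 mul0r mulr0.
Qed.

(** A germ without constant term is small on small balls. *)
Lemma analytic_germ_shrink0 r r' f B : 0 < r' -> r' <= r ->
  analytic_germ r f B -> analytic_germ r' (fun h => f h - f 0) (r' / r * B).
Proof.
move=> r'0 r'r [P [b [Pb bB Pf]]].
have r0 : 0 < r by exact: lt_le_trans r'r.
have b0 k : 0 <= b k by exact: (ga_ge0 (homogeneous_graded r0) (Pb k)).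
have q0 : 0 <= r' / r by rewrite divr_ge0// ltW.
have q1 : r' / r <= 1 by rewrite ler_pdivrMr// mul1r.
exists (fun n => if n is 0 then fun=> 0 else P n),
  (fun n => if n is 0 then 0 else (r' / r) ^+ n * b n); split.
- case=> [|n]; first exact: (ga_zero (homogeneous_graded r'0)).
  exact: homogeneous_shrink (Pb n.+1).
- move=> n; apply: (@le_trans _ _ (r' / r * series b n)); last by rewrite ler_wpM2l.
  rewrite /series /= mulr_sumr; apply: ler_sum => -[|k] _; first exact: mulr_ge0.
  by rewrite exprS -mulrA ler_wpM2l// ler_piMl// exprn_ile1.
- move=> h hr'; have hr : centered_ball r h by exact: le_trans hr' r'r.
  have z0 : centered_ball r 0 by rewrite /centered_ball/= normr0 ltW.
  have f0 : f 0 = P 0%N 0.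
    apply: (@cvg_unique _ (@norm_hausdorff _ R^o) _ _ _ _ (Pf 0 z0)).
    rewrite (_ : P 0%N 0 = series (P ^~ 0) 1); last by rewrite /series /= big_nat1.
    apply: cvg_series_finite_support => -[//|k] _; exact: homogeneousS_0 (Pb k.+1).
  rewrite (_ : series _ = (fun n => series (P ^~ h) n - (if n is 0 then 0 else P 0%N 0))).
    apply: cvgB; first exact: Pf.
    by rewrite f0; apply: cvg_near_cst; exists 1%N => // -[].
  apply/funext => -[|n]; rewrite /series /=; first by rewrite !big_nil subr0.
  rewrite !big_nat_recl//= add0r (homogeneous0_cst r0 (Pb 0%N) hr).
  by rewrite addrAC subrr add0r.
Qed.

Lemma analytic_germ_comp_scale r k f B : 0 < k -> analytic_germ r f B ->
  analytic_germ (r / k) (fun h => f (k *: h)) B.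
Proof.
move=> k0 [P [b [Pb bB Pf]]].
have kball h : centered_ball (r / k) h -> centered_ball r (k *: h).
  by rewrite /centered_ball/= ler_pdivlMr// normrZ gtr0_norm// mulrC.
exists (fun n h => P n (k *: h)), b; split=> //.
- move=> n; have [A [c [Ac c0 cb PE]]] := Pb n.
  exists (fun u => A (fun i => k *: u i)), (`|k| ^+ n * c); split.
  + exact: bounded_multilinear_comp_scale.
  + by rewrite mulr_ge0// exprn_ge0.
  + rewrite gtr0_norm// expr_div_n mulrAC mulrCA mulfV ?mulr1 1?mulrC//.
    by rewrite gt_eqF// exprn_gt0.
  + by move=> h /kball hr; rewrite PE.
- by move=> h /kball hr; exact: Pf.
Qed.

Definition locally_analytic (g : X -> R) : Prop :=
  forall x, exists r B, 0 < r /\ analytic_germ r (fun h => g (x + h)) B.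

Lemma locally_analytic_real_analytic g : locally_analytic g -> real_analytic g.
Proof.
move=> ga x; have [r [B [r0 [P [b [Pb bB Pg]]]]]] := ga x.
pose A n := sval (cid (Pb n)); have H n := svalP (cid (Pb n)).
exists (fun n h => A n (fun=> h)); split.
  move=> n; have [c [Ac _ _ _]] := H n; exists (A n); split=> //; first exact: Ac.1.
  exact: bounded_multilinear_continuous Ac.
have : \forall h \near (0 : X), centered_ball r h.
  by apply/nbhs_ballP; exists r => //= h; rewrite -ball_normE/= sub0r normrN => /ltW.
apply: filterS => h hr; have := Pg h hr.
rewrite (_ : P ^~ h = fun n => A n (fun=> h))//.
by apply/funext => n; have [c [_ _ _]] := H n; apply.
Qed.

End AnalyticGerms.

(** * An implicit function theorem for analytic germs *)

Section FixedPoint.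
Context {R : realType} {S : Type} {D : set S} {N : (S -> R) -> R -> Prop}.
Hypothesis NA : normed_algebra D N.
Variables (e : nat -> S -> R) (b : nat -> R) (eta : R).
Hypothesis eta0 : 0 < eta.
Hypothesis eb : forall k, N (e k) (b k).
Hypothesis b_const : b 0 <= eta / 2.
Hypothesis b_slope : forall n,
  series (fun k => b k.+1 * (k.+1%:R * eta ^+ k)) n <= 2^-1.

Implicit Types (t u : S -> R) (eps : R).

Let b0 k : 0 <= b k. Proof. exact: (na_ge0 NA (eb k)). Qed.

Let etak k : 0 <= eta ^+ k. Proof. by rewrite exprn_ge0// ltW. Qed.

Lemma na_expB t u eps k : N t eta -> N u eta -> N (fun s => t s - u s) eps ->
  N (fun s => t s ^+ k - u s ^+ k) (k%:R * eta ^+ k.-1 * eps).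
Proof.
move=> tN uN tuN; elim: k => [|k IH].
  by apply: (na_ext NA (na_zero NA)) => [s _|]; rewrite ?subrr// !mul0r.
have H := na_add NA (na_mul NA tN IH) (na_mul NA tuN (na_exp NA k uN)).
apply: (na_ext NA H) => [s _|]; first by rewrite !exprS; ring.
rewrite -natr1 mulrDl mul1r [leRHS]mulrDl [eps * _]mulrC lerD2r.
by case: k {IH H} => [|k]; [rewrite !mul0r mulr0|rewrite exprS; lra].
Qed.

Definition evaluation t s : R := limn (series (fun k => e k s * t s ^+ k)).

Let b_sum n : series (fun k => b k * eta ^+ k) n <= eta.
Proof.
case: n => [|n]; first by rewrite /series /= big_nil ltW.
rewrite /series /= big_nat_recl//= expr0 mulr1.
rewrite [leRHS](_ : _ = eta / 2 + eta * 2^-1); last by lra.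
rewrite lerD//.
apply: (@le_trans _ _ (eta * series (fun k => b k.+1 * (k.+1%:R * eta ^+ k)) n)); last first.
  by rewrite ler_pM2l//; exact: b_slope n.
rewrite /series /= mulr_sumr; apply: ler_sum => k _.
rewrite exprS mulrCA ler_wpM2l ?(ltW eta0)// ler_wpM2l// ler_peMl//.
by rewrite ler1n.
Qed.

Lemma evaluation_cvg t s : N t eta -> D s ->
  series (fun k => e k s * t s ^+ k) @ \oo --> evaluation t s.
Proof.
move=> tN Ds; apply: (@cvg_dominated_series _ _ (fun k => b k * eta ^+ k) eta).
split=> // k; rewrite normrM normrX ler_pM//; first exact: (na_bound NA Ds (eb k)).
by rewrite lerXn2r ?nnegrE ?(ltW eta0)//; exact: (na_bound NA Ds tN).
Qed.

Lemma evaluation_stable t : N t eta -> N (evaluation t) eta.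
Proof.
move=> tN; apply: (na_sum NA (F := fun k s => e k s * t s ^+ k)) b_sum _ => [k|s Ds].
  exact: (na_mul NA (eb k) (na_exp NA k tN)).
exact: evaluation_cvg.
Qed.

Lemma evaluation_contraction t u eps : N t eta -> N u eta ->
  N (fun s => t s - u s) eps ->
  N (fun s => evaluation t s - evaluation u s) (eps / 2).
Proof.
move=> tN uN tuN; have eps0 := na_ge0 NA tuN.
apply: (na_sum NA (F := fun k s => e k s * (t s ^+ k - u s ^+ k))
  (b := fun k => b k * (k%:R * eta ^+ k.-1 * eps))) => [k|n|s Ds].
- exact: (na_mul NA (eb k) (na_expB k tN uN tuN)).
- case: n => [|n]; first by rewrite /series /= big_nil divr_ge0.
  rewrite /series /= big_nat_recl//= !mul0r mulr0 add0r.
  apply: (@le_trans _ _ (eps * series (fun k => b k.+1 * (k.+1%:R * eta ^+ k)) n)).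
    rewrite /series /= mulr_sumr; apply: ler_sum => k _; lra.
  by rewrite ler_wpM2l.
- rewrite (_ : series _ = (fun n => series (fun k => e k s * t s ^+ k) n
     - series (fun k => e k s * u s ^+ k) n)).
    by apply: cvgB; exact: evaluation_cvg.
  apply/funext => n; rewrite /series /= -sumrB; apply: eq_bigr => k _.
  by rewrite mulrBr.
Qed.

Let iterate m : S -> R := iter m evaluation (fun=> 0).

Let iterate_in m : N (iterate m) eta.
Proof.
elim: m => [|m IH]; last exact: evaluation_stable.
exact: (na_le NA (na_zero NA) (ltW eta0)).
Qed.

Let half_pow m := eta / 2 ^+ m.+1.

Let iterate_step m : N (fun s => iterate m.+1 s - iterate m s) (half_pow m).
Proof.
elim: m => [|m IH]; last first.
  have := evaluation_contraction (iterate_in m.+1) (iterate_in m) IH.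
  by move=> /(na_le NA); apply; rewrite /half_pow [in leRHS]exprS invfM; lra.
apply: (na_ext NA (eb 0)) => [s Ds|]; last by rewrite /half_pow expr1.
rewrite subr0 -[LHS]mulr1 -(expr0 0) /=; apply/esym/(@cvg_lim _ (@norm_hausdorff _ R^o)) => //.
rewrite (_ : e 0 s * _ = series (fun k => e k s * 0 ^+ k) 1); last first.
  by rewrite /series /= big_nat1.
by apply: cvg_series_finite_support => -[//|k] _; rewrite expr0n mulr0.
Qed.

Let half_sum m n : series (fun k => half_pow (m + k)) n <= eta / 2 ^+ m.
Proof.
suff -> : series (fun k => half_pow (m + k)) n = eta / 2 ^+ m - eta / 2 ^+ (m + n).
  by rewrite lerBlDr lerDl divr_ge0// ltW.
elim: n => [|n IH]; first by rewrite /series /= big_nil addn0 subrr.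
by rewrite seriesSr IH /half_pow addnS exprS invfM; lra.
Qed.

Let step_series m n s :
  series (fun k => iterate (m + k).+1 s - iterate (m + k) s) n
  = iterate (m + n) s - iterate m s.
Proof.
elim: n => [|n IH]; first by rewrite /series /= big_nil addn0 subrr.
by rewrite seriesSr IH addnS addrC addrA subrK.
Qed.

Let fixpoint s : R := limn (iterate ^~ s).

Let fixpoint_cvg s : D s -> iterate ^~ s @ \oo --> fixpoint s.
Proof.
move=> Ds; suff : cvgn (series (fun k => iterate (0 + k).+1 s - iterate (0 + k) s)).
  have -> : series (fun k => iterate (0 + k).+1 s - iterate (0 + k) s) = iterate ^~ s.
    by apply/funext => n; rewrite step_series subr0.
  by [].
apply: (@cvg_dominated_series _ _ (fun k => half_pow (0 + k)) (eta / 2 ^+ 0)).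
by split=> // k; exact: (na_bound NA Ds (iterate_step k)).
Qed.

Let fixpoint_dist m : N (fun s => fixpoint s - iterate m s) (eta / 2 ^+ m).
Proof.
apply: (na_sum NA (F := fun k s => iterate (m + k).+1 s - iterate (m + k) s)
   (b := fun k => half_pow (m + k))) => // s Ds.
rewrite (_ : series _ = (fun n => iterate (n + m) s - iterate m s)); last first.
  by apply/funext => n; rewrite step_series addnC.
apply: cvgB; last exact: cvg_cst.
by rewrite (cvg_shiftn m (iterate ^~ s)); exact: fixpoint_cvg.
Qed.

(** By b_slope, which bounds the derivative, evaluation is a contraction of ratio
    1/2 of the ball of radius eta of the algebra. *)
Lemma na_fixpoint : exists t, N t eta /\
  forall s, D s -> series (fun k => e k s * t s ^+ k) @ \oo --> t s.
Proof.
have fN : N fixpoint eta.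
  by apply: (na_ext NA (fixpoint_dist 0)) => [s _|]; rewrite ?subr0// expr0 divr1.
exists fixpoint; split=> // s Ds.
suff E : fixpoint s = evaluation fixpoint s.
  by have := evaluation_cvg fN Ds; rewrite -E.
suff : (fun n => iterate n.+1 s) @ \oo --> evaluation fixpoint s.
  rewrite (cvg_shiftS (iterate ^~ s)).
  exact: (@cvg_unique _ (@norm_hausdorff _ R^o) _ _ _ _ (fixpoint_cvg Ds)).
rewrite (_ : (fun n => _) = (fun n => evaluation fixpoint s
   - (evaluation fixpoint s - iterate n.+1 s))); last first.
  by apply/funext => n; rewrite subKr.
rewrite -[X in _ --> X]subr0; apply: cvgB; first exact: cvg_cst.
apply: norm_cvg0; apply: (@squeeze_cvgr _ _ _ _ (fun=> 0) (fun m => eta / 2 ^+ m.+1)).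
- apply: nearW => m; rewrite normr_ge0/=.
  have := evaluation_contraction fN (iterate_in m) (fixpoint_dist m).
  by move=> /(na_bound NA Ds); rewrite exprS invfM mulrA mulrAC.
- exact: cvg_cst.
- rewrite (_ : (fun m => _) = geometric (eta / 2) 2^-1); last first.
    by apply/funext => m; rewrite /= exprS invfM exprVn mulrA.
  by apply: cvg_geometric; rewrite ger0_norm ?invr_ge0// invf_lt1// ltr1n.
Qed.

End FixedPoint.

Section ImplicitFunction.
Context {R : realType} {X : normedModType R}.
Variables (r rho B : R) (H : X * R -> R).
Hypotheses (r0 : 0 < r) (rho0 : 0 < rho).
Hypothesis HN : power_series (@centered_ball R X r) (analytic_germ r) rho H B.
Hypothesis H0 : H (0, 0) = 0.
Hypothesis H_slope : forall t, 0 <= t <= rho -> t <= H (0, t).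

(** Solving for the linear term in t turns H (h, t) = 0 into the fixed point
    equation t = sum e k * t ^ k, in which the terms of degrees 0 and 1 vanish at
    h = 0. *)
Theorem analytic_implicit_function : exists r' (t : X -> R),
  [/\ 0 < r', r' <= r, analytic_germ r' t rho &
      forall h, `|h| <= r' -> H (h, t h) = 0].
Proof.
have NA := @analytic_germ_algebra R X r r0.
have [c [b [cb bB cH]]] := power_series_coef HN.
have b0 k : 0 <= b k by exact: (na_ge0 NA (cb k)).
have ball0 q : 0 < q -> @centered_ball R X q 0.
  by move=> q0; rewrite /centered_ball/= normr0 ltW.
have B0 : 0 <= B by have := bB 0%N; rewrite /series /= big_nil.
have c00 : c 0%N 0 = 0.
  rewrite -H0; apply: (@cvg_unique _ (@norm_hausdorff _ R^o) _ _ _ _ _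
     (cH (0, 0) (conj (ball0 _ r0) _))); last by rewrite /= normr0 ltW.
  rewrite (_ : c 0%N 0 = series (fun k => c k 0 * 0 ^+ k) 1); last first.
    by rewrite /series /= big_nat1 expr0 mulr1.
  by apply: cvg_series_finite_support => -[//|k] _; rewrite expr0n mulr0.
have bB' n : series (fun k => b k.+2 * rho ^+ k.+2) n <= B.
  apply: le_trans (bB n.+2); rewrite /series /= !big_nat_recl//= addrA lerDr.
  by rewrite addr_ge0// mulr_ge0// exprn_ge0// ltW.
pose d := c 1%N 0.
(* The slope d at the origin is positive since H (0, t) >= t differs from d * t by
   a term of order t ^ 2. *)
have d_gt0 : 0 < d.
  pose t := Num.min rho (rho ^+ 2 / (2 * (B + 1))).
  have B1 : 0 < 2 * (B + 1) by lra.
  have t0 : 0 < t by rewrite lt_min rho0 divr_gt0// exprn_gt0.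
  have trho : t <= rho by rewrite ge_min lexx.
  have tB : t * (2 * (B + 1)) <= rho ^+ 2.
    by rewrite -ler_pdivlMr// ge_min lexx orbT.
  clearbody t.
  have tD : power_domain (@centered_ball R X r) rho (0, t).
    by split; [exact: ball0|rewrite /= gtr0_norm].
  have tail : `|H (0, t) - d * t| <= (t / rho) ^+ 2 * B.
    have Hc : series (fun k => c k.+2 0 * t ^+ k.+2) @ \oo --> H (0, t) - d * t.
      rewrite (_ : series _ = (fun n => series (fun k => c k 0 * t ^+ k) (n + 2)%N - d * t)).
        apply: cvgB; last exact: cvg_cst.
        by rewrite (cvg_shiftn 2 (series (fun k => c k 0 * t ^+ k))); exact: cH tD.
      apply/funext => n; rewrite /series /= addn2 !big_nat_recl//= c00 mul0r add0r.
      by rewrite expr1 /d addrC addKr.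
    apply: dominated_series_bound Hc.
    instantiate (1 := fun k => (t / rho) ^+ 2 * (b k.+2 * rho ^+ k.+2)).
    split=> [k|n].
      rewrite normrM normrX (gtr0_norm t0).
      apply: (@le_trans _ _ (b k.+2 * t ^+ k.+2)).
        by rewrite ler_wpM2r ?exprn_ge0 ?(ltW t0)//; exact: (na_bound NA (ball0 _ r0) (cb _)).
      rewrite [leRHS](_ : _ = b k.+2 * (t ^+ 2 * rho ^+ k)); last first.
        by rewrite (exprD rho 2 k); field; rewrite gt_eqF.
      rewrite ler_wpM2l// (exprD t 2 k) ler_wpM2l ?exprn_ge0 ?(ltW t0)//.
      by rewrite lerXn2r// nnegrE ltW.
    rewrite /series /= -mulr_sumr ler_wpM2l//; first exact: exprn_ge0 (divr_ge0 (ltW t0) (ltW rho0)).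
    exact: bB'.
  have := H_slope (t := t); rewrite (ltW t0) trho => /(_ isT) tH.
  have : t <= d * t + (t / rho) ^+ 2 * B.
    have := le_trans (ler_norm _) tail; lra.
  have : (t / rho) ^+ 2 * B <= t / 2.
    rewrite expr_div_n mulrAC ler_pdivrMr ?exprn_gt0//.
    apply: (@le_trans _ _ (t / 2 * (t * (2 * (B + 1))))).
      by rewrite expr2; nra.
    by rewrite ler_wpM2l// divr_ge0// ltW.
  move=> h1 h2; have : 0 < d * t by lra.
  by rewrite pmulr_lgt0.
(* The choice of eta makes the terms of degree at least 2 in t contribute at most
   1/4 to the slope; that of q, the ratio of the radii, does so for the linear
   term and makes the constant term at most eta / 2. *)
pose eta := Num.min (rho / 4) (rho ^+ 2 * d / (8 * (B + 1))).
have B8 : 0 < 8 * (B + 1) by lra.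
have rho20 : 0 < rho ^+ 2 by rewrite exprn_gt0.
have eta0 : 0 < eta.
  by rewrite lt_min !divr_gt0// mulr_gt0.
have eta_rho : eta <= rho / 4 by rewrite ge_min lexx.
have eta_B : eta * (8 * (B + 1)) <= rho ^+ 2 * d.
  by rewrite -ler_pdivlMr// ge_min lexx orbT.
pose q := Num.min 1 (Num.min (d / (4 * (b 1%N + 1))) (eta * d / (2 * (b 0%N + 1)))).
have b14 : 0 < 4 * (b 1%N + 1) by have := b0 1%N; lra.
have b02 : 0 < 2 * (b 0%N + 1) by have := b0 0%N; lra.
have q0 : 0 < q by rewrite !lt_min ltr01 !divr_gt0// mulr_gt0.
have q1 : q <= 1 by rewrite ge_min lexx.
have qb1 : q * (4 * (b 1%N + 1)) <= d.
  by rewrite -ler_pdivlMr// !ge_min lexx !orbT.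
have qb0 : q * (2 * (b 0%N + 1)) <= eta * d.
  by rewrite -ler_pdivlMr// !ge_min lexx !orbT.
pose r' := q * r.
have r'0 : 0 < r' by rewrite mulr_gt0.
have r'r : r' <= r by rewrite ger_pMl.
have r'rq : r' / r = q by rewrite mulfK// gt_eqF.
have NA' := @analytic_germ_algebra R X r' r'0.
pose e k h := if k is 1 then - d^-1 * (c 1%N h - c 1%N 0) else - d^-1 * c k h.
pose be k := if k is k'.+2 then d^-1 * b k else d^-1 * (q * b k).
have dN : `| - d^-1 | = d^-1 by rewrite normrN gtr0_norm// invr_gt0.
have eN k : analytic_germ r' (e k) (be k).
  suff [f [fN ->]] : exists f, analytic_germ r' f (d * be k) /\
      e k = fun h => - d^-1 * f h.
    by have := na_scale NA' (- d^-1) fN; rewrite dN mulKf ?gt_eqF.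
  case: k => [|[|k]]; rewrite /e /be mulVKf ?gt_eqF//.
  - exists (c 0%N); split=> //; rewrite -r'rq.
    apply: (na_ext NA' (analytic_germ_shrink0 r'0 r'r (cb 0%N))) => // h _.
    by rewrite c00 subr0.
  - exists (fun h => c 1%N h - c 1%N 0); split=> //.
    by rewrite -r'rq; exact: analytic_germ_shrink0 (cb 1%N).
  - exists (c k.+2); split=> //; exact: analytic_germ_shrink (cb k.+2).
have [|n|t [tN tE]] := na_fixpoint NA' eta0 eN.
- rewrite /be ler_pdivrMl//; have := mulr_ge0 (ltW q0) (b0 0%N); nra.
- case: n => [|n]; first by rewrite /series /= big_nil invr_ge0.
  rewrite /series /= big_nat_recl//= expr0 !mulr1.
  have h1 : d^-1 * (q * b 1%N) <= 4^-1.
    by rewrite ler_pdivrMl//; have := mulr_ge0 (ltW q0) (b0 1%N); nra.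
  suff h2 : \sum_(0 <= i < n) d^-1 * b i.+2 * (i.+2%:R * eta ^+ i.+1) <= 4^-1 by lra.
  apply: (@le_trans _ _ (d^-1 * (2 * eta / rho ^+ 2) * B)); last first.
    rewrite -mulrA ler_pdivrMl// mulrAC ler_pdivrMr//; nra.
  apply: (@le_trans _ _ (d^-1 * (2 * eta / rho ^+ 2) *
      series (fun k => b k.+2 * rho ^+ k.+2) n)); last first.
    by rewrite ler_wpM2l// mulr_ge0 ?invr_ge0 ?(ltW d_gt0)// divr_ge0 ?mulr_ge0// ltW.
  rewrite /series /= mulr_sumr; apply: ler_sum => k _.
  have kp : (k.+2)%:R * (eta ^+ k) <= 2 * rho ^+ k :> R.
    apply: (@le_trans _ _ (k.+2%:R * (rho / 4) ^+ k)).
      by rewrite ler_wpM2l// lerXn2r// nnegrE ?divr_ge0// ltW.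
    rewrite expr_div_n mulrA ler_pdivrMr ?exprn_gt0//.
    rewrite mulrAC ler_wpM2r ?exprn_ge0 ?(ltW rho0)// -natrX -natrM ler_nat.
    elim: k => // k IH; rewrite expnS mulnCA.
    apply: leq_trans (leq_mul (leqnn 4) IH).
    by rewrite -[k.+3]addn1 (mulnDl 1 3) mul1n leq_add2l.
  rewrite [leLHS](_ : _ = d^-1 * b k.+2 * (eta * (k.+2%:R * eta ^+ k))); last first.
    by rewrite exprS; ring.
  rewrite [leRHS](_ : _ = d^-1 * b k.+2 * (eta * (2 * rho ^+ k))); last first.
    by rewrite (exprD rho 2 k); field; rewrite !gt_eqF.
  by rewrite ler_wpM2l ?mulr_ge0 ?invr_ge0 ?(ltW d_gt0)// ler_wpM2l// ltW.
- exists r', t; split=> //.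
    apply: (na_le NA' tN); apply: le_trans eta_rho _.
    by rewrite ler_piMr ?(ltW rho0)// invf_le1 ?ler1n.
  move=> h hr'; have hr : centered_ball r h by exact: le_trans hr' r'r.
  have th : `|t h| <= rho.
    apply: le_trans (na_bound NA' (hr' : centered_ball r' h) tN) _.
    by apply: le_trans eta_rho _; rewrite ler_piMr ?(ltW rho0)// invf_le1 ?ler1n.
  have Hth := cH (h, t h) (conj hr th).
  have E : (fun n => - d^-1 * series (fun k => c k h * t h ^+ k) n.+2 + t h) @ \oo --> t h.
    rewrite (_ : (fun n => _) = (fun n => series (fun k => e k h * t h ^+ k) (n + 2)%N)).
      by rewrite (cvg_shiftn 2 (series (fun k => e k h * t h ^+ k))); exact: tE.
    apply/funext => n; rewrite addn2 /series /= !big_nat_recl//= !mulrDr mulr_sumr.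
    rewrite (eq_bigr (fun k => e k.+2 h * t h ^+ k.+2)); last by move=> k _; rewrite mulrA.
    rewrite -/d !expr1 expr0; field.
    by rewrite gt_eqF.
  have E' : (fun n => - d^-1 * series (fun k => c k h * t h ^+ k) n.+2 + t h) @ \oo
      --> - d^-1 * H (h, t h) + t h.
    apply: cvgD; last exact: cvg_cst.
    apply: cvgM; first exact: cvg_cst.
    rewrite (_ : (fun n => _) = (fun n => series (fun k => c k h * t h ^+ k) (n + 2)%N)).
      by rewrite (cvg_shiftn 2 (series (fun k => c k h * t h ^+ k))); exact: Hth.
    by apply/funext => n; rewrite addn2.
  have : - d^-1 * H (h, t h) + t h = t h.
    exact: (@cvg_unique _ (@norm_hausdorff _ R^o) _ _ _ _ E' E).
  move/(congr1 (fun y => d * (t h - y))); rewrite subrr mulr0 opprD addrCA subrr addr0.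
  by rewrite mulNr opprK mulrA mulfV ?mul1r// gt_eqF.
Qed.

End ImplicitFunction.

(** * An entire distribution function *)

Section GaussianCdf.
Context {R : realType}.
Notation mu := (@lebesgue_measure R).

Let G (s : R) : R := \int[mu]_(t in `]-oo, s]) gauss_fun t.

Let G_integrable s : mu.-integrable `]-oo, s] (EFin \o @gauss_fun R).
Proof. by apply: integrableS (@integrableT_gauss R). Qed.

Let G_derive (x : R) : is_derive x 1 G (gauss_fun x).
Proof.
have xx1 : x < x + 1 by rewrite ltrDl.
have [dG GE] := @continuous_FTC1 R gauss_fun -oo%O x (x + 1) xx1 (G_integrable _) (ltNyr _)
  (@continuous_gauss_fun R x).
by split=> //; rewrite -derive1E.
Qed.

Let G_ge0 s : 0 <= G s.
Proof. by apply: Rintegral_ge0 => x _; exact: gauss_fun_ge0. Qed.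

Let G_le s : G s <= Num.sqrt pi.
Proof.
rewrite -lee_fin -integralT_gauss /G /Rintegral fineK; last first.
  by apply: integrable_fin_num => //; exact: G_integrable.
apply: ge0_subset_integral => //.
- by apply/measurable_EFinP; exact: measurable_gauss_fun.
- by move=> x _; rewrite lee_fin gauss_fun_ge0.
Qed.

Let sqrt_pi_ge1 : 1 <= Num.sqrt pi :> R.
Proof. by rewrite -[leLHS]sqrtr1 ler_sqrt ?pi_gt0//; apply: le_trans (pi_ge2 R); lra. Qed.

(** The limit of the primitive at minus infinity is subtracted, which the
    comparison with the Gaussian function itself then bounds from above. *)
Theorem gaussian_cdf : exists (Phi : R -> R) (c : R),
  [/\ 0 < c <= 1, forall x : R, is_derive x 1 Phi (c * expR (- x ^+ 2)),
      forall x, 0 <= Phi x <= 1, 0 < Phi 0 &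
      forall x, x <= -1 -> Phi x <= expR (- x ^+ 2)].
Proof.
pose l := inf (range G).
have Ginf : has_inf (range G).
  by split; [exists (G 0); exists 0|exists 0 => _ [x _ <-]].
have lG x : l <= G x by apply: (ge_inf Ginf.2); exists x.
have l0 : 0 <= l by apply: lb_le_inf; [exact: Ginf.1|move=> _ [x _ <-]].
have sp0 : 0 < Num.sqrt pi :> R by exact: lt_le_trans sqrt_pi_ge1.
pose c : R := (Num.sqrt pi)^-1.
have c0 : 0 < c by rewrite invr_gt0.
have c1 : c <= 1 by rewrite invf_le1.
exists (fun x => c * (G x - l)), c; split=> [|x|x||x x1].
- by rewrite c0.
- have H := is_deriveZ c (is_deriveB (G_derive x) (is_derive_cst l x (1 : R))).
  by rewrite subr0 in H; exact: H.
- rewrite mulr_ge0 ?subr_ge0 ?(ltW c0)//= mulrC ler_pdivrMr// mul1r.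
  by rewrite lerBlDr (le_trans (G_le x))// lerDl.
- rewrite mulr_gt0// subr_gt0; apply: le_lt_trans (lG (- 1)) _.
  have [|x [_ E]] := @mean_value _ _ _ (-1) 0 G_derive; first by rewrite oppr_lt0.
  by rewrite -subr_gt0 E mulr_gt0 ?expR_gt0// subr_gt0 oppr_lt0.
- apply: (@le_trans _ _ (G x - l)); first by rewrite ler_piMl// subr_ge0.
  rewrite lerBlDr -lerBlDl; apply: lb_le_inf; first exact: Ginf.1.
  move=> _ [u _ <-]; rewrite lerBlDl.
  have [ux|xu] := leP u x; last first.
    rewrite ler_wpDl ?expR_ge0//; apply: (derive_ge0_homo G_derive) => [y _|].
      exact: gauss_fun_ge0.
    exact: ltW.
  pose h (v : R) := gauss_fun v - G v.
  have h' (v : R) : is_derive v 1 h ((- (2 * v) - 1) * gauss_fun v).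
    rewrite mulrBl mul1r; apply: is_deriveB.
    have sq : is_derive v 1 (fun v : R => - v ^+ 2) (- (2 * v)).
      apply: is_deriveN.
      rewrite (_ : (fun y : R => y ^+ 2) = (id : R -> R) ^+ 2); last first.
        by apply/funext => y; rewrite exprfctE.
      by have := is_deriveX 2 (is_derive_id v (1 : R)); rewrite /GRing.scale/= mulr1.
    have := @is_derive1_comp _ expR (fun v : R => - v ^+ 2) _ _ _ (is_derive_expR _) sq.
    by rewrite mulrC.
    exact: G_derive.
  have hux : h u <= h x.
    apply: (derive_ge0_homo h') => // y yx; rewrite mulr_ge0 ?expR_ge0//.
    by have := le_trans (ltW yx) x1; lra.
  have := gauss_fun_ge0 u; rewrite /h in hux; rewrite -/(gauss_fun x); lra.
Qed.

End GaussianCdf.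

Section GaussianCdfComposition.
Context {R : realType} {S : Type} {D : set S} {N : (S -> R) -> R -> Prop}.
Hypothesis NA : normed_algebra D N.
Variables (Phi : R -> R) (c : R).
Hypothesis c01 : 0 < c <= 1.
Hypothesis Phi' : forall x : R, is_derive x 1 Phi (c * expR (- x ^+ 2)).
Hypothesis Phi01 : forall x, 0 <= Phi x <= 1.
Hypothesis Phi_tail : forall x, x <= -1 -> Phi x <= expR (- x ^+ 2).
Variables (lam x eta : R) (f : S -> R).
Hypotheses (lam0 : 0 <= lam) (eta0 : 0 < eta) (feta : N f eta).

Let is_derive_affine (v : R) : is_derive v 1 (fun v => lam * (x + v)) lam.
Proof.
rewrite -[X in is_derive _ _ _ X]mulr1; apply: is_deriveZ.
rewrite -[X in is_derive _ _ _ X]add0r; apply: is_deriveD.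
Qed.

(** The derivative of v |-> Phi (lam * (x + v)) is the exponential of a quadratic
    polynomial, whose norm is at most the exponential of the norm of that
    polynomial, the constant term being counted with its sign. *)
Let na_cdf : N (fun s => Phi (lam * (x + f s)))
  (Phi (lam * x) + eta * (lam *
     expR (- (lam * x) ^+ 2 + (2 * lam ^+ 2 * `|x| * eta + lam ^+ 2 * eta ^+ 2)))).
Proof.
pose phi (v : R) := lam * (c * expR (- (lam * (x + v)) ^+ 2)).
have PA := power_series_algebra (point_algebra R) eta0.
have var := power_series_var (point_algebra R) eta0.
set B := expR _.
have expo : power_series [set: unit] (fun (g : unit -> R) b => `|g tt| <= b) eta
    (fun p => phi p.2) (lam * B).
  have q : power_series [set: unit] (fun (g : unit -> R) b => `|g tt| <= b) eta
     (fun p => (- 2 * lam ^+ 2 * x) * p.2 + - (lam ^+ 2) * p.2 ^+ 2)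
     (2 * lam ^+ 2 * `|x| * eta + lam ^+ 2 * eta ^+ 2).
    have := na_add PA (na_scale PA (- 2 * lam ^+ 2 * x) var)
      (na_scale PA (- (lam ^+ 2)) (na_exp PA 2 var)).
    move=> /(na_le PA); apply.
    have l2 : `|lam ^+ 2| = lam ^+ 2 by rewrite ger0_norm ?sqr_ge0.
    by rewrite normrM (normrM (- 2)) !normrN l2 normr_nat.
  have := na_scale PA (lam * c) (na_expR PA (- (lam * x) ^+ 2) q).
  move=> /(na_ext PA); apply => [[u v] _ /=|].
    by rewrite /phi -mulrA; congr (_ * (_ * expR _)); ring.
  case/andP: c01 => c0 c1; rewrite ger0_norm ?mulr_ge0 ?(ltW c0)//.
  by rewrite ler_wpM2r ?expR_ge0// ler_piMr.
have [d [b [db bB dE]]] := power_series_coef expo.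
have dB n : series (fun k => `|d k tt| * eta ^+ k) n <= lam * B.
  apply: le_trans (bB n); apply: ler_sum => k _.
  by rewrite ler_wpM2r ?exprn_ge0 ?(ltW eta0).
have phiE v : `|v| <= eta -> series (fun k => d k tt * v ^+ k) @ \oo --> phi v.
  by move=> veta; exact: (dE (tt, v) (conj I veta)).
have Psi' (v : R) : is_derive v 1 (fun v => Phi (lam * (x + v))) (phi v).
  have := @is_derive1_comp _ Phi (fun v : R => lam * (x + v)) _ _ _ (Phi' _) (is_derive_affine v).
  by rewrite mulrC.
have := na_compose_primitive NA eta0 dB phiE Psi' feta.
by rewrite addr0 ger0_norm//; case/andP: (Phi01 (lam * x)).
Qed.

Let le_expR_sqr (y : R) : y <= expR (y ^+ 2).
Proof. by apply: le_trans (expR_ge1Dx _); have := sqr_ge0 (y - 2^-1); lra. Qed.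

(** On a complex strip of width eta, the distribution function with precision
    lam ^ 2 is at most of size exp (3 lam ^ 2 eta ^ 2). *)
Lemma na_cdf_bounded :
  N (fun s => Phi (lam * (x + f s))) (2 * expR (3 * (lam * eta) ^+ 2)).
Proof.
apply: (na_le NA na_cdf).
have h1 : eta * lam <= expR ((lam * eta) ^+ 2) by rewrite mulrC; exact: le_expR_sqr.
have h2 : expR (- (lam * x) ^+ 2 + (2 * lam ^+ 2 * `|x| * eta + lam ^+ 2 * eta ^+ 2))
   <= expR (2 * (lam * eta) ^+ 2).
  rewrite ler_expR.
  have := sqr_ge0 (lam * (`|x| - eta)); rewrite !exprMn -[x ^+ 2](real_normK (num_real x)).
  by lra.
have [_ P1] := andP (Phi01 (lam * x)).
have h3 : eta * lam * expR (- (lam * x) ^+ 2 + (2 * lam ^+ 2 * `|x| * eta + lam ^+ 2 * eta ^+ 2))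
   <= expR (3 * (lam * eta) ^+ 2).
  apply: (@le_trans _ _ (expR ((lam * eta) ^+ 2) * expR (2 * (lam * eta) ^+ 2))).
    by rewrite ler_pM ?expR_ge0// mulr_ge0// ltW.
  by rewrite -expRD ler_expR; lra.
have h4 : 1 <= expR (3 * (lam * eta) ^+ 2) by rewrite -expR0 ler_expR mulr_ge0// sqr_ge0.
by rewrite mulrA; lra.
Qed.

(** Where x <= -1, the decay exp (- lam ^ 2) keeps half of its exponent on a complex
    strip of width 1/8. *)
Lemma na_cdf_tail : 1 <= lam -> x <= -1 -> eta <= 8^-1 ->
  N (fun s => Phi (lam * (x + f s))) (2 * expR (- (lam ^+ 2 / 2))).
Proof.
move=> lam1 x1 eta8; apply: (na_le NA na_cdf).
have h1 : eta * lam <= expR ((lam * eta) ^+ 2) by rewrite mulrC; exact: le_expR_sqr.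
have x0 : x < 0 by apply: le_lt_trans x1 _; rewrite oppr_lt0.
have l2 : 0 <= lam ^+ 2 by exact: sqr_ge0.
have key : 2^-1 <= x ^+ 2 - 2 * `|x| * eta - 2 * eta ^+ 2.
  rewrite ltr0_norm//.
  have k1 : 0 <= (- x) * (8^-1 - eta) by rewrite mulr_ge0 ?subr_ge0// oppr_ge0 ltW.
  have k2 : 0 <= (- 1 - x) * (- x) by rewrite mulr_ge0 ?subr_ge0// oppr_ge0 ltW.
  have k3 : 0 <= (8^-1 - eta) * (8^-1 + eta) by rewrite mulr_ge0 ?subr_ge0 ?addr_ge0// ltW.
  by lra.
have h2 : Phi (lam * x) <= expR (- (lam ^+ 2 / 2)).
  apply: le_trans (Phi_tail _) _; first by nra.
  rewrite ler_expR exprMn lerN2 ler_wpM2l//; nra.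
have h3 : eta * lam * expR (- (lam * x) ^+ 2 + (2 * lam ^+ 2 * `|x| * eta + lam ^+ 2 * eta ^+ 2))
   <= expR (- (lam ^+ 2 / 2)).
  apply: (@le_trans _ _ (expR ((lam * eta) ^+ 2) * expR (- (lam * x) ^+ 2 +
     (2 * lam ^+ 2 * `|x| * eta + lam ^+ 2 * eta ^+ 2)))).
    by rewrite ler_wpM2r ?expR_ge0.
  rewrite -expRD ler_expR !exprMn.
  have := ler_wpM2l l2 key; lra.
by rewrite mulrA; lra.
Qed.

End GaussianCdfComposition.

(** * Coarse analytic approximation *)

(** Used for the continuity in t at 0 of the sum of a power series. *)
Lemma power_series_lipschitz0 {R : realType} {S : Type} {D : set S}
    {N : (S -> R) -> R -> Prop} (NA : normed_algebra D N) rho H B s t :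
  0 < rho -> power_series D N rho H B -> D s -> `|t| <= rho ->
  `|H (s, t) - H (s, 0)| <= `|t| / rho * B.
Proof.
move=> rho0 HN Ds trho; have [c [b [cb bB cH]]] := power_series_coef HN.
have t0 : `|0 : R| <= rho by rewrite normr0 ltW.
have dH := cvgB (cH (s, t) (conj Ds trho)) (cH (s, 0) (conj Ds t0)).
have b0 k : 0 <= b k by exact: (na_ge0 NA (cb k)).
apply: (@dominated_series_bound _ (fun k => c k s * (t ^+ k - 0 ^+ k))
  (fun k => `|t| / rho * (b k * rho ^+ k))).
  split=> [k|n]; last first.
    rewrite /series /= -mulr_sumr ler_wpM2l ?divr_ge0 ?(ltW rho0)//; exact: bB.
  case: k => [|k].
    by rewrite !expr0 subrr mulr0 normr0 mulr_ge0 ?divr_ge0 ?mulr1 ?(ltW rho0).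
  rewrite expr0n subr0 normrM normrX mulrCA ler_pM//.
    exact: (na_bound NA Ds (cb _)).
  rewrite !exprS mulrACA -mulrA mulVKf ?gt_eqF// ler_wpM2l//.
  by rewrite lerXn2r// nnegrE ltW.
rewrite (_ : series _ = (fun n => series (fun k => c k s * t ^+ k) n -
   series (fun k => c k s * 0 ^+ k) n)); first exact: dH.
apply/funext => n; rewrite /series /= -sumrB; apply: eq_bigr => k _.
by rewrite mulrBr.
Qed.

Lemma half_series_le {R : realType} n : series (fun k => 2^-1 ^+ k.+1 : R) n <= 1.
Proof.
suff -> : series (fun k => 2^-1 ^+ k.+1) n = 1 - 2^-1 ^+ n :> R.
  by rewrite lerBlDr lerDl exprn_ge0.
elim: n => [|n IH]; first by rewrite /series /= big_nil subrr.
by rewrite seriesSr IH exprS; lra.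
Qed.

Lemma expRN_le_half {R : realType} n : expR (- n%:R) <= 2^-1 ^+ n :> R.
Proof.
rewrite -[- n%:R]mulrN1 expRM_natl lerXn2r ?nnegrE ?expR_ge0//.
rewrite expRN lef_pV2 ?posrE ?expR_gt0//.
by apply: le_trans (expR_ge1Dx _); lra.
Qed.

Section CoarseApproximation.
Context {R : realType} {X : normedModType R}.
Variables (Phi : R -> R) (c : R).
Hypothesis c01 : 0 < c <= 1.
Hypothesis Phi' : forall x : R, is_derive x 1 Phi (c * expR (- x ^+ 2)).
Hypothesis Phi01 : forall x, 0 <= Phi x <= 1.
Hypothesis Phi0 : 0 < Phi 0.
Hypothesis Phi_tail : forall x, x <= -1 -> Phi x <= expR (- x ^+ 2).

Variable xs : nat -> X.
Hypothesis xs_net : forall x, exists n, `|x - xs n| < 1.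

Variables (Q : X -> R) (L M m r0 B : R).
Hypotheses (L0 : 0 < L) (M1 : 1 <= M) (m0 : 0 < m) (r00 : 0 < r0).
Hypothesis Q_ge0 : forall x, 0 <= Q x.
Hypothesis Q_at0 : Q 0 = 0.
Hypothesis Q_separating : forall x, M <= `|x| -> m * `|x| <= Q x.
Hypothesis Q_lipschitz : forall x y, `|Q x - Q y| <= L * `|x - y|.
Hypothesis Q_analytic : forall x, analytic_germ r0 (fun h => Q (x + h) - Q x) B.

(** The constants serve the functions a n and u j defined below: a n is at least
    f - M everywhere, and at most f plus a constant at distance less than far
    from xs n; u j is at most f at distance at least far from xs j, and at
    least f + C0 + 1 where that distance is less than 1. The number ell makes up
    for one factor Phi 0. *)
Let A := L + 1.
Let K := m^-1.
Let far := Num.max M (2 * A / m).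
Let ell := - ln (Phi 0).
Let C0 := far + K * L * far + ell + 1.
Let K' := Num.max (2 / m) (C0 + 2).

Let M0 : 0 < M. Proof. exact: lt_le_trans M1. Qed.
Let K0 : 0 < K. Proof. by rewrite invr_gt0. Qed.
Let far_M : M <= far. Proof. by rewrite /far le_max lexx. Qed.
Let far_A : 2 * A <= m * far.
Proof. by rewrite [m * _]mulrC -ler_pdivrMr// /far le_max lexx orbT. Qed.
Let far0 : 0 < far. Proof. exact: lt_le_trans far_M. Qed.
Let ell0 : 0 <= ell.
Proof. by rewrite oppr_ge0 ln_le0//; case/andP: (Phi01 0). Qed.
Let expR_ell : expR (- ell) = Phi 0. Proof. by rewrite opprK lnK. Qed.
Let C00 : 0 < C0.
Proof. by have := mulr_gt0 (mulr_gt0 K0 L0) far0; have := ell0; have := far0; rewrite /C0; lra. Qed.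
Let K'_m : 2 <= K' * m. Proof. by rewrite -ler_pdivrMr// /K' le_max lexx. Qed.
Let K'_C0 : C0 + 2 <= K'. Proof. by rewrite /K' le_max lexx orbT. Qed.
Let K'0 : 0 < K'. Proof. by have := K'_C0; have := C00; lra. Qed.
Let KK' : K <= K'.
Proof. by rewrite /K -(mul1r m^-1) ler_pdivrMr//; have := K'_m; lra. Qed.

Let Phi_homo x y : x <= y -> Phi x <= Phi y.
Proof.
apply: (derive_ge0_homo Phi') => z _; case/andP: c01 => c0 _.
by rewrite mulr_ge0 ?expR_ge0// ltW.
Qed.

Variable f : X -> R.
Hypothesis f_lipschitz : forall x y, `|f x - f y| <= `|x - y|.

Let f_le x y : f x <= f y + `|x - y|.
Proof. by have := le_trans (ler_norm _) (f_lipschitz x y); lra. Qed.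

Let Q_le x y : Q x <= Q y + L * `|x - y|.
Proof. by have := le_trans (ler_norm _) (Q_lipschitz x y); lra. Qed.

Let a n x : R := f (xs n) + K * Q (x - xs n).
Let u j x : R := f (xs j) + K' * (A - Q (x - xs j)).
Let lam n j : R := n%:R * 2^-1 ^+ j.
(** The sum over n is a smooth measure of how far t exceeds the infimum of the
    a n. The factors Phi, close to a step function at u j, make it converge by
    damping the terms with n > j near xs j; away from xs j they are at least
    Phi 0 for t >= f. *)
Let T n x t : R :=
  expR (n.+1%:R * (t - a n x)) * \prod_(0 <= j < n) Phi (lam n j * (t - u j x)).

Let lam0 n j : 0 <= lam n j. Proof. by rewrite mulr_ge0// exprn_ge0. Qed.

Let prod_Phi_ge0 n (w : nat -> R) : 0 <= \prod_(0 <= j < n) Phi (w j).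
Proof. by apply: prodr_ge0 => j _; case/andP: (Phi01 (w j)). Qed.

Let T_ge0 n x t : 0 <= T n x t.
Proof. by rewrite mulr_ge0 ?expR_ge0. Qed.

Let a_lipschitz n x y : a n x <= a n y + K' * L * `|x - y|.
Proof.
rewrite /a -addrA lerD2l; apply: (@le_trans _ _ (K * (Q (y - xs n) + L * `|x - y|))).
  rewrite ler_pM2l//; apply: le_trans (Q_le _ (y - xs n)) _.
  by rewrite opprB addrA subrK.
rewrite mulrDr lerD2l mulrA ler_wpM2r// ler_wpM2r//; exact: ltW.
Qed.

Let u_lipschitz j x y : u j x <= u j y + K' * L * `|x - y|.
Proof.
have := ler_wpM2l (ltW K'0) (Q_le (y - xs j) (x - xs j)).
by rewrite opprB addrA subrK distrC /u; lra.
Qed.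

(** T n is a nondecreasing function of t minus functions which are all
    Lipschitz with the same constant, whatever n is. *)
Let T_le n x y s t : s + K' * L * `|x - y| <= t -> T n y s <= T n x t.
Proof.
move=> st; rewrite ler_pM ?expR_ge0//.
  by rewrite ler_expR ler_pM2l//; have := a_lipschitz n x y; lra.
apply: ler_prod => j _; have [-> /=] := andP (Phi01 (lam n j * (s - u j y))).
by move=> _; apply: Phi_homo; rewrite ler_wpM2l//; have := u_lipschitz j x y; lra.
Qed.

Let T_growth n x s t : s <= t -> expR (t - s) * T n x s <= T n x t.
Proof.
move=> st; rewrite mulrA; apply: ler_pM.
- by rewrite mulr_ge0 ?expR_ge0.
- by [].
- rewrite -expRD ler_expR.
  have : t - s <= n.+1%:R * (t - s) by rewrite ler_peMl ?subr_ge0// ler1n.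
  lra.
- apply: ler_prod => j _; have [-> /=] := andP (Phi01 (lam n j * (s - u j x))).
  by move=> _; apply: Phi_homo; rewrite ler_wpM2l//; lra.
Qed.

Let a_ge n x : f x - M <= a n x.
Proof.
have := f_le x (xs n); have [xM|Mx] := leP M `|x - xs n|.
  have : `|x - xs n| <= K * Q (x - xs n).
    by rewrite /K ler_pdivlMl//; exact: Q_separating.
  by rewrite /a; have := M0; lra.
have := mulr_ge0 (ltW K0) (Q_ge0 (x - xs n)); rewrite /a; lra.
Qed.

(** A value of t below all a n by 1 makes the sum at most 1. *)
Let T_low n x : T n x (f x - M - 1) <= 2^-1 ^+ n.+1.
Proof.
apply: le_trans (expRN_le_half _).
apply: le_trans (_ : expR (n.+1%:R * (f x - M - 1 - a n x)) <= _).
  by rewrite /T ler_piMr ?expR_ge0// prodr_ile1// => j; exact: Phi01.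
rewrite ler_expR -[- n.+1%:R]mulrN1 ler_pM2l//; have := a_ge n x; lra.
Qed.

Let u_le x j : far <= `|x - xs j| -> u j x <= f x.
Proof.
move=> xj; have := f_le (xs j) x; rewrite distrC.
have Qd := Q_separating (le_trans far_M xj).
set d := `|x - xs j| in xj Qd *; rewrite /u.
have h1 : K' * (m * d) <= K' * Q (x - xs j) by rewrite ler_pM2l.
have h2 : K' * (2 * A) <= K' * (m * d).
  by rewrite ler_pM2l// (le_trans far_A)// ler_pM2l.
have h3 : 2 * d <= K' * m * d by rewrite ler_wpM2r//; exact: le_trans (ltW far0) xj.
lra.
Qed.

(** At the first net point at distance less than far from x, all factors Phi
    are at least Phi 0; the exponential outweighs their product. *)
Let T_high x : exists n, 1 < T n x (f x + C0).
Proof.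
have near_x : exists n, `|x - xs n| < far.
  have [n xn] := xs_net x; exists n; apply: lt_le_trans xn _.
  exact: le_trans M1 far_M.
have [n xn nmin] := ex_minnP near_x; exists n.
have Phi_ge j : (j < n)%N -> Phi 0 <= Phi (lam n j * (f x + C0 - u j x)).
  move=> jn; apply: Phi_homo; rewrite mulr_ge0//.
  have : far <= `|x - xs j|.
    by rewrite leNgt; apply/negP => /nmin; rewrite leqNgt jn.
  by move/u_le; have := C00; lra.
have an : a n x <= f x + far + K * L * far.
  have h1 := f_le (xs n) x; rewrite distrC in h1.
  have h2 : K * Q (x - xs n) <= K * L * far.
    rewrite -mulrA ler_pM2l//; apply: le_trans (Q_le _ 0) _.
    by rewrite Q_at0 add0r subr0 ler_pM2l// ltW.
  by rewrite /a; lra.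
apply: (@lt_le_trans _ _ (expR (n.+1%:R * (ell + 1)) * Phi 0 ^+ n)).
  rewrite -expR_ell -expRM_natl -expRD -[ltLHS]expR0 ltr_expR -natr1.
  by have := ell0; have := ler0n R n; lra.
rewrite ler_pM ?expR_ge0 ?exprn_ge0 ?(ltW Phi0)//.
  by rewrite ler_expR ler_pM2l// /C0; lra.
rewrite (_ : Phi 0 ^+ n = \prod_(0 <= j < n) Phi 0); last first.
  by rewrite prodr_const_nat subn0.
rewrite big_nat_cond [leRHS]big_nat_cond.
by apply: ler_prod => j /andP[/andP[_ jn] _]; rewrite (ltW Phi0) Phi_ge.
Qed.

(** Partial sums are used as the sum may be infinite. *)
Let admissible x : set R := [set t | forall N, series (fun n => T n x t) N <= 1].

Let admissible_low x : admissible x (f x - M - 1).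
Proof.
move=> N; apply: le_trans (half_series_le N); apply: ler_sum => n _; exact: T_low.
Qed.

Let admissible_ub x t : admissible x t -> t <= f x + C0.
Proof.
move=> xt; rewrite leNgt; apply/negP => tC; have [n] := T_high x; apply/negP.
rewrite -leNgt; apply: le_trans (xt n.+1); rewrite seriesSr.
apply: (@le_trans _ _ (T n x t)); last by rewrite lerDr; apply: sumr_ge0.
by apply: T_le; rewrite subrr normr0 mulr0 addr0 ltW.
Qed.

Let admissible_le x y s t : s + K' * L * `|x - y| <= t ->
  admissible x t -> admissible y s.
Proof.
move=> st xt N; apply: le_trans (xt N); apply: ler_sum => n _; exact: T_le.
Qed.

Let g x : R := sup (admissible x).

Let admissible_sup x : has_sup (admissible x).
Proof.
split; first by exists (f x - M - 1); exact: admissible_low.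
by exists (f x + C0) => t; exact: admissible_ub.
Qed.

Let le_g x t : admissible x t -> t <= g x.
Proof. by move=> xt; apply: (ub_le_sup (admissible_sup x).2). Qed.

Let g_le x b : (forall t, admissible x t -> t <= b) -> g x <= b.
Proof. by move=> xb; apply: (ge_sup (admissible_sup x).1). Qed.

(** Since T_le holds with one constant for all n, the supremum inherits it: the
    Lipschitz constant of g depends neither on f nor on the number of terms. *)
Let g_le_lipschitz x y : g x <= g y + K' * L * `|x - y|.
Proof.
apply: g_le => t xt; rewrite -lerBlDr; apply: le_g.
by apply: admissible_le xt; rewrite subrK.
Qed.

Let g_lipschitz x y : `|g x - g y| <= K' * L * `|x - y|.
Proof.
have h1 := g_le_lipschitz x y; have h2 := g_le_lipschitz y x.
by rewrite distrC in h2; rewrite ler_norml; apply/andP; split; lra.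
Qed.

Let g_bounds x : f x - M - 1 <= g x <= f x + C0.
Proof.
by rewrite (le_g (admissible_low x))/=; apply: g_le; exact: admissible_ub.
Qed.

Section Germ.
Variable x0 : X.
Let t0 := g x0.

Variables (j0 : nat) (eta rho r : R).
Hypothesis x0_j0 : `|x0 - xs j0| < 1.
Hypotheses (eta0 : 0 < eta) (rho0 : 0 < rho) (r_gt0 : 0 < r) (r_le : r <= r0).
Hypothesis eta_j0 : eta <= 2^-1 ^+ j0 / 8.
Hypothesis r_eta : rho + K' * (r / r0 * B) <= eta.

Let N2 := power_series (@centered_ball R X r) (analytic_germ r) rho.
Let NA := @analytic_germ_algebra R X r r_gt0.
Let N2A : normed_algebra (power_domain (@centered_ball R X r) rho) N2 :=
  power_series_algebra NA rho0.

Let q j (h : X) : R := Q (x0 + h - xs j) - Q (x0 - xs j).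

Let B0 : 0 <= B.
Proof. exact: (na_ge0 (@analytic_germ_algebra R X r0 r00) (Q_analytic x0)). Qed.

Let q_germ j : analytic_germ r (q j) (r / r0 * B).
Proof.
have := analytic_germ_shrink0 r_gt0 r_le (Q_analytic (x0 - xs j)).
move=> /(na_ext NA); apply => // h _.
by rewrite /q addr0 subrr subr0 addrAC.
Qed.

Let linear_germ (k : R) j : `|k| <= K' -> N2 (fun p => p.2 + k * q j p.1) eta.
Proof.
move=> kK; have H := power_series_cst NA rho0 (na_scale NA k (q_germ j)).
have := na_add N2A (power_series_var NA rho0) H => /(na_le N2A); apply.
apply: le_trans r_eta; rewrite lerD2l ler_wpM2r// mulr_ge0//.
by rewrite divr_ge0 ?(ltW r_gt0) ?(ltW r00).
Qed.

(** Hence the factor of index j0 damps all terms of index n > j0 around x0. *)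
Let u_j0 : t0 - u j0 x0 <= - 1.
Proof.
have [_ tC] := andP (g_bounds x0).
have h1 : f x0 - 1 <= f (xs j0).
  by have := f_le x0 (xs j0); have := x0_j0; lra.
have h2 : Q (x0 - xs j0) <= L.
  apply: le_trans (Q_le _ 0) _; rewrite Q_at0 add0r subr0 -[leRHS]mulr1 ler_pM2l//.
  exact: ltW.
have h3 : K' <= K' * (A - Q (x0 - xs j0)).
  by rewrite -[leLHS]mulr1 ler_pM2l// /A; lra.
by have := K'_C0; rewrite /t0 /u; lra.
Qed.

Let D := C0 + M + eta.

Let exp_germ n : N2 (fun p => expR (n.+1%:R * (t0 + p.2 - a n (x0 + p.1))))
  (expR (n.+1%:R * D)).
Proof.
have H : N2 (fun p => n.+1%:R * (p.2 + - K * q n p.1)) (n.+1%:R * eta).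
  have := na_scale N2A n.+1%:R (@linear_germ (- K) n _).
  by rewrite normr_nat; apply; rewrite normrN gtr0_norm.
have := na_expR N2A (n.+1%:R * (t0 - a n x0)) H; move=> /(na_ext N2A); apply.
  move=> p _; rewrite -mulrDr; congr (expR (_ * _)); rewrite /a /q; ring.
rewrite ler_expR -mulrDr ler_pM2l// lerD2r.
have [_ tC] := andP (g_bounds x0); have := a_ge n x0; rewrite /t0; lra.
Qed.

Let Phi_germ n j : N2 (fun p => Phi (lam n j * (t0 + p.2 - u j (x0 + p.1))))
  (2 * expR (3 * (lam n j * eta) ^+ 2)).
Proof.
have H : N2 (fun p => p.2 + K' * q j p.1) eta.
  by apply: linear_germ; rewrite gtr0_norm.
have := na_cdf_bounded N2A c01 Phi' Phi01 (t0 - u j x0) (lam0 n j) eta0 H.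
move=> /(na_ext N2A); apply => // p _.
by congr (Phi (_ * _)); rewrite /u /q; ring.
Qed.

Let Phi_germ_j0 n : 1 <= lam n j0 ->
  N2 (fun p => Phi (lam n j0 * (t0 + p.2 - u j0 (x0 + p.1))))
  (2 * expR (- (lam n j0 ^+ 2 / 2))).
Proof.
move=> lam1.
have H : N2 (fun p => p.2 + K' * q j0 p.1) eta.
  by apply: linear_germ; rewrite gtr0_norm.
have eta8 : eta <= 8^-1.
  by apply: le_trans eta_j0 _; rewrite ler_piMl// exprn_ile1// invf_le1// ler1n.
have := na_cdf_tail N2A c01 Phi' Phi01 Phi_tail (lam0 n j0) eta0 H lam1 u_j0 eta8.
move=> /(na_ext N2A); apply => // p _.
by congr (Phi (_ * _)); rewrite /u /q; ring.
Qed.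

Let T_germ n : N2 (fun p => T n (x0 + p.1) (t0 + p.2))
  (expR (n.+1%:R * D) * \prod_(0 <= j < n) (2 * expR (3 * (lam n j * eta) ^+ 2))).
Proof.
apply: (na_mul N2A (exp_germ n)).
by apply: (na_prod N2A (F := fun j p => Phi (lam n j * (t0 + p.2 - u j (x0 + p.1))))) => j _.
Qed.

Let sum_lam_sqr n : \sum_(0 <= j < n) (lam n j) ^+ 2 <= 2 * n%:R ^+ 2.
Proof.
rewrite mulrC; under eq_bigr do rewrite exprMn.
rewrite -mulr_sumr ler_wpM2l ?sqr_ge0//.
have := @half_series_le R n.
suff : \sum_(0 <= j < n) (2^-1 ^+ j) ^+ 2 <= 2 * series (fun k => 2^-1 ^+ k.+1 : R) n.
  lra.
rewrite /series /= mulr_sumr; apply: ler_sum => j _.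
rewrite [2^-1 ^+ j.+1]exprS mulrA divff ?mul1r// expr2 ler_piMl ?exprn_ge0// exprn_ile1//.
by rewrite invf_le1// ler1n.
Qed.

(** The factor of index j0 kills T n for n large: the imaginary parts cost at
    most exp (6 (n eta) ^ 2), which is less than the square root of the gain. *)
Let T_germ_tail n : (j0 < n)%N -> (2 ^ j0 <= n)%N ->
  N2 (fun p => T n (x0 + p.1) (t0 + p.2))
  (expR (n.+1%:R * D) * 2 ^+ n * expR (- (lam n j0 ^+ 2 / 4))).
Proof.
move=> j0n n2.
have lam1 : 1 <= lam n j0.
  by rewrite /lam exprVn ler_pdivlMr ?exprn_gt0// mul1r -natrX ler_nat.
pose b j : R := if j == j0 then 2 * expR (- (lam n j0 ^+ 2 / 2))
  else 2 * expR (3 * (lam n j * eta) ^+ 2).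
have H : N2 (fun p => \prod_(0 <= j < n) Phi (lam n j * (t0 + p.2 - u j (x0 + p.1))))
    (\prod_(0 <= j < n) b j).
  apply: (na_prod N2A (F := fun j p => Phi (lam n j * (t0 + p.2 - u j (x0 + p.1))))) => j _.
  rewrite /b; case: eqP => [->|_]; [exact: Phi_germ_j0|exact: Phi_germ].
apply: (na_le N2A (na_mul N2A (exp_germ n) H)).
rewrite -mulrA ler_pM2l ?expR_gt0//.
have bE j : b j <= 2 * expR (3 * eta ^+ 2 * (lam n j) ^+ 2 -
     (if j == j0 then lam n j0 ^+ 2 / 2 else 0)).
  rewrite /b; case: eqP => [->|_].
    rewrite ler_pM2l// ler_expR lerDr mulr_ge0 ?sqr_ge0// mulr_ge0 ?sqr_ge0//.
  by rewrite subr0 exprMn [lam n j ^+ 2 * _]mulrC mulrA.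
apply: (@le_trans _ _ (\prod_(0 <= j < n) (2 * expR (3 * eta ^+ 2 * (lam n j) ^+ 2 -
     (if j == j0 then lam n j0 ^+ 2 / 2 else 0))))).
  by apply: ler_prod => j _; rewrite (bE j) andbT /b; case: ifP => _; rewrite mulr_ge0 ?expR_ge0.
rewrite big_split/= prodr_const_nat subn0 ler_pM2l ?exprn_gt0//.
rewrite -expR_sum ler_expR sumrB -mulr_sumr -big_mkcond/= big_nat1_eq j0n/=.
have h1 := ler_wpM2l (sqr_ge0 eta) (sum_lam_sqr n).
have h2 : 24 * eta ^+ 2 * n%:R ^+ 2 <= lam n j0 ^+ 2.
  rewrite /lam exprMn mulrC ler_wpM2l ?sqr_ge0//.
  have e0 : 0 <= 2^-1 ^+ j0 :> R by rewrite exprn_ge0.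
  have := eta_j0; have := eta0; nra.
lra.
Qed.

Let D0 : 0 <= D.
Proof. by have := C00; have := M0; have := eta0; rewrite /D; lra. Qed.

Let T_germ_summable : exists (b : nat -> R) b_sum,
  (forall n, N2 (fun p => T n (x0 + p.1) (t0 + p.2)) (b n)) /\
  (forall n, series b n <= b_sum).
Proof.
pose cc : R := (2^-1 ^+ j0) ^+ 2 / 4.
have cc0 : 0 < cc by rewrite divr_gt0// exprn_gt0// exprn_gt0.
have DD : 0 <= (2 * D + 2) / cc by rewrite divr_ge0 ?(ltW cc0)//; have := D0; lra.
have := archi_boundP DD; set n1 := Num.bound _; rewrite ltr_pdivrMr// => n1P.
pose N1 := maxn n1 (maxn j0.+1 (2 ^ j0)).
pose d n := expR (n.+1%:R * D) * \prod_(0 <= j < n) (2 * expR (3 * (lam n j * eta) ^+ 2)).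
have d0 n : 0 <= d n.
  by rewrite mulr_ge0 ?expR_ge0// prodr_ge0// => j _; rewrite mulr_ge0 ?expR_ge0.
pose d' n := if (n < N1)%N then d n else 0.
have d'0 n : 0 <= d' n by rewrite /d'; case: ifP.
exists (fun n => d' n + 2 * 2^-1 ^+ n.+1), (series d' N1 + 2); split=> n; last first.
  rewrite /series /= big_split/= -mulr_sumr lerD//; last first.
    by have := @half_series_le R n; rewrite /series /=; lra.
  have cv : series d' @ \oo --> series d' N1.
    by apply: cvg_series_finite_support => k; rewrite /d' leqNgt => /negbTE->.
  rewrite -[leRHS](cvg_lim _ cv)//; apply: nondecreasing_cvgn_le.
    by apply/nondecreasing_series.
  by apply/cvg_ex; exists (series d' N1).
rewrite /d'; have [nN|] := ltnP n N1.
  by apply: (na_le N2A (T_germ n)); rewrite lerDl mulr_ge0// exprn_ge0.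
rewrite !geq_max => /and3P[n1n j0n n2].
apply: (na_le N2A (T_germ_tail j0n n2)); rewrite add0r [2^-1 ^+ n.+1]exprS mulrA divff// mul1r.
have n10 : 1 <= n%:R :> R by rewrite ler1n (leq_trans _ j0n).
apply: le_trans (expRN_le_half n).
have e2 : 2 ^+ n <= expR n%:R :> R.
  rewrite -[n%:R]mulr1 expRM_natl lerXn2r ?nnegrE ?expR_ge0//.
  by apply: le_trans (expR_ge1Dx _); lra.
apply: (@le_trans _ _ (expR (n.+1%:R * D) * expR n%:R * expR (- (lam n j0 ^+ 2 / 4)))).
  by rewrite ler_wpM2r ?expR_ge0// ler_wpM2l ?expR_ge0.
rewrite -!expRD ler_expR.
have -> : lam n j0 ^+ 2 / 4 = n%:R * (n%:R * cc).
  by rewrite /lam /cc; field.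
have ncc : 2 * D + 2 <= n%:R * cc.
  by rewrite (le_trans (ltW n1P))// ler_wpM2r ?(ltW cc0)// ler_nat.
have h1 := ler_wpM2l (ler0n R n) ncc.
have h2 := ler_wpM2r D0 n10.
rewrite -natr1; lra.
Qed.

Let F (p : X * R) : R := limn (series (fun n => T n (x0 + p.1) (t0 + p.2))).

Let Dom := power_domain (@centered_ball R X r) rho.

Let F_cvg p : Dom p -> series (fun n => T n (x0 + p.1) (t0 + p.2)) @ \oo --> F p.
Proof.
move=> Dp; have [b [b_sum [Tb bb]]] := T_germ_summable.
apply: (@cvg_dominated_series _ _ b b_sum); split=> // n.
exact: (na_bound N2A Dp (Tb n)).
Qed.

Let F_germ : exists BF, N2 F BF.
Proof.
have [b [b_sum [Tb bb]]] := T_germ_summable; exists b_sum.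
exact: (na_sum N2A Tb bb F_cvg).
Qed.

Let ball0 : centered_ball r (0 : X).
Proof. by rewrite /centered_ball/= normr0 ltW. Qed.

Let Dom0 t : `|t| <= rho -> Dom (0, t).
Proof. by []. Qed.

Let series_le_F p N : Dom p ->
  series (fun n => T n (x0 + p.1) (t0 + p.2)) N <= F p.
Proof.
move=> Dp; apply: nondecreasing_cvgn_le; last exact: F_cvg.
by apply/nondecreasing_series => n _ _; exact: T_ge0.
Qed.

Let F_le p b : Dom p ->
  (forall N, series (fun n => T n (x0 + p.1) (t0 + p.2)) N <= b) -> F p <= b.
Proof. by move=> Dp pb; apply: limr_le; [exact: F_cvg|exact: nearW]. Qed.

Let admissibleP p : Dom p -> admissible (x0 + p.1) (t0 + p.2) <-> F p <= 1.
Proof.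
move=> Dp; split=> [pa|F1 N]; first exact: F_le.
exact: le_trans (series_le_F N Dp) F1.
Qed.

Let F_growth h s t : Dom (h, s) -> Dom (h, t) -> s <= t ->
  expR (t - s) * F (h, s) <= F (h, t).
Proof.
move=> Ds Dt st; rewrite mulrC -ler_pdivlMr ?expR_gt0//; apply: F_le => // N.
rewrite ler_pdivlMr ?expR_gt0//; apply: le_trans (series_le_F N Dt).
rewrite mulrC /series /= mulr_sumr; apply: ler_sum => n _.
rewrite (_ : t - s = (t0 + t) - (t0 + s)); last by ring.
by apply: T_growth; rewrite lerD2l.
Qed.

(** F (0, t) <= 1 for t < 0 and F (0, t) > 1 for t > 0, by the definition of g, and
    F (0, t) is continuous in t. *)
Let F00 : F (0, 0) = 1.
Proof.
have [BF FN] := F_germ.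
have lip t : `|t| <= rho -> `|F (0, t) - F (0, 0)| <= `|t| / rho * BF.
  exact: (power_series_lipschitz0 NA rho0 FN ball0).
have BF0 : 0 <= BF by exact: (na_ge0 N2A FN).
have small e : 0 < e -> exists2 t, 0 < t <= rho & t / rho * BF <= e.
  move=> e0; exists (Num.min rho (e * rho / (BF + 1))).
    by rewrite lt_min rho0 divr_gt0 ?mulr_gt0 ?ltr_wpDl//= ge_min lexx.
  rewrite mulrAC ler_pdivrMr//.
  apply: (@le_trans _ _ (e * rho / (BF + 1) * BF)).
    by rewrite ler_wpM2r// ge_min lexx orbT.
  rewrite mulrAC ler_pdivrMr ?ltr_wpDl// ler_wpM2l ?mulr_ge0 ?(ltW e0) ?(ltW rho0)//.
  by rewrite lerDl.
apply/le_anti/andP; split; apply/ler_addgt0Pl => e e0.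
- have [t /andP[tgt0 trho] te] := small e e0.
  have tn : `|- t| <= rho by rewrite normrN gtr0_norm.
  have h : F (0, 0) - F (0, - t) <= t / rho * BF.
    by have := lip _ tn; rewrite normrN (gtr0_norm tgt0) distrC; apply: le_trans; exact: ler_norm.
  have [s sa st] := sup_adherent tgt0 (admissible_sup x0).
  have : F (0, - t) <= 1.
    apply: (admissibleP (Dom0 tn)).1; apply: admissible_le sa.
    by rewrite /= addr0 subrr normr0 mulr0 addr0 ltW.
  by lra.
- have [t /andP[tgt0 trho] te] := small e e0.
  have tn : `|t| <= rho by rewrite gtr0_norm.
  have h : F (0, t) - F (0, 0) <= t / rho * BF.
    by have := lip _ tn; rewrite (gtr0_norm tgt0); apply: le_trans; exact: ler_norm.
  have : ~ F (0, t) <= 1.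
    move=> /(admissibleP (Dom0 tn)).2; rewrite /= addr0 => /le_g; rewrite -/t0 /=.
    by rewrite gerDl leNgt tgt0.
  by move/negP; rewrite -ltNge; lra.
Qed.

(** Since F (h, t) increases with t at least as fast as exp t, the implicit
    function theorem applies to F = 1, and its solution is the supremum that
    defines g. *)
Lemma g_germ : exists r' b, 0 < r' /\ analytic_germ r' (fun h => g (x0 + h)) b.
Proof.
have [BF FN] := F_germ.
pose H p := F p - 1.
have HN : N2 H (BF + `|1|) by exact: (na_sub N2A FN (na_cst N2A 1)).
have zrho : `|0 : R| <= rho by rewrite normr0 ltW.
have H0 : H (0, 0) = 0 by rewrite /H F00 subrr.
have H_slope t : 0 <= t <= rho -> t <= H (0, t).
  move=> /andP[tge0 trho]; have tn : `|t| <= rho by rewrite ger0_norm.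
  have := F_growth (Dom0 zrho) (Dom0 tn) tge0; rewrite F00 subr0 mulr1 /H.
  have := expR_ge1Dx t; lra.
have [r' [t [r'0 r'r tN tE]]] := analytic_implicit_function r_gt0 rho0 HN H0 H_slope.
have NA' := @analytic_germ_algebra R X r' r'0.
exists r', (`|t0| + rho); split=> //.
apply: (na_ext NA' (na_add NA' (na_cst NA' t0) tN)) => // h hr'.
have Dh : Dom (h, t h).
  by split; [exact: le_trans hr' r'r|exact: (na_bound NA' hr' tN)].
have F1 : F (h, t h) = 1 by apply/eqP; rewrite -subr_eq0; apply/eqP; exact: tE.
apply/le_anti/andP; split.
  by apply: le_g; apply: (admissibleP Dh).2; rewrite F1.
apply: g_le => s; apply: contraPP => /negP; rewrite -ltNge => ts sa.
set d := s - (t0 + t h); have d0 : 0 < d by rewrite subr_gt0.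
have : F (h, t h) <= expR (- d).
  apply: F_le => // N; rewrite expRN -div1r ler_pdivlMr ?expR_gt0//.
  apply: le_trans (sa N); rewrite mulrC /series /= mulr_sumr.
  by apply: ler_sum => n _; apply: T_growth; exact: ltW.
by rewrite F1 -[leLHS]expR0 ler_expR oppr_ge0 leNgt d0.
Qed.

End Germ.

(** The width eta must decrease with the index j0 of a net point near x0; the radius
    r is then small enough for K' * Q to vary by at most eta / 2 in norm. *)
Lemma coarse_approximation_of : exists g' : X -> R,
  [/\ forall x y, `|g' x - g' y| <= K' * L * `|x - y|,
      forall x, `|f x - g' x| <= C0 + M + 1 & locally_analytic g'].
Proof.
exists g; split=> [||x0]; first exact: g_lipschitz.
  move=> x; have [h1 h2] := andP (g_bounds x); rewrite ler_norml.
  have C0p := C00; have Mp := M0; by apply/andP; split; lra.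
have [j0 x0j0] := xs_net x0.
have B0 : 0 <= B by exact: (na_ge0 (@analytic_germ_algebra R X r0 r00) (Q_analytic x0)).
pose eta : R := 2^-1 ^+ j0 / 8; have eta0 : 0 < eta by rewrite divr_gt0// exprn_gt0.
have rho0 : 0 < eta / 2 by rewrite divr_gt0.
pose r := Num.min r0 (r0 * (eta / 2) / (K' * (B + 1))).
have KB : 0 < K' * (B + 1) by rewrite mulr_gt0// ltr_wpDl.
have r_gt0 : 0 < r by rewrite lt_min r00 divr_gt0// mulr_gt0.
have r_le : r <= r0 by rewrite ge_min lexx.
apply: (@g_germ x0 j0 eta (eta / 2) r) => //.
have : r * (K' * (B + 1)) <= r0 * (eta / 2).
  by rewrite -ler_pdivlMr// ge_min lexx orbT.
rewrite -ler_pdivrMl// => h.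
have h2 : K' * (r / r0 * B) <= r0^-1 * (r * (K' * (B + 1))).
  rewrite [leLHS](_ : _ = r0^-1 * (r * (K' * B))); last by ring.
  by rewrite ler_wpM2l ?invr_ge0 ?(ltW r00)// ler_wpM2l ?(ltW r_gt0)// ler_wpM2l ?(ltW K'0)// lerDl.
lra.
Qed.

End CoarseApproximation.

(** The error is fixed but does not depend on the function, so that rescaling turns
    it into any prescribed one. *)
Theorem coarse_approximation {R : realType} {X : normedModType R} (xs : nat -> X)
    (Q : X -> R) (L M m r0 B : R) :
  (forall x, exists n, `|x - xs n| < 1) ->
  0 < L -> 1 <= M -> 0 < m -> 0 < r0 ->
  (forall x, 0 <= Q x) -> Q 0 = 0 ->
  (forall x, M <= `|x| -> m * `|x| <= Q x) ->
  (forall x y, `|Q x - Q y| <= L * `|x - y|) ->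
  (forall x, analytic_germ r0 (fun h => Q (x + h) - Q x) B) ->
  exists C E : R, forall f : X -> R, (forall x y, `|f x - f y| <= `|x - y|) ->
    exists g, [/\ forall x y, `|g x - g y| <= C * `|x - y|,
      forall x, `|f x - g x| <= E & locally_analytic g].
Proof.
move=> xs_net L0 M1 m0 r00 Q0 Qat0 Qsep Qlip Qan.
have [Phi [c [c01 Phi' Phi01 Phi0 Phi_tail]]] := @gaussian_cdf R.
eexists; eexists => f flip; exact: (coarse_approximation_of c01 Phi' Phi01 Phi0 Phi_tail
  xs_net L0 M1 m0 r00 Q0 Qat0 Qsep Qlip Qan flip).
Qed.

(** * Averages over the circle *)

Section CircleAverage.
Context {R : realType}.
Notation mu := (@lebesgue_measure R).
Let I : set R := `[0, pi *+ 2].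

Let pi20 : 0 < pi *+ 2 :> R. Proof. by rewrite pmulrn_rgt0// pi_gt0. Qed.
Let mI : measurable (I : set (measurableTypeR R)). Proof. exact: measurable_itv. Qed.
Let muI : mu I = (pi *+ 2)%:E.
Proof. by rewrite lebesgue_measure_itv/= lte_fin pi20 sube0. Qed.

Definition circle_integrable (u : R -> R) := mu.-integrable I (EFin \o u).

Definition circle_average (u : R -> R) : R := (pi *+ 2)^-1 * \int[mu]_(t in I) u t.

Lemma continuous_circle_integrable (u : R -> R) : continuous u -> circle_integrable u.
Proof.
move=> cu; apply: continuous_compact_integrable; first exact: segment_compact.
exact: continuous_subspaceT.
Qed.

Lemma circle_averageD u v : circle_integrable u -> circle_integrable v ->
  circle_average (fun t => u t + v t) = circle_average u + circle_average v.
Proof. by move=> iu iv; rewrite /circle_average RintegralD// mulrDr. Qed.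

Lemma circle_averageZ (k : R) u : circle_integrable u ->
  circle_average (fun t => k * u t) = k * circle_average u.
Proof. by move=> iu; rewrite /circle_average RintegralZl// mulrCA. Qed.

Lemma circle_integrableD u v : circle_integrable u -> circle_integrable v ->
  circle_integrable (fun t => u t + v t).
Proof. by move=> iu iv; apply: (integrableD _ iu iv). Qed.

Lemma circle_integrableZ (k : R) u : circle_integrable u ->
  circle_integrable (fun t => k * u t).
Proof. by move=> iu; apply: (integrableZl _ k iu). Qed.

Lemma circle_average_cst (k : R) : circle_average (fun=> k) = k.
Proof.
rewrite /circle_average Rintegral_cst// [fine _](congr1 fine muI)/=.
by rewrite mulrCA mulVf ?mulr1// gt_eqF.
Qed.

Lemma eq_circle_average u v : u =1 v -> circle_average u = circle_average v.
Proof. by move=> /funext ->. Qed.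

Lemma circle_average_bound u (K : R) : circle_integrable u ->
  (forall t, `|u t| <= K) -> `|circle_average u| <= K.
Proof.
move=> iu uK; rewrite /circle_average normrM ger0_norm ?invr_ge0 ?(ltW pi20)//.
rewrite ler_pdivrMl//; apply: le_trans (le_normr_Rintegral mI iu) _.
apply: (@le_trans _ _ (\int[mu]_(t in I) K)).
  apply: le_Rintegral => //; first exact: (integrable_norm iu).
  by apply: continuous_circle_integrable => x; exact: cvg_cst.
by rewrite Rintegral_cst// [fine _](congr1 fine muI)/= mulrC.
Qed.

Lemma circle_dominated_convergence (w : nat -> R -> R) u (K : R) :
  (\forall n \near \oo, continuous (w n) /\ forall t, `|w n t| <= K) ->
  (forall t, w ^~ t @ \oo --> u t) ->
  circle_integrable u /\
  (fun n => circle_average (w n)) @ \oo --> circle_average u.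
Proof.
move=> [n0 _ wK] wu.
have cw n : continuous (w (n + n0)%N) by case: (wK (n + n0)%N _); rewrite /= ?leq_addl.
have bw n t : `|w (n + n0)%N t| <= K.
  by case: (wK (n + n0)%N _) => [|_]; rewrite /= ?leq_addl.
have wu' t : (fun n => w (n + n0)%N t) @ \oo --> u t.
  by rewrite (cvg_shiftn n0 (w ^~ t)); exact: wu.
have mw n : measurable_fun I (w (n + n0)%N).
  by apply: measurable_funTS; exact: continuous_measurable_fun.
have mu_ : measurable_fun I u by apply: measurable_fun_cvg mw _ => t _; exact: wu'.
have [||||| iu _ cvg_int] := @dominated_convergence _ _ _ mu I mI
  (fun n => EFin \o w (n + n0)%N) (EFin \o u) (EFin \o (fun=> K)).
- by move=> n; apply/measurable_EFinP; exact: mw.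
- exact/measurable_EFinP.
- by apply: aeW => t _; apply: cvg_EFin; [exact: nearW|exact: wu'].
- by apply: continuous_circle_integrable => x; exact: cvg_cst.
- by apply: aeW => t n _; rewrite /= lee_fin.
split=> //; rewrite -(cvg_shiftn n0) /circle_average.
apply: cvgM; first exact: cvg_cst.
apply: fine_cvg; rewrite fineK; first exact: cvg_int.
exact: integrable_fin_num.
Qed.

(** Two primitives on the line are compared; the function itself is not
    assumed to be differentiable. *)
Lemma circle_average_shift u (e : R) : continuous u ->
  (forall t, u (t + pi *+ 2) = u t) ->
  circle_average (fun t => u (t + e)) = circle_average u.
Proof.
move=> cu per; rewrite /circle_average; congr (_ * _).
pose a : R := - `|e| - 1.
pose U (x : R) : R := \int[mu]_(t in `[a, x]) u t.
have U' (x : R) : a < x -> is_derive x 1 U (u x).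
  move=> ax; have xx1 : x < x + 1 by rewrite ltrDl.
  have iu : mu.-integrable `[a, x + 1] (EFin \o u).
    apply: continuous_compact_integrable; first exact: segment_compact.
    exact: continuous_subspaceT.
  have [dU UE] := continuous_FTC1_closed xx1 iu ax (cu x).
  by split=> //; rewrite -derive1E.
have FTC (v : R -> R) (d : R) : continuous v -> (forall x : R, v x = u (x + d)) -> a < d ->
    \int[mu]_(t in I) v t = U (pi *+ 2 + d) - U d.
  move=> cv vE ad.
  have V' (x : R) : 0 <= x -> is_derive x 1 (fun x : R => U (x + d)) (v x).
    move=> x0; have axd : a < x + d by rewrite (lt_le_trans ad)// lerDr.
    have sh : is_derive x 1 (fun x : R => x + d) 1.
      by rewrite -[X in is_derive _ _ _ X]addr0; apply: is_deriveD.
    have := @is_derive1_comp _ U (fun x : R => x + d) _ _ _ (U' _ axd) sh.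
    by rewrite mulr1 vE.
  have cV (x : R) : 0 <= x -> {for x, continuous (fun x : R => U (x + d))}.
    by move=> /V'[dV _]; apply/differentiable_continuous/derivable1_diffP.
  rewrite /Rintegral (@continuous_FTC2 _ v (fun x : R => U (x + d)) 0 (pi *+ 2) pi20).
  - by rewrite /= add0r.
  - exact: continuous_subspaceT.
  - split.
    + by move=> x; rewrite in_itv/= => /andP[/ltW x0 _]; case: (V' x x0).
    + by apply: cvg_at_right_filter; exact: cV.
    + by apply: cvg_at_left_filter; apply: cV; exact: ltW.
  - move=> x; rewrite in_itv/= => /andP[/ltW x0 _].
    by rewrite derive1E; case: (V' x x0).
have ae : a < e by rewrite /a ltrBlDr; have := lerNnormlW (lexx `|e|); lra.
have a0 : a < 0 by rewrite /a; have := normr_ge0 e; lra.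
rewrite (FTC _ e)//; last first.
  move=> x; apply: (@continuous_comp _ _ _ (fun t => t + e) u x); last exact: cu.
  by apply: cvgD; [exact: cvg_id|exact: cvg_cst].
rewrite (FTC u 0)//; last by move=> x; rewrite addr0.
pose W (x : R) : R := U (x + pi *+ 2) - U x.
have W' (x : R) : a < x -> is_derive x 1 W 0.
  move=> ax; rewrite -(subrr (u x)); apply: is_deriveB; last exact: U'.
  have axp : a < x + pi *+ 2 by rewrite (lt_trans ax)// ltrDl.
  have sh : is_derive x 1 (fun x : R => x + pi *+ 2) 1.
    by rewrite -[X in is_derive _ _ _ X]addr0; apply: is_deriveD.
  have := @is_derive1_comp _ U (fun x : R => x + pi *+ 2) _ _ _ (U' _ axp) sh.
  by rewrite mulr1 per.
have Wcst (x y : R) : a < x -> x < y -> W x = W y.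
  move=> ax xy; have [||z _ /eqP] := @MVT _ W (fun=> 0) x y xy.
  - by move=> z; rewrite in_itv/= => /andP[xz _]; apply: W'; exact: lt_trans xz.
  - apply: continuous_in_subspaceT => z; rewrite inE/= in_itv/= => /andP[xz _].
    apply/differentiable_continuous/derivable1_diffP.
    by case: (W' z (lt_le_trans ax xz)).
  by rewrite mul0r subr_eq0 => /eqP.
rewrite -![pi *+ 2 + _]addrC -/(W e) -/(W 0).
by have [e0|e0|->//] := ltgtP e 0; [apply: Wcst|apply/esym/Wcst].
Qed.

End CircleAverage.

(** * Holomorphic functions as pairs of real functions *)

Section Derivatives.
Context {R : realType} {V W : normedModType R}.

Lemma is_derive_cvgP (f : V -> W) (a v : V) (d : W) :
  is_derive a v f d <->
  (fun e : R => e^-1 *: (f (e *: v + a) - f a)) @ (0 : R)^' --> d.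
Proof.
split=> [[df <-]|fd]; first exact: df.
by split; [apply/cvg_ex; exists d|apply/cvg_lim => //; exact: norm_hausdorff].
Qed.

Lemma cvg_line (u : R -> V) (k z : V) : u @ (0 : R)^' --> k ->
  (fun e : R => e *: u e + z) @ (0 : R)^' --> z.
Proof.
move=> uk; have : (fun e : R => e *: u e + z) @ (0 : R)^' --> 0 *: k + z.
  apply: cvgD; last exact: cvg_cst.
  by apply: cvgZ uk; apply: cvg_within_filter; exact: cvg_id.
by rewrite scale0r add0r.
Qed.

End Derivatives.

Lemma is_derive_scale {R : realType} {V : normedModType R} (f : R -> R) (df t : R)
  (v : V) : is_derive t 1 f df -> is_derive t 1 (fun s => f s *: v) (df *: v).
Proof.
move=> /is_derive_cvgP fd; apply/is_derive_cvgP.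
under eq_fun do rewrite -scalerBl scalerA.
exact: cvgZr_tmp fd.
Qed.

Lemma bounded_derive_lipschitz {R : realType} (f df : R -> R) (a b K : R) :
  (forall x : R, a < x < b -> is_derive x 1 f (df x)) ->
  (forall x, a < x < b -> `|df x| <= K) ->
  forall x y, a < x < b -> a < y < b -> `|f x - f y| <= K * `|x - y|.
Proof.
move=> f' dfK; suff lt_case x y : a < x < b -> a < y < b -> x < y ->
    `|f x - f y| <= K * `|x - y|.
  move=> x y xab yab; have [xy|yx|->] := ltgtP x y.
  - exact: lt_case.
  - by rewrite distrC [`|x - y|]distrC; exact: lt_case.
  - by rewrite !subrr normr0 mulr0.
move=> /andP[ax xb] /andP[ay yb] xy.
have [||z zxy E] := @MVT _ f df x y xy.
- move=> z; rewrite in_itv/= => /andP[xz zy]; apply: f'.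
  by rewrite (lt_trans ax)//= (lt_trans zy).
- apply: continuous_in_subspaceT => z; rewrite inE/= in_itv/= => /andP[xz zy].
  apply/differentiable_continuous/derivable1_diffP.
  have zab : a < z < b by rewrite (lt_le_trans ax)//= (le_lt_trans zy).
  by case: (f' z zab).
rewrite distrC E normrM [`|x - y|]distrC ler_wpM2r//; apply: dfK.
move: zxy; rewrite in_itv/= => /andP[xz zy].
by rewrite (lt_trans ax)//= (lt_trans zy).
Qed.

Section HolomorphicPairs.
Context {R : realType} {X : normedModType R}.
Notation V := (X * X)%type.
Implicit Types (z w h k : V) (G : V -> R) (L d : R).

Definition mul_i z : V := (- z.2, z.1).

Definition tube d : set V := [set z | `|z.2| < d].

(** Differentiability is asked for along lines, a property which averages over
    circles inherit. *)
Record tube_smooth d L G : Prop := TubeSmooth {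
  ts_ge0 : 0 <= L;
  ts_lipschitz : forall z w, tube d z -> tube d w -> `|G z - G w| <= L * `|z - w|;
  ts_derivable : forall z k, tube d z -> derivable G z k;
  ts_linear : forall z (a : R) h k, tube d z ->
    'D_(a *: h + k) G z = a * 'D_h G z + 'D_k G z }.

(** G1 and G2 are the real and imaginary parts of a holomorphic function, so that
    all limits and integrals below are those of real functions. *)
Record holomorphic_pair d L G1 G2 : Prop := HolomorphicPair {
  hp_re : tube_smooth d L G1;
  hp_im : tube_smooth d L G2;
  hp_cr_re : forall z k, tube d z -> 'D_(mul_i k) G1 z = - 'D_k G2 z;
  hp_cr_im : forall z k, tube d z -> 'D_(mul_i k) G2 z = 'D_k G1 z }.

Lemma norm_fst_le z : `|z.1| <= `|z|.
Proof. by rewrite [leRHS]prod_normE le_max lexx. Qed.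

Lemma norm_snd_le z : `|z.2| <= `|z|.
Proof. by rewrite [leRHS]prod_normE le_max lexx orbT. Qed.

Lemma norm_mul_i z : `|mul_i z| = `|z|.
Proof. by rewrite !prod_normE /= normrN maxC. Qed.

Lemma tube_near d z : tube d z -> \forall w \near z, tube d w.
Proof.
rewrite /tube/= => zd; apply/nbhs_ballP; exists (d - `|z.2|); rewrite /= ?subr_gt0//.
move=> w; rewrite -ball_normE/= ltrBrDl => zw.
have wz : `|w.2| <= `|z.2| + `|z.2 - w.2|.
  by rewrite distrC -{1}(subrK z.2 w.2) addrC ler_normD.
rewrite (le_lt_trans wz)// (le_lt_trans _ zw)// lerD2l.
exact: (norm_snd_le (z - w)).
Qed.

Section TubeSmooth.
Variables (d L : R) (G : V -> R).
Hypothesis GS : tube_smooth d L G.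

Lemma ts_is_derive z k : tube d z -> is_derive z k G ('D_k G z).
Proof. by move=> dz; split=> //; exact: (ts_derivable GS). Qed.

Lemma ts_linear0 z : tube d z -> 'D_0 G z = 0.
Proof.
move=> dz; have := ts_linear GS 1 0 0 dz; rewrite scaler0 addr0 mul1r.
by move/eqP; rewrite -[X in X == _]addr0 (inj_eq (addrI _)) => /eqP.
Qed.

Lemma ts_linearZ z (a : R) k : tube d z -> 'D_(a *: k) G z = a * 'D_k G z.
Proof. by move=> dz; rewrite -[a *: k]addr0 (ts_linear GS)// ts_linear0// addr0. Qed.

Lemma ts_derive_bound z k : tube d z -> `|'D_k G z| <= L * `|k|.
Proof.
move=> dz; have /is_derive_cvgP H := ts_is_derive k dz.
apply: cvg_norm_le H _.
have near_z : \forall e \near (0 : R)^', tube d (e *: k + z).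
  exact: (cvg_line (cvg_cst k) (tube_near dz)).
near=> e.
have e0 : e != 0 by near: e; exact: nbhs_dnbhs_neq.
rewrite normrZ normfV ler_pdivrMl ?normr_gt0// mulrCA.
apply: le_trans (ts_lipschitz GS _ dz) _; first by near: e.
by rewrite addrK normrZ.
Unshelve. all: by end_near. Qed.

(** A Lipschitz function that has derivatives along lines has derivatives along
    curves. *)
Lemma ts_derive_curve (gam : R -> V) (t : R) k : tube d (gam t) ->
  is_derive t 1 gam k -> is_derive t 1 (fun s => G (gam s)) ('D_k G (gam t)).
Proof.
move=> dz /is_derive_cvgP gamk.
have /is_derive_cvgP Gk := ts_is_derive k dz.
apply/is_derive_cvgP; apply/cvgrPdist_le => eps eps0.
have L1 : 0 < 2 * (L + 1) by rewrite mulr_gt0// ltr_wpDl// (ts_ge0 GS).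
have c0 := cvg_line (cvg_cst k) (tube_near dz).
have c1 : (fun e : R => gam (e *: 1 + t)) @ (0 : R)^' --> gam t.
  rewrite (_ : (fun e : R => _) = (fun e : R => e *: (e^-1 *: (gam (e *: 1 + t) - gam t))
     + gam t)); first exact: cvg_line gamk.
  apply/funext => e; have [->|e0] := eqVneq e 0.
    by rewrite !scale0r !add0r.
  by rewrite scalerA mulfV// scale1r subrK.
have {}c1 := c1 _ (tube_near dz).
near=> e.
have e0 : e != 0 by near: e; exact: nbhs_dnbhs_neq.
have dz1 : tube d (gam (e *: 1 + t)) by near: e; exact: c1.
have dz2 : tube d (e *: k + gam t) by near: e; exact: c0.
have gk : `|k - e^-1 *: (gam (e *: 1 + t) - gam t)| <= eps / (2 * (L + 1)).
  by near: e; move/cvgrPdist_le : gamk; apply; rewrite divr_gt0.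
have Gkk : `|'D_k G (gam t) - e^-1 *: (G (e *: k + gam t) - G (gam t))| <= eps / 2.
  by near: e; move/cvgrPdist_le : Gk; apply; rewrite divr_gt0.
set z1 := gam (e *: 1 + t) in dz1 gk *; set z2 := e *: k + gam t in dz2 Gkk *.
have z12 : `|e^-1 *: (G z1 - G z2)| <= eps / 2.
  rewrite normrZ; apply: (@le_trans _ _ (`|e^-1| * (L * `|z1 - z2|))).
    by rewrite ler_wpM2l//; exact: (ts_lipschitz GS).
  rewrite mulrCA -normrZ.
  have -> : e^-1 *: (z1 - z2) = - (k - e^-1 *: (z1 - gam t)).
    have -> : z1 - z2 = (z1 - gam t) - e *: k by rewrite /z2 opprD addrA addrAC.
    by rewrite opprB scalerBr scalerA mulVf// scale1r.
  rewrite normrN; apply: (@le_trans _ _ ((L + 1) * (eps / (2 * (L + 1))))).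
    by apply: ler_pM => //; [exact: (ts_ge0 GS)|rewrite lerDl].
  rewrite le_eqVlt; apply/orP; left; apply/eqP; field.
  by rewrite gt_eqF// ltr_wpDl// (ts_ge0 GS).
rewrite [X in `|X|](_ : _ = ('D_k G (gam t) - e^-1 *: (G z2 - G (gam t)))
   - e^-1 *: (G z1 - G z2)); last first.
  by rewrite /GRing.scale/=; ring.
apply: le_trans (ler_normB _ _) _; lra.
Unshelve. all: by end_near. Qed.

End TubeSmooth.
End HolomorphicPairs.

(** * The Cauchy formula for the derivative *)

Section CauchyFormula.
Context {R : realType} {X : normedModType R}.
Notation V := (X * X)%type.

(** The point exp (i t) h. *)
Definition circle (h : V) (t : R) : V := cos t *: h + sin t *: mul_i h.

Lemma norm_cos_le1 (t : R) : `|cos t| <= 1.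
Proof. by rewrite ler_norml cos_geN1 cos_le1. Qed.

Lemma norm_sin_le1 (t : R) : `|sin t| <= 1.
Proof. by rewrite ler_norml sin_geN1 sin_le1. Qed.

Lemma norm_circle_le h t : `|circle h t| <= 2 * `|h|.
Proof.
apply: le_trans (ler_normD _ _) _; rewrite !normrZ norm_mul_i -mulrDl ler_wpM2r//.
by have := norm_cos_le1 t; have := norm_sin_le1 t; lra.
Qed.

Lemma is_derive_circle (z h : V) (rho t : R) :
  is_derive t (1 : R) (fun t => z + rho *: circle h t)
    ((- rho * sin t) *: h + (rho * cos t) *: mul_i h).
Proof.
rewrite -[X in is_derive _ _ _ X]add0r; apply: is_deriveD.
rewrite mulNr -mulrN -!scalerA -scalerDr; apply: is_deriveZ.
apply: is_deriveD.
  exact: is_derive_scale h (is_derive_cos t).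
exact: is_derive_scale (mul_i h) (is_derive_sin t).
Qed.

Lemma circle_continuous d L (G : V -> R) (z h : V) (rho : R) :
  tube_smooth d L G -> (forall t, tube d (z + rho *: circle h t)) ->
  continuous (fun t => G (z + rho *: circle h t)).
Proof.
move=> GS wd t; apply/differentiable_continuous/derivable1_diffP.
by case: (ts_derive_curve GS (wd t) (is_derive_circle z h rho t)).
Qed.

Variables (d L : R) (G1 G2 : V -> R).
Hypothesis GH : holomorphic_pair d L G1 G2.
Variables (z h : V) (rho1 : R).
Hypothesis room : `|z.2| + 2 * rho1 * `|h| < d.

Let GS1 := hp_re GH.
Let GS2 := hp_im GH.
Let L0 : 0 <= L := ts_ge0 GS1.

Let w (rho t : R) : V := z + rho *: circle h t.

Let norm_w (rho t : R) : 0 <= rho -> `|w rho t - z| <= rho * (2 * `|h|).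
Proof.
move=> rho0; rewrite /w addrC addKr normrZ ger0_norm// ler_wpM2l//.
exact: norm_circle_le.
Qed.

Let w_tube (rho t : R) : 0 <= rho -> rho <= rho1 -> tube d (w rho t).
Proof.
move=> rho0 rho01; apply: le_lt_trans room.
have -> : (w rho t).2 = z.2 + (w rho t - z).2 by rewrite [(_ - z).2]/= addrC subrK.
apply: le_trans (ler_normD _ _) _; rewrite lerD2l.
apply: le_trans (norm_snd_le _) _; apply: le_trans (norm_w t rho0) _.
by rewrite mulrCA mulrA ler_wpM2r// ler_wpM2l.
Qed.

Let z_tube : 0 <= rho1 -> tube d z.
Proof.
by move=> rho10; have := w_tube 0 (lexx 0) rho10; rewrite /w scale0r addr0.
Qed.

Let D1 (rho t : R) : R := 'D_h G1 (w rho t).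
Let D2 (rho t : R) : R := 'D_h G2 (w rho t).

Let g1 (rho t : R) : R := G1 (w rho t) - G1 z.
Let g2 (rho t : R) : R := G2 (w rho t) - G2 z.

Let derive_circle v (a b : R) : tube d v ->
  'D_(a *: h + b *: mul_i h) G1 v = a * 'D_h G1 v - b * 'D_h G2 v /\
  'D_(a *: h + b *: mul_i h) G2 v = a * 'D_h G2 v + b * 'D_h G1 v.
Proof.
move=> dv; rewrite (ts_linear GS1)// (ts_linear GS2)// !(ts_linearZ GS1, ts_linearZ GS2)//.
by rewrite (hp_cr_re GH)// (hp_cr_im GH)// mulrN.
Qed.

Let is_derive_w_rho (rho t : R) : is_derive rho (1 : R) (w ^~ t) (circle h t).
Proof.
rewrite -[X in is_derive _ _ _ X]add0r; apply: is_deriveD.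
rewrite -[X in is_derive _ _ _ X]scale1r.
exact: (is_derive_scale (circle h t) (is_derive_id rho (1 : R))).
Qed.

Let is_derive_w_t (rho t : R) : is_derive t (1 : R) (w rho)
  ((- rho * sin t) *: h + (rho * cos t) *: mul_i h).
Proof. exact: is_derive_circle. Qed.

Let dw (rho t : R) : 0 < rho -> rho <= rho1 -> tube d (w rho t).
Proof. by move=> rho0; apply: w_tube; exact: ltW. Qed.

Let g1_rho (rho t : R) : 0 < rho -> rho <= rho1 ->
  is_derive rho (1 : R) (g1 ^~ t) (cos t * D1 rho t - sin t * D2 rho t).
Proof.
move=> rho0 rho01; have dwt := dw t rho0 rho01.
have [<- _] := derive_circle (cos t) (sin t) dwt.
rewrite -[X in is_derive _ _ _ X]subr0; apply: is_deriveB.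
exact: (ts_derive_curve GS1 (gam := w ^~ t)).
Qed.

Let g2_rho (rho t : R) : 0 < rho -> rho <= rho1 ->
  is_derive rho (1 : R) (g2 ^~ t) (cos t * D2 rho t + sin t * D1 rho t).
Proof.
move=> rho0 rho01; have dwt := dw t rho0 rho01.
have [_ <-] := derive_circle (cos t) (sin t) dwt.
rewrite -[X in is_derive _ _ _ X]subr0; apply: is_deriveB.
exact: (ts_derive_curve GS2 (gam := w ^~ t)).
Qed.

Let g1_t (rho t : R) : 0 < rho -> rho <= rho1 -> is_derive t (1 : R) (g1 rho)
  ((- rho * sin t) * D1 rho t - (rho * cos t) * D2 rho t).
Proof.
move=> rho0 rho01; have dwt := dw t rho0 rho01.
have [<- _] := derive_circle (- rho * sin t) (rho * cos t) dwt.
rewrite -[X in is_derive _ _ _ X]subr0; apply: is_deriveB.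
exact: (ts_derive_curve GS1 (gam := w rho)).
Qed.

Let g2_t (rho t : R) : 0 < rho -> rho <= rho1 -> is_derive t (1 : R) (g2 rho)
  ((- rho * sin t) * D2 rho t + (rho * cos t) * D1 rho t).
Proof.
move=> rho0 rho01; have dwt := dw t rho0 rho01.
have [_ <-] := derive_circle (- rho * sin t) (rho * cos t) dwt.
rewrite -[X in is_derive _ _ _ X]subr0; apply: is_deriveB.
exact: (ts_derive_curve GS2 (gam := w rho)).
Qed.

Let norm_g_le (rho t : R) : 0 < rho -> rho <= rho1 ->
  `|g1 rho t| <= L * (rho * (2 * `|h|)) /\ `|g2 rho t| <= L * (rho * (2 * `|h|)).
Proof.
move=> rho0 rho01; have dwt := dw t rho0 rho01.
have dz := z_tube (le_trans (ltW rho0) rho01).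
have := norm_w t (ltW rho0) => wz; split.
  by apply: le_trans (ts_lipschitz GS1 dwt dz) _; rewrite ler_wpM2l.
by apply: le_trans (ts_lipschitz GS2 dwt dz) _; rewrite ler_wpM2l.
Qed.

(** Real and imaginary part of exp (- i t) (G w - G z) / rho. *)
Let p (rho t : R) : R := rho^-1 * (g1 rho t * cos t + g2 rho t * sin t).
Let q (rho t : R) : R := rho^-1 * (g2 rho t * cos t - g1 rho t * sin t).

Let cs t : cos t * cos t + sin t * sin t = 1 :> R.
Proof. by rewrite -!expr2 cos2Dsin2. Qed.

Let p_rho (rho t : R) : 0 < rho -> rho <= rho1 ->
  is_derive rho 1 (p ^~ t) (rho^-1 * (D1 rho t - p rho t)).
Proof.
move=> rho0 rho01; have rn : rho != 0 by rewrite gt_eqF.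
have inv : is_derive rho 1 (fun r : R => r^-1) (- (rho ^- 2)).
  have := @is_deriveV _ id rho 1 1 rn (is_derive_id rho (1 : R)).
  by rewrite /GRing.scale/= mulr1.
have g1r := g1_rho t rho0 rho01; have g2r := g2_rho t rho0 rho01.
have num : is_derive rho 1 (fun r => g1 r t * cos t + g2 r t * sin t) (D1 rho t).
  have e1 := is_deriveM g1r (is_derive_cst (cos t) rho (1 : R)).
  have e2 := is_deriveM g2r (is_derive_cst (sin t) rho (1 : R)).
  apply: (is_derive_eq (is_deriveD e1 e2)).
  rewrite /GRing.scale/= !mulr0 !add0r -[RHS]mulr1 -(cs t); ring.
apply: (is_derive_eq (is_deriveM inv num)); by rewrite /GRing.scale/= /p; field.
Qed.

Let q_t (rho t : R) : 0 < rho -> rho <= rho1 ->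
  is_derive t 1 (q rho) (D1 rho t - p rho t).
Proof.
move=> rho0 rho01; have rn : rho != 0 by rewrite gt_eqF.
have g1t := g1_t t rho0 rho01; have g2t := g2_t t rho0 rho01.
have e1 := is_deriveM g2t (is_derive_cos t).
have e2 := is_deriveM g1t (is_derive_sin t).
apply: (is_derive_eq (is_deriveZ rho^-1 (is_deriveB e1 e2))).
by rewrite /GRing.scale/= /p -[D1 rho t in RHS]mulr1 -(cs t); field.
Qed.

Let p_t_continuous (rho : R) : 0 < rho -> rho <= rho1 -> continuous (p rho).
Proof.
move=> rho0 rho01 t.
have c1 : {for t, continuous (g1 rho)}.
  by apply/differentiable_continuous/derivable1_diffP; case: (g1_t t rho0 rho01).
have c2 : {for t, continuous (g2 rho)}.
  by apply/differentiable_continuous/derivable1_diffP; case: (g2_t t rho0 rho01).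
apply: cvgM; first exact: cvg_cst.
apply: cvgD; apply: cvgM => //; [exact: continuous_cos|exact: continuous_sin].
Qed.

Let q_t_continuous (rho : R) : 0 < rho -> rho <= rho1 -> continuous (q rho).
Proof.
move=> rho0 rho01 t.
by apply/differentiable_continuous/derivable1_diffP; case: (q_t t rho0 rho01).
Qed.

Let p_bound (rho t : R) : 0 < rho -> rho <= rho1 -> `|p rho t| <= 4 * (L * `|h|).
Proof.
move=> rho0 rho01; have [b1 b2] := norm_g_le t rho0 rho01.
rewrite normrM gtr0_norm ?invr_gt0// ler_pdivrMl//.
apply: le_trans (ler_normD _ _) _; rewrite !normrM.
have := ler_pM (normr_ge0 _) (normr_ge0 _) b1 (norm_cos_le1 t).
have := ler_pM (normr_ge0 _) (normr_ge0 _) b2 (norm_sin_le1 t).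
rewrite !mulr1; lra.
Qed.

Let D1_bound (rho t : R) : 0 < rho -> rho <= rho1 -> `|D1 rho t| <= L * `|h|.
Proof. by move=> rho0 rho01; apply: (ts_derive_bound GS1); apply: w_tube => //; exact: ltW. Qed.

Let slope_bound (rho t : R) : 0 < rho -> rho <= rho1 -> `|D1 rho t - p rho t| <= 5 * (L * `|h|).
Proof.
move=> rho0 rho01; apply: le_trans (ler_normB _ _) _.
have := p_bound t rho0 rho01; have := D1_bound t rho0 rho01; lra.
Qed.

Let average_p (rho : R) : R := circle_average (p rho).

Let q_periodic (rho t : R) : q rho (t + pi *+ 2) = q rho t.
Proof. by rewrite /q /g1 /g2 /w /circle cosD2pi sinD2pi. Qed.

(** The radial derivative of p is the angular derivative of q divided by rho,
    whose integral over the circle vanishes. The derivatives are not known to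
    be continuous, so that this is read off the difference quotients. *)
Let average_p_derive (rho : R) : 0 < rho -> rho < rho1 -> is_derive rho 1 average_p 0.
Proof.
move=> rho0 rho01; apply/is_derive_cvgP/cvgr_dnbhsP => e [e_neq0 e0].
pose D n (t : R) : R := (e n)^-1 * (p (rho + e n) t - p rho t)
  - rho^-1 * ((e n)^-1 * (q rho (t + e n) - q rho t)).
have cp := p_t_continuous rho0 (ltW rho01).
have cq := q_t_continuous rho0 (ltW rho01).
have cqe n : continuous (fun t => q rho (t + e n)).
  move=> t; apply: (@continuous_comp _ _ _ (fun t => t + e n) (q rho) t); last exact: cq.
  by apply: cvgD; [exact: cvg_id|exact: cvg_cst].
have e_small : \forall n \near \oo, rho / 2 < rho + e n < rho1.
  have : (fun n => rho + e n) @ \oo --> rho + 0 by apply: cvgD => //; exact: cvg_cst.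
  rewrite addr0 => re; near=> n; apply/andP; split; near: n.
    by apply: cvgr_gt re _ _; lra.
  exact: cvgr_lt re _ rho01.
have D0 t : D ^~ t @ \oo --> (0 : R).
  have /is_derive_cvgP/cvgr_dnbhsP/(_ e (conj e_neq0 e0)) P := p_rho t rho0 (ltW rho01).
  have /is_derive_cvgP/cvgr_dnbhsP/(_ e (conj e_neq0 e0)) Q := q_t t rho0 (ltW rho01).
  rewrite -[X in _ --> X](subrr (rho^-1 * (D1 rho t - p rho t))).
  apply: cvgB.
    rewrite (_ : (fun n => _) = (fun n => (e n)^-1 *: (p (e n *: 1 + rho) t - p rho t)))//.
    by apply/funext => n; rewrite /GRing.scale/= mulr1 [rho + _]addrC.
  apply: cvgM; first exact: cvg_cst.
  rewrite (_ : (fun n => _) = (fun n => (e n)^-1 *: (q rho (e n *: 1 + t) - q rho t)))//.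
  by apply/funext => n; rewrite /GRing.scale/= mulr1 [t + _]addrC.
have K0 : 0 <= L * `|h| by rewrite mulr_ge0.
have Dbound : \forall n \near \oo, continuous (D n) /\
    forall t, `|D n t| <= 2 * rho^-1 * (5 * (L * `|h|)) + rho^-1 * (5 * (L * `|h|)).
  near=> n.
  have /andP[re1 re2] : rho / 2 < rho + e n < rho1 by near: n.
  have re0 : 0 < rho + e n by apply: lt_trans re1; rewrite divr_gt0.
  split=> [t|t].
    apply: cvgB; apply: cvgM; try exact: cvg_cst.
      by apply: cvgB; [exact: p_t_continuous re0 (ltW re2) t|exact: cp].
    by apply: cvgM; [exact: cvg_cst|apply: cvgB; [exact: cqe|exact: cq]].
  apply: le_trans (ler_normB _ _) _; apply: lerD.
    rewrite normrM normfV ler_pdivrMl ?normr_gt0// mulrC.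
    have := @bounded_derive_lipschitz _ (p ^~ t)
      (fun r => r^-1 * (D1 r t - p r t)) (rho / 2) rho1 (2 * rho^-1 * (5 * (L * `|h|))) _ _
      (rho + e n) rho.
    rewrite [rho + e n - rho]addrAC subrr add0r; apply.
    + move=> r /andP[r1 r2]; apply: p_rho (ltW r2); apply: lt_trans r1.
      by rewrite divr_gt0.
    + move=> r /andP[r1 r2].
      have r0 : 0 < r by apply: lt_trans r1; rewrite divr_gt0.
      rewrite normrM ler_pM//; last exact: slope_bound r0 (ltW r2).
      rewrite gtr0_norm ?invr_gt0//.
      have -> : 2 * rho^-1 = (rho / 2)^-1 by rewrite invfM invrK mulrC.
      by rewrite lef_pV2 ?posrE ?divr_gt0// ltW.
    + by rewrite re1.
    + by rewrite rho01 andbT ltr_pdivrMr// ltr_pMr// ltr1n.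
  rewrite normrM gtr0_norm ?invr_gt0// ler_wpM2l ?invr_ge0 ?(ltW rho0)//.
  rewrite normrM normfV ler_pdivrMl ?normr_gt0// mulrC.
  have := @bounded_derive_lipschitz _ (q rho) (fun t => D1 rho t - p rho t)
    (t - `|e n| - 1) (t + `|e n| + 1) (5 * (L * `|h|)) _ _ (t + e n) t.
  rewrite [t + e n - t]addrAC subrr add0r; apply.
  + by move=> s _; exact: q_t rho0 (ltW rho01).
  + by move=> s _; exact: slope_bound rho0 (ltW rho01).
  + have := ler_norm (e n); have := lerNnormlW (lexx `|e n|) => a b.
    by apply/andP; split; lra.
  + by have := normr_ge0 (e n) => a; apply/andP; split; lra.
have [_] := circle_dominated_convergence Dbound D0.
rewrite circle_average_cst; apply: cvg_trans; apply: near_eq_cvg.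
near=> n.
have /andP[re1 re2] : rho / 2 < rho + e n < rho1 by near: n.
have re0 : 0 < rho + e n by apply: lt_trans re1; rewrite divr_gt0.
have ip := continuous_circle_integrable cp.
have ipe := continuous_circle_integrable (p_t_continuous re0 (ltW re2)).
have iq := continuous_circle_integrable cq.
have iqe := continuous_circle_integrable (cqe n).
rewrite (eq_circle_average (v := fun t => ((e n)^-1 * p (rho + e n) t
   + (- (e n)^-1) * p rho t) + ((- (rho^-1 * (e n)^-1)) * q rho (t + e n) +
      (rho^-1 * (e n)^-1) * q rho t))); last by move=> t; rewrite /D; ring.
rewrite !circle_averageD; do ?exact: circle_integrableD; do ?exact: circle_integrableZ.
  rewrite (circle_averageZ _ ipe) (circle_averageZ _ ip).
  rewrite (circle_averageZ _ iqe) (circle_averageZ _ iq).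
  rewrite (circle_average_shift (e n) cq (q_periodic rho)).
  rewrite /GRing.scale/= mulr1 [e n + rho]addrC /average_p; ring.
all: apply: circle_integrableD; exact: circle_integrableZ.
Unshelve. all: by end_near. Qed.

(** The average of p does not depend on the radius, and tends to the derivative as
    the radius goes to 0. *)
Lemma cauchy_formula_aux (kap : R) : 0 < kap -> kap < rho1 ->
  'D_h G1 z = average_p kap.
Proof.
move=> kap0 kap1.
have cst_p rho : 0 < rho -> rho <= kap -> average_p rho = average_p kap.
  move=> rho0; rewrite le_eqVlt => /predU1P[->//|rk].
  have [||x _ /eqP] := @MVT _ average_p (fun=> 0) rho kap rk.
  - move=> x; rewrite in_itv/= => /andP[rx xk].
    by apply: average_p_derive; [exact: lt_trans rx|exact: lt_trans kap1].
  - apply: continuous_in_subspaceT => x; rewrite inE/= in_itv/= => /andP[rx xk].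
    apply/differentiable_continuous/derivable1_diffP.
    by case: (@average_p_derive x (lt_le_trans rho0 rx) (le_lt_trans xk kap1)).
  by rewrite mul0r subr_eq0 => /eqP.
pose r n : R := kap * harmonic n.
have r0 n : 0 < r n by rewrite mulr_gt0// invr_gt0.
have rk n : r n <= kap by rewrite ger_pMr// invf_le1// ler1n.
have r_cvg : r @ \oo --> (0 : R).
  rewrite -(mulr0 kap); apply: cvgM; [exact: cvg_cst|exact: cvg_harmonic].
have rne n : r n != 0 by rewrite gt_eqF.
have dz : tube d z by apply: z_tube; exact: ltW (lt_trans kap0 kap1).
have pcvg t : (fun n => p (r n) t) @ \oo --> 'D_h G1 z.
  have /is_derive_cvgP/cvgr_dnbhsP/(_ r (conj rne r_cvg)) P := ts_is_derive GS1 (circle h t) dz.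
  have /is_derive_cvgP/cvgr_dnbhsP/(_ r (conj rne r_cvg)) Q := ts_is_derive GS2 (circle h t) dz.
  have [E1 E2] := derive_circle (cos t) (sin t) dz.
  rewrite -[circle h t]/(cos t *: h + sin t *: mul_i h) E1 in P.
  rewrite -[circle h t]/(cos t *: h + sin t *: mul_i h) E2 in Q.
  have -> : 'D_h G1 z = (cos t * 'D_h G1 z - sin t * 'D_h G2 z) * cos t +
      (cos t * 'D_h G2 z + sin t * 'D_h G1 z) * sin t.
    by rewrite -[LHS]mulr1 -(cs t); ring.
  rewrite (_ : (fun n => p (r n) t) = fun n =>
      ((r n)^-1 *: (G1 (r n *: circle h t + z) - G1 z)) * cos t +
      ((r n)^-1 *: (G2 (r n *: circle h t + z) - G2 z)) * sin t).
    by apply: cvgD; apply: cvgM => //; exact: cvg_cst.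
  apply/funext => n.
  by rewrite /p /g1 /g2 /w /GRing.scale/= [z + _]addrC; ring.
have near_p : \forall n \near \oo, continuous (p (r n)) /\
    forall t, `|p (r n) t| <= 4 * (L * `|h|).
  apply: nearW => n; have rn1 := le_trans (rk n) (ltW kap1); split.
    exact: p_t_continuous.
  by move=> t; exact: p_bound.
have [_] := circle_dominated_convergence near_p pcvg.
rewrite circle_average_cst; set u := (u in u @ \oo --> _) => uh.
have uE : u = fun=> average_p kap by apply/funext => n; exact: cst_p.
rewrite uE in uh.
by apply: (@cvg_unique _ (@norm_hausdorff _ R^o) _ _ _ _ uh); exact: cvg_cst.
Qed.

End CauchyFormula.

Section DerivativePair.
Context {R : realType} {X : normedModType R}.
Notation V := (X * X)%type.
Implicit Types (z w h k : V) (G : V -> R).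

(** The integrand is the real part of exp (- i t) (G (z + kap exp (i t) h) - G z) / kap,
    where G = G1 + i G2. *)
Lemma cauchy_formula d L G1 G2 z h (kap : R) :
  holomorphic_pair d L G1 G2 -> 0 < kap -> `|z.2| + 2 * kap * `|h| < d ->
  'D_h G1 z = circle_average (fun t =>
    kap^-1 * ((G1 (z + kap *: circle h t) - G1 z) * cos t
            + (G2 (z + kap *: circle h t) - G2 z) * sin t)).
Proof.
move=> GH kap0 room; pose sl := d - (`|z.2| + 2 * kap * `|h|).
have sl0 : 0 < sl by rewrite subr_gt0.
have h0 := normr_ge0 h.
have h1 : 0 < 4 * (`|h| + 1) by lra.
apply: (@cauchy_formula_aux _ _ d L G1 G2 GH z h (kap + sl / (4 * (`|h| + 1)))) => //.
  have : 2 * (sl / (4 * (`|h| + 1))) * `|h| <= sl / 2.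
    rewrite mulrAC mulrA ler_pdivrMr//; nra.
  by rewrite /sl in sl0 *; lra.
by rewrite ltrDl divr_gt0.
Qed.

(** The parts of - i G: what holds for G1 thus holds for G2. *)
Lemma holomorphic_pair_rot d L G1 G2 : holomorphic_pair d L G1 G2 ->
  holomorphic_pair d L G2 (fun z => - G1 z).
Proof.
move=> [S1 S2 CR1 CR2].
have derN z k : tube d z -> 'D_k (fun z => - G1 z) z = - 'D_k G1 z.
  by move=> dz; rewrite -deriveN//; exact: ts_derivable S1 _ _ dz.
split=> //.
- split.
  + exact: ts_ge0 S1.
  + by move=> z w dz dw; rewrite -opprD normrN; exact: ts_lipschitz S1 _ _ dz dw.
  + by move=> z k dz; apply: derivableN; exact: ts_derivable S1 _ _ dz.
  + by move=> z a h k dz; rewrite !derN// (ts_linear S1)// opprD mulrN.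
- by move=> z k dz; rewrite derN// opprK CR2.
- by move=> z k dz; rewrite derN// CR1// opprK.
Qed.

Section Derivative.
Variables (d s L kap : R) (h : V).
Hypotheses (kap0 : 0 < kap) (hs : 2 * kap * `|h| < s).

Lemma circle_tube z t : tube (d - s) z -> tube d (z + kap *: circle h t).
Proof.
rewrite /tube/= => zd; apply: le_lt_trans (_ : `|z.2| + s < d); last lra.
apply: le_trans (ler_normD _ _) _; rewrite lerD2l.
apply: le_trans (norm_snd_le (kap *: circle h t)) _; rewrite normrZ gtr0_norm//.
apply: le_trans (ltW hs); rewrite [2 * _]mulrC -mulrA ler_wpM2l ?(ltW kap0)//.
exact: norm_circle_le.
Qed.

Lemma shrink_tube z : tube (d - s) z -> tube d z.
Proof.
have s0 : 0 < s by apply: le_lt_trans hs; rewrite !mulr_ge0// ltW.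
by rewrite /tube/=; lra.
Qed.

Let I G1 G2 k z (t : R) : R :=
  kap^-1 * (('D_k G1 (z + kap *: circle h t) - 'D_k G1 z) * cos t
          + ('D_k G2 (z + kap *: circle h t) - 'D_k G2 z) * sin t).

Let derivative_lipschitz G1 G2 : holomorphic_pair d L G1 G2 ->
  forall z w, tube (d - s) z -> tube (d - s) w ->
  `|'D_h G1 z - 'D_h G1 w| <= 4 * L / kap * `|z - w|.
Proof.
move=> GH z w zd wd.
have [S1 S2 _ _] := GH.
have formula v : tube (d - s) v -> 'D_h G1 v = circle_average (fun t =>
    kap^-1 * ((G1 (v + kap *: circle h t) - G1 v) * cos t
            + (G2 (v + kap *: circle h t) - G2 v) * sin t)).
  by move=> vd; apply: (cauchy_formula GH) => //; move: vd hs; rewrite /tube/=; lra.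
have cont v : tube (d - s) v -> continuous (fun t =>
    kap^-1 * ((G1 (v + kap *: circle h t) - G1 v) * cos t
            + (G2 (v + kap *: circle h t) - G2 v) * sin t)).
  move=> vd t; apply: cvgM; first exact: cvg_cst.
  apply: cvgD; apply: cvgM; try (apply: cvgB; last exact: cvg_cst).
  - by apply: (circle_continuous S1) => ?; exact: circle_tube.
  - exact: continuous_cos.
  - by apply: (circle_continuous S2) => ?; exact: circle_tube.
  - exact: continuous_sin.
have iz := continuous_circle_integrable (cont z zd).
have iw := continuous_circle_integrable (cont w wd).
rewrite (formula z zd) (formula w wd) -[X in _ - X]mul1r -mulNr.
rewrite -(circle_averageZ _ iw) -(circle_averageD iz (circle_integrableZ _ iw)).
apply: circle_average_bound.
  exact: circle_integrableD iz (circle_integrableZ _ iw).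
move=> t; rewrite mulN1r -mulrBr normrM gtr0_norm ?invr_gt0//.
rewrite [4 * L / kap]mulrC -!mulrA ler_wpM2l ?invr_ge0 ?(ltW kap0)//.
have L0 := ts_ge0 S1.
have zw v : (z + v) - (w + v) = z - w by rewrite opprD addrACA subrr addr0.
have d1 := ts_lipschitz S1 (circle_tube t zd) (circle_tube t wd).
have d2 := ts_lipschitz S2 (circle_tube t zd) (circle_tube t wd).
have d3 := ts_lipschitz S1 (shrink_tube zd) (shrink_tube wd).
have d4 := ts_lipschitz S2 (shrink_tube zd) (shrink_tube wd).
rewrite zw in d1; rewrite zw in d2.
set Lzw := L * `|z - w| in d1 d2 d3 d4 *.
have bd (a b c e u : R) : `|a - b| <= Lzw -> `|c - e| <= Lzw -> `|u| <= 1 ->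
    `|(a - c) * u - (b - e) * u| <= 2 * Lzw.
  move=> ab ce u1; rewrite -mulrBl normrM.
  apply: (@le_trans _ _ (`|(a - c) - (b - e)|)); first by rewrite ler_piMr.
  have -> : (a - c) - (b - e) = (a - b) - (c - e) by ring.
  by apply: le_trans (ler_normB _ _) _; lra.
rewrite opprD addrACA; apply: le_trans (ler_normD _ _) _.
have := bd _ _ _ _ _ d1 d3 (norm_cos_le1 t).
have := bd _ _ _ _ _ d2 d4 (norm_sin_le1 t).
by lra.
Qed.

(** Differentiation of the Cauchy formula under the integral sign, by dominated
    convergence of the difference quotients. *)
Let derivative_derive G1 G2 : holomorphic_pair d L G1 G2 ->
  forall z k, tube (d - s) z ->
  circle_integrable (I G1 G2 k z) /\
  is_derive z k (fun z => 'D_h G1 z) (circle_average (I G1 G2 k z)).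
Proof.
move=> GH z k zd; have [S1 S2 _ _] := GH; have L0 := ts_ge0 S1.
have formula v : tube (d - s) v -> 'D_h G1 v = circle_average (fun t =>
    kap^-1 * ((G1 (v + kap *: circle h t) - G1 v) * cos t
            + (G2 (v + kap *: circle h t) - G2 v) * sin t)).
  by move=> vd; apply: (cauchy_formula GH) => //; move: vd hs; rewrite /tube/=; lra.
have cont v : tube (d - s) v -> continuous (fun t =>
    kap^-1 * ((G1 (v + kap *: circle h t) - G1 v) * cos t
            + (G2 (v + kap *: circle h t) - G2 v) * sin t)).
  move=> vd t; apply: cvgM; first exact: cvg_cst.
  apply: cvgD; apply: cvgM; try (apply: cvgB; last exact: cvg_cst).
  - by apply: (circle_continuous S1) => ?; exact: circle_tube.
  - exact: continuous_cos.
  - by apply: (circle_continuous S2) => ?; exact: circle_tube.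
  - exact: continuous_sin.
have iz := continuous_circle_integrable (cont z zd).
pose N v t := kap^-1 * ((G1 (v + kap *: circle h t) - G1 v) * cos t
            + (G2 (v + kap *: circle h t) - G2 v) * sin t).
have quot (e : nat -> R) : (forall n, e n != 0) -> e @ \oo --> (0 : R) ->
  circle_integrable (I G1 G2 k z) /\
  (fun n => (e n)^-1 *: ('D_h G1 (e n *: k + z) - 'D_h G1 z)) @ \oo
    --> circle_average (I G1 G2 k z).
  move=> en0 ecvg.
  have ezd : \forall n \near \oo, tube (d - s) (e n *: k + z).
    have ez : (fun n => e n *: k + z) @ \oo --> 0 *: k + z.
      by apply: cvgD; [exact: cvgZr_tmp|exact: cvg_cst].
    by rewrite scale0r add0r in ez; exact: (ez _ (tube_near zd)).
  pose D n t := (e n)^-1 * (N (e n *: k + z) t - N z t).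
  have DE n t : D n t = kap^-1 * (
     ((e n)^-1 *: (G1 (e n *: k + (z + kap *: circle h t)) - G1 (z + kap *: circle h t))
       - (e n)^-1 *: (G1 (e n *: k + z) - G1 z)) * cos t
   + ((e n)^-1 *: (G2 (e n *: k + (z + kap *: circle h t)) - G2 (z + kap *: circle h t))
       - (e n)^-1 *: (G2 (e n *: k + z) - G2 z)) * sin t).
    by rewrite /D /N -!addrA /GRing.scale/=; ring.
  have Dcvg t : D ^~ t @ \oo --> I G1 G2 k z t.
    have quotient G v : tube_smooth d L G -> tube d v ->
        (fun n => (e n)^-1 *: (G (e n *: k + v) - G v)) @ \oo --> 'D_k G v.
      by move=> GS vd; have /is_derive_cvgP/cvgr_dnbhsP := ts_is_derive GS k vd; apply.
    under eq_fun do rewrite DE.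
    apply: cvgM; first exact: cvg_cst.
    by apply: cvgD; apply: cvgM; try exact: cvg_cst;
      apply: cvgB; apply: quotient => //; (exact: circle_tube || exact: shrink_tube).
  have Dbound : \forall n \near \oo, continuous (D n) /\
      forall t, `|D n t| <= kap^-1 * (4 * (L * `|k|)).
    near=> n; have ezn : tube (d - s) (e n *: k + z) by near: n.
    split=> t.
      apply: cvgM; first exact: cvg_cst.
      by apply: cvgB; exact: cont.
    rewrite DE normrM gtr0_norm ?invr_gt0// ler_wpM2l ?invr_ge0 ?(ltW kap0)//.
    have quotient G v : tube_smooth d L G -> tube d v -> tube d (e n *: k + v) ->
        `|(e n)^-1 *: (G (e n *: k + v) - G v)| <= L * `|k|.
      move=> GS vd evd; rewrite normrZ normfV ler_pdivrMl ?normr_gt0// mulrCA.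
      by apply: le_trans (ts_lipschitz GS evd vd) _; rewrite addrK normrZ.
    have ezn' : tube d (e n *: k + (z + kap *: circle h t)).
      by rewrite addrA; exact: circle_tube.
    have q1 := quotient G1 _ S1 (circle_tube t zd) ezn'.
    have q2 := quotient G1 _ S1 (shrink_tube zd) (shrink_tube ezn).
    have q3 := quotient G2 _ S2 (circle_tube t zd) ezn'.
    have q4 := quotient G2 _ S2 (shrink_tube zd) (shrink_tube ezn).
    have bd (a b u : R) : `|a| <= L * `|k| -> `|b| <= L * `|k| -> `|u| <= 1 ->
        `|(a - b) * u| <= 2 * (L * `|k|).
      move=> ak bk u1; rewrite normrM.
      apply: (@le_trans _ _ `|a - b|); first by rewrite ler_piMr.
      by apply: le_trans (ler_normB _ _) _; lra.
    apply: le_trans (ler_normD _ _) _.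
    have := bd _ _ _ q1 q2 (norm_cos_le1 t).
    have := bd _ _ _ q3 q4 (norm_sin_le1 t).
    by lra.
  have [iI avg] := circle_dominated_convergence Dbound Dcvg.
  split=> //; apply: cvg_trans avg; apply: near_eq_cvg; near=> n.
  have ezn : tube (d - s) (e n *: k + z) by near: n.
  have ie := continuous_circle_integrable (cont _ ezn).
  rewrite (formula z zd) (formula _ ezn) -/(N _) -/(N _).
  rewrite (eq_circle_average (v := fun t => (e n)^-1 * N (e n *: k + z) t +
     (- (e n)^-1) * N z t)); last by move=> t; rewrite /D; ring.
  rewrite circle_averageD; do ?exact: circle_integrableZ.
  by rewrite (circle_averageZ _ ie) (circle_averageZ _ iz) /GRing.scale/=; ring.
have hn n : harmonic n != 0 :> R by rewrite gt_eqF// invr_gt0.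
split; first by case: (quot _ hn (@cvg_harmonic R)).
apply/is_derive_cvgP/cvgr_dnbhsP => e [en0 ecvg].
by case: (quot e en0 ecvg).
Unshelve. all: by end_near. Qed.

Let derivative_smooth G1 G2 : holomorphic_pair d L G1 G2 ->
  tube_smooth (d - s) (4 * L / kap) (fun z => 'D_h G1 z).
Proof.
move=> GH; have [S1 S2 _ _] := GH; split.
- by rewrite divr_ge0 ?mulr_ge0 ?(ltW kap0)//; exact: ts_ge0 S1.
- exact: derivative_lipschitz GH.
- by move=> z k zd; have [_ []] := derivative_derive GH k zd.
- move=> z a u k zd.
  have [iu [_ ->]] := derivative_derive GH u zd.
  have [ik [_ ->]] := derivative_derive GH k zd.
  have [_ [_ ->]] := derivative_derive GH (a *: u + k) zd.
  rewrite -(circle_averageZ _ iu) -(circle_averageD (circle_integrableZ a iu) ik).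
  apply: eq_circle_average => t; rewrite /I.
  have zd' := shrink_tube zd; have wd' := circle_tube t zd.
  by rewrite !(ts_linear S1)// !(ts_linear S2)//; ring.
Qed.

(** The Cauchy formula expresses the derivative by values of the functions on a
    circle, so that it is as regular as they are, on a smaller tube. *)
Theorem derivative_holomorphic_pair G1 G2 : holomorphic_pair d L G1 G2 ->
  holomorphic_pair (d - s) (4 * L / kap) (fun z => 'D_h G1 z) (fun z => 'D_h G2 z).
Proof.
move=> GH; have GH' := holomorphic_pair_rot GH.
have [S1 S2 CR1 CR2] := GH; have [_ S1' _ _] := GH'.
have derN z k : tube d z -> 'D_k (fun z => - G1 z) z = - 'D_k G1 z.
  by move=> dz; rewrite -deriveN//; exact: ts_derivable S1 _ _ dz.
split=> [||z k zd|z k zd]; [exact: derivative_smooth GH|exact: derivative_smooth GH'| |].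
  have [_ [_ ->]] := derivative_derive GH (mul_i k) zd.
  have [i2 [_ ->]] := derivative_derive GH' k zd.
  rewrite -mulN1r -(circle_averageZ _ i2); apply: eq_circle_average => t; rewrite /I.
  have zd' := shrink_tube zd; have wd' := circle_tube t zd.
  by rewrite !CR1// !CR2// !derN//; ring.
have [_ [_ ->]] := derivative_derive GH k zd.
have [_ [_ ->]] := derivative_derive GH' (mul_i k) zd.
apply: eq_circle_average => t; rewrite /I.
have zd' := shrink_tube zd; have wd' := circle_tube t zd.
by rewrite !derN// !CR1// !CR2//; ring.
Qed.

End Derivative.
End DerivativePair.

(** * Taylor expansion of holomorphic functions *)

Section Taylor.
Context {R : realType}.

Lemma is_derive_taylor_weight (n : nat) (t : R) :
  is_derive t 1 (fun s : R => (1 - s) ^+ n.+1 / (n.+1)`!%:R)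
    (- ((1 - t) ^+ n / n`!%:R)).
Proof.
have d1 : is_derive t 1 (fun s : R => 1 - s) (-1).
  have := is_deriveB (is_derive_cst (1 : R) t 1) (is_derive_id t (1 : R)).
  by rewrite sub0r.
have d2 := is_deriveX n.+1 d1.
have d3 := is_deriveM d2 (is_derive_cst ((n.+1)`!%:R^-1 : R) t 1).
rewrite [X in is_derive _ _ X _](_ : _ = ((fun s : R => 1 - s) ^+ n.+1 *
  cst ((n.+1)`!%:R^-1))); last first.
  by apply/funext => s; rewrite /GRing.mul/= fctE.
apply: is_derive_eq d3 _.
rewrite scaler0 add0r factS natrM invfM /GRing.scale/= /cst.
have n0 : n.+1%:R != 0 :> R by rewrite pnatr_eq0.
by rewrite mulrN1 mulrN mulrACA mulVf// mul1r mulrC.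
Qed.

(** The derivatives of consecutive terms cancel. *)
Lemma is_derive_taylor_sum (psi : nat -> R -> R) (n : nat) (t : R) :
  (forall k (s : R), is_derive s 1 (psi k) (psi k.+1 s)) ->
  is_derive t 1 (fun s : R => \sum_(0 <= j < n.+1) psi j s * ((1 - s) ^+ j / j`!%:R))
    (psi n.+1 t * ((1 - t) ^+ n / n`!%:R)).
Proof.
move=> psi'; elim: n => [|n IH].
  rewrite expr0 fact0 divr1 mulr1.
  rewrite [X in is_derive _ _ X _](_ : _ = psi 0%N)//.
  by apply/funext => s; rewrite big_nat1 expr0 fact0 divr1 mulr1.
have d1 := is_deriveM (psi' n.+1 t) (is_derive_taylor_weight n t).
have d2 := is_deriveD IH d1.
rewrite [X in is_derive _ _ X _](_ : _ =
  (fun s : R => \sum_(0 <= j < n.+1) psi j s * ((1 - s) ^+ j / j`!%:R)) +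
  psi n.+1 * (fun s : R => (1 - s) ^+ n.+1 / (n.+1)`!%:R)); last first.
  by apply/funext => s; rewrite big_nat_recr.
by apply: is_derive_eq d2 _; rewrite /GRing.scale/=; ring.
Qed.

(** Taylor's formula with the remainder of Cauchy, from the mean value theorem
    applied to the Taylor polynomials at a moving point. *)
Lemma taylor_remainder (psi : nat -> R -> R) (n : nat) (M : R) :
  (forall k (s : R), is_derive s 1 (psi k) (psi k.+1 s)) ->
  (forall s, `|psi n.+1 s| <= M) ->
  `|psi 0%N 1 - \sum_(0 <= j < n.+1) psi j 0 / j`!%:R| <= M / n`!%:R.
Proof.
move=> psi' psiM.
have [c [/andP[c0 c1]]] := mean_value (fun t => is_derive_taylor_sum n t psi')
  (ltr01 : (0 : R) < 1).
rewrite subr0 mulr1 subrr.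
rewrite big_nat_recl// expr0 fact0 divr1 mulr1 big1 ?addr0; last first.
  by move=> j _; rewrite exprS mul0r mul0r mulr0.
under eq_bigr do rewrite expr1n mul1r.
move=> ->; rewrite normrM; apply: ler_pM => //.
rewrite normrM normfV normr_nat ler_piMl ?invr_ge0//.
by rewrite ger0_norm ?exprn_ge0 ?exprn_ile1; lra.
Qed.

End Taylor.

Section IteratedDerivatives.
Context {R : realType} {X : normedModType R}.
Notation V := (X * X)%type.

Fixpoint iter_derive (hs : seq V) (G : V -> R) : V -> R :=
  if hs is h :: hs' then fun z => 'D_h (iter_derive hs' G) z else G.

Lemma holomorphic_pair0 d : holomorphic_pair d 0 (fun=> 0 : R) (fun _ : V => 0 : R).
Proof.
have S : tube_smooth d 0 (fun _ : V => 0 : R).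
  split=> //.
  - by move=> z w _ _; rewrite subrr normr0 mul0r.
  - by move=> z a h k _; rewrite !derive_cst mulr0 addr0.
by split=> // z k _; rewrite !derive_cst ?oppr0.
Qed.

Variables (d L : R) (G1 G2 : V -> R).
Hypothesis GH : holomorphic_pair d L G1 G2.

(** Each derivative uses up s of the width of the tube and, by the Cauchy formula
    on circles of radius s / (4 |h|), multiplies the constant by 16 |h| / s. *)
Lemma iter_derive_holomorphic_pair s hs : 0 < s ->
  holomorphic_pair (d - (size hs)%:R * s) (L * \prod_(h <- hs) (16 * `|h| / s))
    (iter_derive hs G1) (iter_derive hs G2).
Proof.
move=> s0; elim: hs => [|h hs IH] /=.
  by rewrite big_nil mul0r subr0 mulr1.
have [->|h0] := eqVneq h 0.
  rewrite big_cons normr0 mulr0 !mul0r mulr0.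
  rewrite (_ : (fun z => _) = fun=> 0); last by apply/funext => z; rewrite derive0.
  rewrite (_ : (fun z => 'D_0 _ z) = fun=> 0); last by apply/funext => z; rewrite derive0.
  exact: holomorphic_pair0.
have hn : 0 < `|h| by rewrite normr_gt0.
have kap0 : 0 < s / (4 * `|h|) by rewrite divr_gt0// mulr_gt0.
have room : 2 * (s / (4 * `|h|)) * `|h| < s.
  by rewrite [ltLHS](_ : _ = s / 2); [lra|field; rewrite gt_eqF].
have := derivative_holomorphic_pair kap0 room IH.
rewrite [X in holomorphic_pair X](_ : _ = d - (size hs).+1%:R * s); last first.
  by rewrite -natr1; ring.
rewrite [X in holomorphic_pair _ X](_ : _ = L * \prod_(h <- h :: hs) (16 * `|h| / s))//.
by rewrite big_cons; field; rewrite !gt_eqF.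
Qed.

Hypothesis d0 : 0 < d.

Let iter_smooth hs : tube_smooth (d / 2)
  (L * \prod_(h <- hs) (16 * `|h| / (d / (2 * (size hs).+1%:R)))) (iter_derive hs G1).
Proof.
have n0 : 0 < (size hs).+1%:R :> R by rewrite ltr0n.
have s0 : 0 < d / (2 * (size hs).+1%:R) by rewrite divr_gt0// mulr_gt0.
have [[S1 S2 S3 S4] _ _ _] := iter_derive_holomorphic_pair hs s0.
have sub z : tube (d / 2) z -> tube (d - (size hs)%:R * (d / (2 * (size hs).+1%:R))) z.
  rewrite /tube/= => zd; apply: lt_le_trans zd _.
  have -> : (size hs)%:R * (d / (2 * (size hs).+1%:R)) = (d / 2) * ((size hs)%:R / (size hs).+1%:R).
    by field; rewrite gt_eqF.
  have : (size hs)%:R / (size hs).+1%:R <= 1 :> R by rewrite ler_pdivrMr// mul1r ler_nat.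
  by move: d0; set q := _ / _; nra.
split=> //.
- by move=> z w /sub zd /sub; exact: S2.
- by move=> z k /sub; exact: S3.
- by move=> z a h k /sub; exact: S4.
Qed.

Lemma iter_derive_linear hs1 hs2 h k (a : R) z : tube (d / 2) z ->
  iter_derive (hs1 ++ (a *: h + k) :: hs2) G1 z =
  a * iter_derive (hs1 ++ h :: hs2) G1 z + iter_derive (hs1 ++ k :: hs2) G1 z.
Proof.
elim: hs1 z => [|l hs1 IH] z zd /=; first by exact: (ts_linear (iter_smooth hs2) a h k zd).
rewrite (@near_eq_derive _ _ _ _ (fun z => a * iter_derive (hs1 ++ h :: hs2) G1 z +
  iter_derive (hs1 ++ k :: hs2) G1 z)); last first.
  by near=> w; apply: IH; near: w; exact: tube_near.
have i1 := ts_is_derive (iter_smooth (hs1 ++ h :: hs2)) l zd.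
have i2 := ts_is_derive (iter_smooth (hs1 ++ k :: hs2)) l zd.
have i3 := is_deriveD (is_deriveZ a i1) i2.
exact: derive_val.
Unshelve. all: by end_near. Qed.

Definition taylor_constant := 32 * expR 1 / d : R.

Lemma taylor_constant_gt0 : 0 < taylor_constant.
Proof. by rewrite divr_gt0// mulr_gt0// expR_gt0. Qed.

(** Spending the margin d / 2 evenly on the derivatives costs n ^ n, which is
    at most exp(n) n!. *)
Lemma iter_derive_bound hs z : tube (d / 2) z -> (0 < size hs)%N ->
  `|iter_derive hs G1 z| <=
    (size hs)`!%:R * (L * d / 32 * taylor_constant ^+ size hs * \prod_(h <- hs) `|h|).
Proof.
case: hs => // h hs zd _ /=.
apply: le_trans (ts_derive_bound (iter_smooth hs) h zd) _.
have L0 := ts_ge0 (hp_re GH).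
set n := size hs; have n0 : 0 < n.+1%:R :> R by rewrite ltr0n.
have prodE (m : R) (l : seq V) : 0 < m -> \prod_(k <- l) (16 * `|k| / (d / (2 * m))) =
    (32 / d * m) ^+ size l * \prod_(k <- l) `|k|.
  move=> m0; elim: l => [|k l IH]; first by rewrite !big_nil mulr1.
  by rewrite !big_cons IH/= exprS; field; rewrite !gt_eqF.
rewrite prodE// -/n.
have key : (32 / d * n.+1%:R) ^+ n <= (n.+1)`!%:R * (d / 32 * taylor_constant ^+ n.+1).
  rewrite /taylor_constant [32 * _ / d]mulrAC exprMn [X in _ <= _ * (_ * X)]exprMn.
  rewrite [leRHS](_ : _ = (32 / d) ^+ n * ((n.+1)`!%:R * expR 1 ^+ n.+1)); last first.
    have -> : (32 / d) ^+ n.+1 = 32 / d * (32 / d) ^+ n by rewrite exprS.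
    move: (_ ^+ n) (_`!%:R) (_ ^+ n.+1) => p q r.
    by field; rewrite gt_eqF.
  have c0 : 0 <= 32 / d by rewrite divr_ge0// ltW.
  rewrite ler_wpM2l ?exprn_ge0// -expRM_natl mulr1.
  have := expR_ge1Dxn n (ltW n0).
  have f0 : 0 < (n.+1)`!%:R :> R by rewrite ltr0n fact_gt0.
  move=> e1; rewrite -ler_pdivrMl// mulrC.
  apply: (@le_trans _ _ (n.+1%:R ^+ n.+1 / (n.+1)`!%:R)); last lra.
  by rewrite ler_wpM2r ?invr_ge0 ?(ltW f0)// ler_weXn2l// ler1n.
rewrite big_cons; have p0 : 0 <= \prod_(h <- hs) `|h| by rewrite prodr_ge0.
rewrite [leLHS](_ : _ = (32 / d * n.+1%:R) ^+ n * (L * (`|h| * \prod_(h <- hs) `|h|))); last by ring.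
rewrite [leRHS](_ : _ = (n.+1)`!%:R * (d / 32 * taylor_constant ^+ n.+1) *
  (L * (`|h| * \prod_(h <- hs) `|h|))); last by ring.
by rewrite ler_wpM2r// mulr_ge0// mulr_ge0.
Qed.

Let real_tube (x : X) : tube (d / 2) (x, 0).
Proof. by rewrite /tube/= normr0 divr_gt0. Qed.

Let taylor_form x n (u : 'I_n -> X) : R :=
  n`!%:R^-1 * iter_derive [seq ((u i, 0) : V) | i <- enum 'I_n] G1 (x, 0).

Let taylor_form_multilinear x n : (0 < n)%N ->
  bounded_multilinear (@taylor_form x n) (L * d / 32 * taylor_constant ^+ n).
Proof.
move=> n0; split=> [u i a v w /=|u]; last first.
  have f0 : 0 < n`!%:R :> R by rewrite ltr0n fact_gt0.
  rewrite normrM ger0_norm ?invr_ge0 ?(ltW f0)// ler_pdivrMl//.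
  have := @iter_derive_bound [seq ((u i, 0) : V) | i <- enum 'I_n] _ (real_tube x).
  rewrite size_map size_enum_ord => /(_ n0) B; apply: le_trans B _.
  rewrite le_eqVlt big_map big_enum/=; apply/orP; left; apply/eqP.
  congr (_ * (_ * _)); apply: eq_bigr => i _.
  by rewrite prod_normE/= normr0 max_l.
have iE : i \in enum 'I_n by rewrite mem_enum.
have := enum_uniq 'I_n; rewrite /taylor_form.
case/splitPr: iE => s1 s2; rewrite cat_uniq/= => /and3P[_ + /andP[is2 _]].
rewrite negb_or => /andP[is1 _].
have mapE y : [seq ((dfwith u i y j, 0) : V) | j <- s1 ++ i :: s2] =
    [seq (u j, 0) | j <- s1] ++ (y, 0) :: [seq (u j, 0) | j <- s2].
  rewrite map_cat/= dfwithin; congr (_ ++ _ :: _); apply/eq_in_map => j js.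
    by rewrite dfwithout//; apply: contraNneq is1 => ->.
  by rewrite dfwithout//; apply: contraNneq is2 => ->.
rewrite !mapE (_ : ((a *: v + w, 0) : V) = a *: (v, 0) + (w, 0)); last first.
  by rewrite -[RHS]/(_, _) /= scaler0 addr0.
by rewrite (iter_derive_linear _ _ _ _ _ (real_tube x)) mulrDr mulrCA.
Qed.

(** The radius and the norm are the same at all points. The factor 4 in the radius
    gives the Taylor terms the ratio 1/4, which outweighs the factor n + 1 in the
    remainder. *)
Theorem holomorphic_analytic_germ x :
  analytic_germ (4 * taylor_constant)^-1 (fun h => G1 (x + h, 0) - G1 (x, 0))
    (L * d / 32).
Proof.
have K0 := taylor_constant_gt0; have L0 := ts_ge0 (hp_re GH).
set K := taylor_constant in K0 *; set r := (4 * K)^-1.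
have r0 : 0 < r by rewrite invr_gt0 mulr_gt0.
have Kr : K * r = 4^-1 by rewrite /r invfM mulrCA mulfV ?mulr1// gt_eqF.
have C0 : 0 <= L * d / 32 by rewrite divr_ge0// mulr_ge0// ltW.
exists (fun n => if n is 0 then fun=> 0 else fun h => @taylor_form x n (fun=> h)),
  (fun n => if n is 0 then 0 else L * d / 32 * 4^-1 ^+ n); split.
- case=> [|n]; first exact: (ga_zero (homogeneous_graded r0)).
  exists (@taylor_form x n.+1), (L * d / 32 * K ^+ n.+1); split=> //.
  + exact: taylor_form_multilinear.
  + by rewrite mulr_ge0// exprn_ge0// ltW.
  + by rewrite -mulrA -exprMn Kr.
- case=> [|n]; first by rewrite /series/= big_nil.
  apply: (@le_trans _ _ (L * d / 32 * (1 - 4^-1 ^+ n))); last first.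
    by rewrite ler_piMr// gerBl exprn_ge0.
  elim: n => [|n IH]; first by rewrite /series/= big_nat1 expr0 subrr mulr0.
  rewrite seriesSr; apply: le_trans (lerD IH (lexx _)) _ => /=.
  rewrite -mulrDr ler_wpM2l// exprS.
  have : 0 <= 4^-1 ^+ n :> R by rewrite exprn_ge0.
  by move: (4^-1 ^+ n) => q; lra.
- move=> h hr.
  pose psi n (t : R) := iter_derive (nseq n ((h, 0) : V)) G1 (x + t *: h, 0).
  have psi' k (s : R) : is_derive s 1 (psi k) (psi k.+1 s).
    have /is_derive_cvgP := ts_is_derive (iter_smooth (nseq k ((h, 0) : V))) (h, 0)
      (real_tube (x + s *: h)).
    move=> D; apply/is_derive_cvgP; move: D.
    rewrite [X in X @ _ --> _ -> _](_ : _ = fun e => e^-1 *: (psi k (e *: 1 + s) - psi k s))//.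
    apply/funext => e; rewrite /psi (_ : (x + (e *: 1 + s) *: h, 0) =
      e *: ((h, 0) : V) + (x + s *: h, 0))//.
    by rewrite -[RHS]/(_, _) /= scaler0 addr0 [e *: 1]mulr1 scalerDl addrCA.
  have psiB n s : `|psi n.+1 s| <= (n.+1)`!%:R * (L * d / 32 * 4^-1 ^+ n.+1).
    apply: le_trans (@iter_derive_bound (nseq n.+1 ((h, 0) : V)) _ (real_tube _) _) _.
      by rewrite size_nseq.
    rewrite size_nseq -/K ler_wpM2l// -mulrA ler_wpM2l//.
    rewrite (_ : \prod_(_ <- _) _ = `|h| ^+ n.+1); last first.
      by rewrite big_nseq iter_mulr_1 prod_normE/= normr0 max_l.
    rewrite -exprMn lerXn2r ?nnegrE ?mulr_ge0 ?invr_ge0 ?(ltW K0) ?(ltW d0)//.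
    by rewrite -Kr ler_wpM2l// ltW.
  have termE n : @taylor_form x n.+1 (fun=> h) = psi n.+1 0 / (n.+1)`!%:R.
    rewrite /taylor_form mulrC /psi scale0r addr0.
    rewrite (_ : [seq _ | _ <- _] = nseq n.+1 (h, 0))//.
    by rewrite -[in RHS](size_enum_ord n.+1); elim: (enum _) => //= i s ->.
  have rem n : `|(G1 (x + h, 0) - G1 (x, 0)) -
      series (fun n => (if n is 0 then fun=> 0 else fun h => @taylor_form x n (fun=> h)) h) n.+1|
      <= L * d / 32 * 2^-1 ^+ n.+1.
    have := taylor_remainder psi' (psiB n).
    have -> : psi 0%N 1 = G1 (x + h, 0) by rewrite /psi /= scale1r.
    rewrite /series/= !big_nat_recl// fact0 divr1 add0r.
    have -> : psi 0%N 0 = G1 (x, 0) by rewrite /psi /= scale0r addr0.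
    under [X in _ -> `|_ - X| <= _]eq_bigr do rewrite termE.
    move=> /le_trans rem; rewrite -addrA -opprD; apply: rem.
    have f0 : 0 < n`!%:R :> R by rewrite ltr0n fact_gt0.
    rewrite ler_pdivrMr// factS natrM.
    have n2 : n.+1%:R * 2^-1 ^+ n.+1 <= 1 :> R.
      by rewrite exprVn ler_pdivrMr ?exprn_gt0// mul1r -natrX ler_nat ltnW// ltn_expl.
    have -> : (4^-1 : R) = 2^-1 * 2^-1 by field.
    rewrite exprMn.
    have q0 : 0 <= 2^-1 ^+ n.+1 :> R by rewrite exprn_ge0.
    rewrite [leLHS](_ : _ = n.+1%:R * 2^-1 ^+ n.+1 *
      (L * d / 32 * 2^-1 ^+ n.+1 * n`!%:R)); last by ring.
    by rewrite ler_piMl// mulr_ge0 ?(ltW f0)// mulr_ge0.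
  rewrite -cvg_shiftS; apply/cvgrPdist_le => e e0.
  have half : `|2^-1| < 1 :> R by rewrite ger0_norm// invf_lt1// ltr1n.
  have /cvgrPdist_le/(_ e e0) : (fun n => L * d / 32 * 2^-1 ^+ n.+1) @ \oo --> (0 : R).
    rewrite -[X in _ --> X](mulr0 (L * d / 32)); apply: cvgM; first exact: cvg_cst.
    by rewrite cvg_shiftS; exact: cvg_expr.
  apply: filterS => n; rewrite sub0r normrN; apply: le_trans.
  by apply: le_trans (rem n) _; exact: ler_norm.
Qed.

End IteratedDerivatives.

(** * The separating function as a power series *)

Section LipschitzHolomorphic.
Context {R : realType} {X : normedModType R}.
Notation V := (X * X)%type.

(** Lipschitz conditions for Taylor's norm become Lipschitz conditions for the
    maximum norm of X * X. *)
Lemma taylor_norm_le_norm (v : complexification X) :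
  taylor_norm v <= 2 * `|v : V|.
Proof.
apply: taylor_norm_le => c s cs1.
have le1 (a b : R) : a ^+ 2 + b ^+ 2 = 1 -> `|a| <= 1.
  move=> ab1; rewrite -(@expr_le1 _ 2)// real_normK ?num_real//.
  by rewrite -ab1 lerDl sqr_ge0.
apply: le_trans (ler_normB _ _) _; rewrite !normrZ mulr2n mulrDl mul1r.
apply: lerD.
  apply: le_trans (norm_fst_le v); rewrite ler_piMl//; exact: le1 cs1.
apply: le_trans (norm_snd_le v); rewrite ler_piMl//.
by apply: (le1 s c); rewrite addrC.
Qed.

Lemma Re_le_norm (z : R[i]) (a : R) : `|z| <= a%:C%C -> `|complex.Re z| <= a.
Proof. by move=> za; rewrite -lecR; exact: le_trans (normc_ge_Re z) za. Qed.

Lemma Re_mulNi (z : R[i]) : complex.Re (- 'i%C * z) = complex.Im z.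
Proof. by case: z => a b; rewrite /= !(mul0r, mul1r, oppr0, sub0r, opprK, mulN1r, add0r). Qed.

(** The factor c = 1 gives the real part of F and c = - i its imaginary part. *)
Lemma is_derive_Re (F : complexification X -> R[i]^o) (z k : complexification X)
  (c : R[i]) : differentiable F z ->
  is_derive (z : V) (k : V) (fun w : V => complex.Re (c * F w))
    (complex.Re (c * 'd F z k)).
Proof.
move=> Fz; apply/is_derive_cvgP/cvgrPdist_le => e e0.
have := @diff_derivable _ _ _ F z k Fz; rewrite /derivable => /cvg_ex[l] Fl.
have dE : 'd F z k = l.
  by rewrite -deriveE//; apply/cvg_lim => //; exact: norm_hausdorff.
set n := complex.Re `|c|; have nE : n%:C%C = `|c| by apply: RRe_real; exact: normr_real.
have n0 : 0 <= n by rewrite -lecR nE; exact: normr_ge0.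
have c0 : 0 < e / (n + 1) by rewrite divr_gt0// ltr_wpDl.
have ec0 : 0 < (e / (n + 1))%:C%C by rewrite ltcR.
move/cvgrPdist_le : Fl => /(_ _ ec0).
move=> Fe; have [r /= r0 rB] := proj1 (nbhs_ballP _ _) Fe.
have rE : (complex.Re r)%:C%C = r by apply: RRe_real; exact: gtr0_real.
have Rr0 : 0 < complex.Re r by rewrite -ltcR rE.
near=> t.
have t0 : t != 0 by near: t; exact: nbhs_dnbhs_neq.
have tr : `|t| < complex.Re r.
  by near: t; exact: dnbhs0_lt.
have normtC : `|t%:C%C| = `|t|%:C%C by rewrite normc_def/= expr0n addr0 sqrtr_sqr.
have tB : `|l - t%:C%C^-1 *: (F (t%:C%C *: k + z) - F z)| <= (e / (n + 1))%:C%C.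
  apply: (rB t%:C%C); last by rewrite -[0]/(0%:C%C) (inj_eq (@complexI R)).
  by rewrite -ball_normE/= sub0r normrN normtC -rE ltcR.
have -> : t *: (k : V) + (z : V) = t%:C%C *: k + z.
  by rewrite -[t%:C%C *: k]/(_, _) /= !scale0r subr0 add0r.
rewrite dE; move: tB; set Fa := F _; set Fb := F z; rewrite -fmorphV => tB.
rewrite [X in `|X|](_ : _ = complex.Re (c * (l - t^-1%:C%C * (Fa - Fb)))); last first.
  by case: (c) (l) (Fa) (Fb) => [c1 c2] [l1 l2] [a1 a2] [b1 b2] /=; rewrite /GRing.scale/=; ring.
apply: Re_le_norm; rewrite normrM -nE.
apply: (@le_trans _ _ (n%:C%C * (e / (n + 1))%:C%C)).
  by rewrite ler_wpM2l// lecR.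
rewrite -rmorphM lecR mulrCA ler_piMr ?(ltW e0)// ler_pdivrMr ?mul1r ?lerDl//.
by rewrite ltr_wpDl.
Unshelve. all: by end_near. Qed.

Section Extension.
Variables (d : R) (F : complexification X -> R[i]^o).
Hypotheses (F_holo : holomorphic_on (strip d) F)
  (F_lip : [lipschitz F z | z in strip d]).

Let scale_real (a : R) (k : complexification X) : a *: (k : V) = a%:C%C *: k.
Proof. by rewrite -[RHS]/(_, _) /= !scale0r subr0 add0r. Qed.

Let scale_i (k : complexification X) : mul_i (k : V) = 'i%C *: k.
Proof. by rewrite -[RHS]/(_, _) /= !scale0r !scale1r sub0r addr0. Qed.

Let derive_Re (c : R[i]) (z k : V) : tube d z ->
  'D_k (fun w : V => complex.Re (c * F w)) z = complex.Re (c * 'd F (z : complexification X) k).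
Proof. by move=> zd; have [_ ->] := is_derive_Re k c (F_holo zd). Qed.

Let Re_tube (M c : R[i]) : 0 < M ->
  (forall z w : complexification X, strip d z -> strip d w -> `|F z - F w| <= M * `|z - w|) ->
  `|c| = 1 -> tube_smooth d (2 * complex.Re M) (fun z : V => complex.Re (c * F z)).
Proof.
move=> M0 FM c1.
have ME : (complex.Re M)%:C%C = M by apply: RRe_real; exact: gtr0_real.
have RM0 : 0 < complex.Re M by rewrite -ltcR ME.
split.
- by rewrite mulr_ge0// ltW.
- move=> z w zd wd.
  rewrite [X in `|X|](_ : _ = complex.Re (c * (F z - F w))); last first.
    by rewrite mulrBr raddfB.
  apply: Re_le_norm; rewrite normrM c1 mul1r; apply: le_trans (FM z w zd wd) _.
  rewrite -ME; change ((complex.Re M)%:C%C *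
    (taylor_norm ((z : complexification X) - w))%:C%C <= (2 * complex.Re M * `|z - w|)%:C%C).
  rewrite -rmorphM lecR.
  by rewrite [2 * _]mulrC -mulrA ler_wpM2l ?(ltW RM0)//; exact: taylor_norm_le_norm.
- by move=> z k zd; have [] := is_derive_Re k c (F_holo zd).
- move=> z a h k zd; rewrite !derive_Re// scale_real.
  rewrite -[RHS](_ : complex.Re (a%:C%C * (c * 'd F (z : complexification X) h)
    + c * 'd F (z : complexification X) k) = _); last first.
    case: (c * 'd F _ h) (c * 'd F _ k) => [x y] [x' y'] /=; ring.
  by rewrite mulrCA -mulrDr; congr (complex.Re (_ * _)); rewrite linearP.
Qed.

Lemma lipschitz_holomorphic_pair : exists L,
  holomorphic_pair d L (fun z : V => complex.Re (F z)) (fun z => complex.Im (F z)).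
Proof.
have [M M0 FM'] : exists2 M : R[i], 0 < M &
    M.-lipschitz_(strip d) (F : complexification X -> R[i]^o).
  by apply: (pinfty_ex_gt _ F_lip); exact: real0.
have FM (z w : complexification X) : strip d z -> strip d w -> `|F z - F w| <= M * `|z - w|.
  by move=> zd wd; exact: (FM' (z, w)).
have ReE : (fun z : V => complex.Re (F z)) = (fun z : V => complex.Re (1 * F z)).
  by apply/funext => z; rewrite mul1r.
have ImE : (fun z : V => complex.Im (F z)) = (fun z : V => complex.Re (- 'i%C * F z)).
  by apply/funext => z; rewrite Re_mulNi.
exists (2 * complex.Re M); rewrite ReE ImE; split.
- by apply: Re_tube => //; exact: normr1.
- apply: Re_tube => //.
  by rewrite normrN normc_def /= expr0n add0r expr1n sqrtr1.
- move=> z k zd; rewrite !derive_Re// scale_i linearZ/=.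
  by rewrite mul1r mulNr raddfN /= opprK.
- move=> z k zd; rewrite !derive_Re// scale_i linearZ/=.
  by rewrite /GRing.scale/= mulrA mulNr -expr2 sqr_i opprK mul1r.
Qed.

End Extension.
End LipschitzHolomorphic.

(** * Lipschitz constants, separability and rescaling *)

Section LipschitzConstant.
Context {R : realType} {X : normedModType R}.
Implicit Types f g : X -> R.

Lemma lipschitz_of_bound f (k : R) :
  (forall x y, `|f x - f y| <= k * `|x - y|) -> lipschitz f.
Proof.
move=> fk; apply: (@klipschitzW _ _ _ k); last by move=> [x y] _; exact: fk.
exact: (@globally_properfilter _ _ (0, 0)).
Qed.

Lemma Lip_le f (k : R) : 0 <= k ->
  (forall x y, `|f x - f y| <= k * `|x - y|) -> (Lip f <= k%:E)%E.
Proof.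
move=> k0 fk; apply: ge_ereal_sup => _ [[x y] _ <-] /=; rewrite lee_fin.
have [->|xy] := eqVneq x y; first by rewrite !subrr normr0 mul0r.
by rewrite ler_pdivrMr ?fk// normr_gt0 subr_eq0.
Qed.

Lemma lipschitz_Lip f : lipschitz f -> exists l : R,
  [/\ 0 <= l, Lip f = l%:E & forall x y, `|f x - f y| <= l * `|x - y|].
Proof.
move=> /pinfty_ex_gt0[k k0 fk].
have ub : (Lip f <= k%:E)%E.
  by apply: Lip_le (ltW k0) _ => x y; exact: (fk (x, y)).
have lb x y : ((`|f x - f y| / `|x - y|)%:E <= Lip f)%E.
  by apply: ereal_sup_ubound; exists (x, y).
have ge0 : (0 <= Lip f)%E.
  by apply: le_trans (lb 0 0); rewrite lee_fin divr_ge0.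
have fin : Lip f \is a fin_num by rewrite ge0_fin_numE// (le_lt_trans ub)// ltry.
exists (fine (Lip f)); rewrite fineK//; split=> //; first exact: fine_ge0.
move=> x y; have [->|xy] := eqVneq x y; first by rewrite subrr normr0 mulr_ge0// fine_ge0.
rewrite -ler_pdivrMr ?normr_gt0 ?subr_eq0// -lee_fin fineK//.
Qed.

Lemma separable_net : separable_space X ->
  exists xs : nat -> X, forall x, exists n, `|x - xs n| < 1.
Proof.
move=> [D /countable_injP[c cinj] D_dense].
exists (fun n => xget 0 [set x | D x /\ c x = n]) => x.
have [|y []] := D_dense (ball x 1) _ (ball_open x (1 : R)).
  by exists x; exact: ballxx.
rewrite -ball_normE/= => xy Dy; exists (c y).
rewrite (@xget_unique _ _ _ y)// => z [Dz czy].
by apply: cinj; rewrite ?inE.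
Qed.

Lemma locally_analytic_cst (c : R) : locally_analytic (fun _ : X => c).
Proof.
by move=> x; exists 1, `|c|; split=> //; exact: (na_cst (analytic_germ_algebra ltr01)).
Qed.

Lemma locally_analytic_rescale (a r : R) g : 0 < r -> locally_analytic g ->
  locally_analytic (fun x => a * g (r *: x)).
Proof.
move=> r0 ga x; have [s [B [s0 gB]]] := ga (r *: x).
have sr0 : 0 < s / r by rewrite divr_gt0.
exists (s / r), (`|a| * B); split=> //.
have NA := @analytic_germ_algebra R X (s / r) sr0.
under eq_fun do rewrite scalerDr.
exact: (na_scale NA) (analytic_germ_comp_scale r0 gB).
Qed.

End LipschitzConstant.

Lemma separating_analytic_germs {R : realType} {X : normedModType R} (Q : X -> R) :
  has_lipschitz_holomorphic_extension Q -> exists L r B,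
    [/\ 0 < L, 0 < r, forall x y, `|Q x - Q y| <= L * `|x - y| &
        forall x, analytic_germ r (fun h => Q (x + h) - Q x) B].
Proof.
move=> [d [d0 [F [FQ F_holo F_lip]]]].
have [L FH] := lipschitz_holomorphic_pair F_holo F_lip.
have QE x : Q x = complex.Re (F (x, 0)) by rewrite FQ.
have L0 : 0 <= L := ts_ge0 (hp_re FH).
exists (L + 1), (4 * taylor_constant d)^-1, (L * d / 32); split.
- by rewrite ltr_wpDl.
- by rewrite invr_gt0 mulr_gt0// taylor_constant_gt0.
- move=> x y; rewrite !QE.
  apply: le_trans (ts_lipschitz (hp_re FH) _ _) _; rewrite /tube/= ?normr0//.
  rewrite prod_normE/= subr0 normr0 max_l//.
  by rewrite ler_wpM2r// lerDl.
- move=> x; have := holomorphic_analytic_germ FH d0 x.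
  by rewrite -QE; under eq_fun do rewrite -QE.
Qed.

Theorem theorem2 (R : realType) (X : completeNormedModType R)
    (X_separable : separable_space X)
    (Q : X -> R) (Q_separating : separating_function Q)
    (Q_extension : has_lipschitz_holomorphic_extension Q) :
  exists C : R, 1 <= C /\
    forall f : X -> R, lipschitz f ->
    forall eps : R, 0 < eps ->
    exists g : X -> R,
      [/\ lipschitz g, real_analytic g,
          (forall x, `|f x - g x| < eps) &
          (Lip g <= C%:E * Lip f)%E].
Proof.
have [xs xs_net] := separable_net X_separable.
have [Q0 Qat0 [M [m [M0 m0 Qsep]]]] := Q_separating.
have [L [r [B [L0 r0 Qlip Qan]]]] := separating_analytic_germs Q_extension.
have M1 : 1 <= Num.max M 1 by rewrite le_max lexx orbT.
have Qsep1 x : Num.max M 1 <= `|x| -> m * `|x| <= Q x.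
  by rewrite ge_max => /andP[Mx _]; exact: Qsep.
have [C [E approx]] := coarse_approximation xs_net L0 M1 m0 r0 Q0 Qat0 Qsep1 Qlip Qan.
exists (Num.max 1 C); split; first by rewrite le_max lexx.
move=> f f_lip eps eps0.
have [l [l0 lE fl]] := lipschitz_Lip f_lip.
have [l_eq0|l_neq0] := eqVneq l 0.
  exists f; split=> //.
  - apply: locally_analytic_real_analytic.
    rewrite (_ : f = fun=> f 0); first exact: locally_analytic_cst.
    apply/funext => x; apply/eqP; rewrite -subr_eq0 -normr_le0.
    by have := fl x 0; rewrite l_eq0 mul0r.
  - by move=> x; rewrite subrr normr0.
  - by rewrite lE l_eq0 mule0.
have {l_neq0}l0' : 0 < l by rewrite lt_neqAle eq_sym l_neq0.
(* Applied to f (s x) / (l s), which is 1-Lipschitz, the coarse approximation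
   yields the error l s E, and s is such that it is less than eps. *)
pose s : R := eps / (l * (`|E| + 1)).
have E1 : 0 < `|E| + 1 by rewrite ltr_wpDl.
have s0 : 0 < s by rewrite divr_gt0// mulr_gt0.
have ls0 : 0 < l * s by rewrite mulr_gt0.
have [x y|g [gC gE ga]] := approx (fun x => (l * s)^-1 * f (s *: x)).
  rewrite -mulrBr normrM gtr0_norm ?invr_gt0// ler_pdivrMl//.
  by apply: le_trans (fl _ _) _; rewrite -scalerBr normrZ gtr0_norm// mulrA.
pose g' x := l * s * g (s^-1 *: x).
have g'C x y : `|g' x - g' y| <= Num.max 1 C * l * `|x - y|.
  rewrite -mulrBr normrM gtr0_norm//.
  apply: (@le_trans _ _ (l * s * (C * `|s^-1 *: x - s^-1 *: y|))).
    by rewrite ler_wpM2l ?gC// ltW.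
  rewrite -scalerBr normrZ gtr0_norm ?invr_gt0//.
  rewrite [leLHS](_ : _ = C * (l * `|x - y|)); last by field; rewrite gt_eqF.
  by rewrite -mulrA ler_wpM2r ?mulr_ge0// le_max lexx orbT.
exists g'; split.
- exact: lipschitz_of_bound g'C.
- apply: locally_analytic_real_analytic.
  by apply: locally_analytic_rescale; rewrite ?invr_gt0.
- move=> x; have := gE (s^-1 *: x); rewrite scalerA divff ?gt_eqF// scale1r => gx.
  rewrite /g' -[f x](mulVKf (lt0r_neq0 ls0)) -mulrBr normrM gtr0_norm//.
  apply: le_lt_trans (ler_wpM2l (ltW ls0) gx) _.
  have -> : l * s = eps / (`|E| + 1) by rewrite /s; field; rewrite !gt_eqF.
  rewrite mulrAC ltr_pdivrMr// ltr_pM2l//.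
  by rewrite (le_lt_trans (ler_norm E))// ltrDl.
- rewrite lE -EFinM; apply: Lip_le => //.
  by rewrite mulr_ge0// le_max ler01.
Qed.
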